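(* Let $P\subset\mathbb{P}H^0(\mathbb{P}^4_{\mathbb{Q}},\mathcal{O}_{\mathbb{P}^4}(2))=\mathbb{P}^{14}_{\mathbb{Q}}$ be a general $4$-plane through the points $[Q_0: 6x_0^2-3x_1^2+2x_2^2-x_3^2=0]$ and $[Q_1: x_0x_1+x_2x_3=0]$ of $\mathbb{P}^{14}(\mathbb{Q})$. Then $$\emptyset\neq\overline{Y_P(\mathbb{Q})}\subsetneq Y_P(\mathbb{A}_{\mathbb{Q}}),$$ and so $Y_P$ does not satisfy weak approximation. Here ''general'' means: there is a nonempty Zariski open subset $U$ of the parameter space (a Grassmannian over $\mathbb{Q}$) of $4$-planes through the two points such that the conclusion holds for every $P\in U(\mathbb{Q})$.
   Context: A $4$-plane $P\simeq\mathbb{P}^4_{(t_0:\dots:t_4)}\subset\mathbb{P}H^0(\mathbb{P}^4,\mathcal{O}(2))\simeq\mathbb{P}^{14}_{\mathbb{Q}}$ is spanned by five linearly independent quadratic forms $Q_0,\dots,Q_4$ over $\mathbb{Q}$ in $x_0,\dots,x_4$; for $t\in P$, $Q_t$ is the quadric $\sum_it_iQ_i=0$ in $\mathbb{P}^4$. Let $H\subset P$ be the locus of singular quadrics and $Z_P=\{(t,[\Lambda])\in P\times\mathbb{G}(2,\mathbb{P}^4):\Lambda\subset Q_t\}$, where $\mathbb{G}(2,\mathbb{P}^4)$ is the Grassmannian of $2$-planes in $\mathbb{P}^4$. The projection $Z_P\to P$ has image $H$, and $Y_P$ is the middle term of its Stein factorization $Z_P\to Y_P\to H\subset P$. (For general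 $P$, $Y_P$ is a smooth Calabi--Yau threefold, a double cover of $H$ whose points are singular quadrics in $P$ together with a ruling by $2$-planes.) $Y(\mathbb{A}_{\mathbb{Q}})=\prod_vY(\mathbb{Q}_v)$ over all places $v$ of $\mathbb{Q}$, with the product topology, and $\overline{Y(\mathbb{Q})}$ is the closure of the diagonally embedded $Y(\mathbb{Q})$. A smooth projective $Y$ with $Y(\mathbb{A}_{\mathbb{Q}})\ne\emptyset$ satisfies weak approximation if $\overline{Y(\mathbb{Q})}=Y(\mathbb{A}_{\mathbb{Q}})$. *)

(* Defs.v *)
(* The notations of multinomials clash with those of analysis. *)
From HB Require Import structures.
From mathcomp Require Import all_boot all_order all_algebra all_field.
From mathcomp Require Import all_classical reals topology.
From mathcomp Require Import -(notations) mpoly.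

Set Implicit Arguments.
Unset Strict Implicit.
Unset Printing Implicit Defensive.

Import Order.TTheory GRing.Theory Num.Theory.

Local Open Scope classical_set_scope.
Local Open Scope ring_scope.
Local Open Scope quotient_scope.

Variant place := Archimedean | Padic (p : nat) of prime p.

Definition padic_norm (p : nat) (x : rat) : rat :=
  if x == 0 then 0
  else p%:R ^+ logn p `|denq x|%N / p%:R ^+ logn p `|numq x|%N.

Definition place_norm (v : place) (x : rat) : rat :=
  match v with
  | Archimedean => `|x|
  | Padic p _ => padic_norm p x
  end.

(* Any complete field with an absolute value that contains the rationals, with
   the absolute value of [v], as a dense subfield; it is unique up to a unique
   isometric isomorphism. *)
Record completion (R : realType) (v : place) := Completion {
  compl_field :> fieldType;
  compl_norm : compl_field -> R;
  compl_embed : {rmorphism rat -> compl_field};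
  compl_norm_eq0 : forall x, compl_norm x = 0 -> x = 0;
  compl_normM : forall x y, compl_norm (x * y) = compl_norm x * compl_norm y;
  compl_normD : forall x y, compl_norm (x + y) <= compl_norm x + compl_norm y;
  compl_norm_embed : forall q, compl_norm (compl_embed q) = ratr (place_norm v q);
  compl_dense : forall x (e : R), 0 < e ->
    exists q, compl_norm (x - compl_embed q) < e;
  compl_complete : forall u : nat -> compl_field,
    (forall e : R, 0 < e -> exists N, forall m n,
       (N <= m)%N -> (N <= n)%N -> compl_norm (u m - u n) < e) ->
    exists l, forall e : R, 0 < e -> exists N, forall n,
       (N <= n)%N -> compl_norm (u n - l) < e }.

Definition Qcompl (R : realType) (v : place) (C : completion R v) : Type := C.

Section CompletionTopology.
Context (R : realType) (v : place) (C : completion R v).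
Local Notation K := (Qcompl C).

HB.instance Definition _ := GRing.Field.copy K (compl_field C).

Local Notation norm := (@compl_norm R v C).

Definition compl_nbhs (x : K) : set_system K :=
  filter_from [set e : R | 0 < e] (fun e => [set y : K | norm (y - x) < e]).

Let norm0 : norm 0 = 0.
Proof.
rewrite -(rmorph0 (compl_embed C)) compl_norm_embed.
have -> : place_norm v 0 = 0.
  by case: v => [|p _] /=; rewrite ?normr0 // /padic_norm eqxx.
exact: rmorph0.
Qed.

Let nbhs_pfilter (x : K) : ProperFilter (compl_nbhs x).
Proof.
apply: filter_from_proper.
  apply: filter_from_filter; first by exists 1; rewrite /= ltr01.
  move=> e1 e2 /= e1_gt0 e2_gt0; exists (Num.min e1 e2).
    by rewrite /= lt_min e1_gt0.
  by move=> y /=; rewrite lt_min => /andP[].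
by move=> e /= e_gt0; exists x; rewrite /= subrr norm0.
Qed.

Let nbhs_singl (x : K) (A : set K) : compl_nbhs x A -> A x.
Proof. by move=> [e /= e_gt0]; apply; rewrite /= subrr norm0. Qed.

Let nbhs_nbhs_ (x : K) (A : set K) : compl_nbhs x A -> compl_nbhs x (compl_nbhs^~ A).
Proof.
move=> [e /= e_gt0 eA]; exists e => // y /= xy.
exists (e - norm (y - x)); first by rewrite /= subr_gt0.
move=> z /=; rewrite ltrBrDr => zy; apply: eA => /=; apply: le_lt_trans zy.
by rewrite -[z - x](subrKA y) compl_normD.
Qed.

HB.instance Definition _ := hasNbhs.Build K compl_nbhs.
HB.instance Definition _ :=
  Nbhs_isNbhsTopological.Build K nbhs_pfilter nbhs_singl nbhs_nbhs_.

End CompletionTopology.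

Definition homogeneous (n : nat) (K : fieldType) (d : nat) (F : mpoly n K) : bool :=
  all (fun m => mdeg m == d) (msupp F).

Notation form5 K := (mpoly 5 K).

Definition xvar (K : fieldType) (i : nat) : form5 K :=
  mpolyX K (mnm1 (inord i : 'I_5)).

Definition Q0 (K : fieldType) : form5 K :=
  6%:R *: xvar K 0 ^+ 2 - 3%:R *: xvar K 1 ^+ 2
  + 2%:R *: xvar K 2 ^+ 2 - xvar K 3 ^+ 2.

Definition Q1 (K : fieldType) : form5 K :=
  xvar K 0 * xvar K 1 + xvar K 2 * xvar K 3.

(* [q] is a basis of (the cone over) a 4-plane in P H^0(P^4, O(2)). *)
Definition four_plane (K : fieldType) (q : 'I_5 -> form5 K) : Prop :=
  (forall i, homogeneous 2 (q i)) /\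
  (forall c : 'I_5 -> K, \sum_i c i *: q i = 0 -> forall i, c i = 0).

Definition in_plane (K : fieldType) (q : 'I_5 -> form5 K) (g : form5 K) : Prop :=
  exists c : 'I_5 -> K, g = \sum_i c i *: q i.

Definition plane_through_Q0_Q1 (K : fieldType) (q : 'I_5 -> form5 K) : Prop :=
  [/\ four_plane q, in_plane q (Q0 K) & in_plane q (Q1 K)].

(* The maximal minors of the k vectors [A 0], ..., [A (k - 1)], one for each
   k-tuple of columns: the Pluecker coordinates of their span, with the usual
   redundancies (signs and zeros). *)
Definition plucker (K : fieldType) (k : nat) (I : finType) (A : 'I_k -> I -> K)
    (j : 'I_#|{ffun 'I_k -> I}|) : K :=
  \det (\matrix_(r, s) A r (enum_val j s)).

Definition quad_coef (K : fieldType) (g : form5 K) (ij : 'I_5 * 'I_5) : K :=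
  mcoeff (mnm_add (mnm1 ij.1) (mnm1 ij.2)) g.

(* Polynomials over the rationals in the Pluecker coordinates of the
   Grassmannian of 4-planes of quadrics. *)
Notation plane_poly := (mpoly #|{ffun 'I_5 -> 'I_5 * 'I_5}| rat).

(* The Zariski open subset of the Grassmannian that is the complement of the
   common zero locus of the members of [U] contains the plane spanned by [q]. *)
Definition in_zariski_open (U : seq plane_poly) (K : fieldType)
    (q : 'I_5 -> form5 K) : Prop :=
  exists2 F, F \in U &
    meval (plucker (fun i => quad_coef (q i)))
                (map_mpoly (ratr : rat -> K) F) != 0.

(* [U] defines a nonempty open subset, over the rationals, of the variety of
   4-planes through [Q0] and [Q1]; nonemptiness is tested over the algebraic
   closure [algC] of the rationals. *)
Definition nonempty_zariski_open (U : seq plane_poly) : Prop :=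
  (forall F, F \in U -> exists d, homogeneous d F) /\
  (exists2 q : 'I_5 -> form5 algC, plane_through_Q0_Q1 q & in_zariski_open U q).

Section Incidence.
Context (q : 'I_5 -> form5 rat).

Definition Qt (t : 'rV[algC]_5) : form5 algC :=
  \sum_i t 0 i *: map_mpoly (ratr : rat -> algC) (q i).

(* Points of Z_P over [algC], given by homogeneous coordinates [t] of a point of
   P and by a basis of the 3-space over the 2-plane, the rows of [M]. *)
Definition Z : set ('rV[algC]_5 * 'M[algC]_(3, 5)) :=
  [set tM | [/\ tM.1 != 0, \rank tM.2 = 3%N &
    forall x : 'rV[algC]_5, (x <= tM.2)%MS -> meval (x 0) (Qt tM.1) = 0]].

(* Polynomials in t_0, ..., t_4 and the Pluecker coordinates of G(2, P^4). *)
Notation nvars := (5 + #|{ffun 'I_3 -> 'I_5}|)%N.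

Definition bihomogeneous (a b : nat) (F : mpoly nvars rat) : bool :=
  all (fun m : multinom nvars =>
         (\sum_i m (lshift _ i) == a)%N && (\sum_j m (rshift 5 j) == b)%N)
      (msupp F).

Definition Z_coords (z : Z) (i : 'I_nvars) : algC :=
  match fintype.split i with
  | inl i => (val z).1 0 i
  | inr j => plucker (val z).2 j
  end.

Definition Z_eval (F : mpoly nvars rat) (z : Z) : algC :=
  meval (Z_coords z) (map_mpoly (ratr : rat -> algC) F).

(* H^0(Z_P, f^* O(d)) for the projection f : Z_P -> P, over the rationals: the
   functions that are, locally on Z_P, quotients of bihomogeneous polynomials
   with rational coefficients whose bidegrees differ by (d, 0). *)
Definition sections (d : nat) : set (Z -> algC) :=
  [set s | forall z : Z, exists a b F G,
     [/\ bihomogeneous (a + d) b F, bihomogeneous a b G, Z_eval G z != 0 &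
         forall z' : Z, Z_eval G z' != 0 -> s z' = Z_eval F z' / Z_eval G z']].

(* The middle term Y_P = Spec_P (f_* O_Z) of the Stein factorization is finite
   over P, so that the pullback of O_P(1) is ample on it and
     Y_P = Proj S  with  S = \bigoplus_d H^0(P, f_* O_Z (d)) = \bigoplus_d H^0(Z_P, f^* O(d)).
   As Y_P is covered by the affine open sets t_i <> 0, with t_i of degree 1, its
   points over a field K are the ring homomorphisms S -> K that do not kill
   all t_i, up to the action of K^* by c . phi = (c ^ d phi_d)_d.
   Below, [cone K] is the set of these homomorphisms, each given by its
   restrictions to the homogeneous parts of S, and [Y K] is Y_P(K). *)
Definition cone (K : fieldType) : set (forall d, sections d -> K) :=
  [set phi |
    [/\ forall s : sections 0, (forall z, val s z = 1) -> phi 0%N s = 1,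
        forall d (s1 s2 s : sections d),
          (forall z, val s z = val s1 z + val s2 z) ->
          phi d s = phi d s1 + phi d s2,
        forall d e (s1 : sections d) (s2 : sections e) (s : sections (d + e)),
          (forall z, val s z = val s1 z * val s2 z) ->
          phi (d + e)%N s = phi d s1 * phi e s2 &
        exists i (s : sections 1), (forall z, val s z = (val z).1 0 i) /\
          phi 1%N s != 0]].

Arguments cone K : clear implicits.

Definition Cone (K : fieldType) : Type := cone K.
HB.instance Definition _ (K : fieldType) := Choice.on (Cone K).

Definition scale_rel (K : fieldType) (phi psi : Cone K) : bool :=
  `[< exists2 c : K, c != 0 & forall d s, val psi d s = c ^+ d * val phi d s >].

Lemma scale_rel_equiv (K : fieldType) : equiv_class_of (@scale_rel K).
Proof.
split=> [phi|phi psi|phi psi chi].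
- by apply/asboolP; exists 1; rewrite ?oner_eq0 // => d s; rewrite expr1n mul1r.
- have sym (f g : Cone K) : scale_rel f g -> scale_rel g f.
    move=> /asboolP[c c0 fg]; apply/asboolP; exists c^-1; first by rewrite invr_eq0.
    by move=> d s; rewrite fg exprVn mulKf // expf_neq0.
  by apply/idP/idP; apply: sym.
- move=> /asboolP[c c0 fg] /asboolP[c' c'0 gh]; apply/asboolP.
  exists (c' * c); first by rewrite mulf_neq0.
  by move=> d s; rewrite gh fg exprMn mulrA.
Qed.

Canonical scale_equiv (K : fieldType) : equiv_rel (Cone K) :=
  EquivRelPack (scale_rel_equiv K).

Definition Y (K : fieldType) : Type := {eq_quot scale_equiv K}.
HB.instance Definition _ (K : fieldType) := Quotient.on (Y K).

Lemma cone_comp (K L : fieldType) (f : {rmorphism K -> L}) (phi : Cone K) :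
  (fun d s => f (val phi d s)) \in cone L.
Proof.
case: phi => phi /= /[!inE] -[h1 hD hM [i [s [hs sN0]]]].
split=> [s0 hs0|d s1 s2 s0 hs0|d e s1 s2 s0 hs0|].
- by rewrite h1 ?rmorph1.
- by rewrite (hD _ _ _ _ hs0) rmorphD.
- by rewrite (hM _ _ _ _ _ hs0) rmorphM.
- by exists i, s; split=> //; rewrite fmorph_eq0.
Qed.

Definition Cone_map (K L : fieldType) (f : {rmorphism K -> L}) (phi : Cone K) : Cone L :=
  exist (fun psi => psi \in cone L) _ (cone_comp f phi).

Definition Y_map (K L : fieldType) (f : {rmorphism K -> L}) (y : Y K) : Y L :=
  \pi_(Y L) (Cone_map f (repr y)).

Lemma Y_mapE (K L : fieldType) (f : {rmorphism K -> L}) (phi : Cone K) :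
  Y_map f (\pi_(Y K) phi) = \pi_(Y L) (Cone_map f phi).
Proof.
apply/eqmodP => /=; case: piP => psi /eqmodP /= /asboolP[c c0 h].
apply/asboolP; exists (f c^-1); first by rewrite fmorph_eq0 invr_eq0.
move=> d s /=; rewrite h -rmorphXn -rmorphM exprVn mulKf // expf_neq0 //.
Qed.

Section Local.
Context (R : realType) (v : place) (C : completion R v).

(* The v-adic topology on the points of the affine cone over Y_P is the
   topology of pointwise convergence (the coarsest one for which regular
   functions are continuous); Y_P(Q_v) carries the quotient topology. *)
HB.instance Definition _ := Topological.copy (Cone (Qcompl C))
  (set_type (cone (Qcompl C) :
     set (prod_topology (fun d => prod_topology (fun _ : sections d => Qcompl C))))).

Definition Y_local : Type := quotient_topology (Y (Qcompl C)).
HB.instance Definition _ := Topological.on Y_local.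

End Local.

Section Adelic.
Context (R : realType) (Qv : forall v : place, completion R v).

(* Y_P is projective, so Y_P(A_Q) is the full product over all places. *)
Definition Y_adelic : topologicalType := prod_topology (fun v => Y_local (Qv v)).

Definition Y_diagonal (y : Y rat) : Y_adelic :=
  fun v => Y_map (compl_embed (Qv v) : {rmorphism rat -> Qcompl (Qv v)}) y.

Definition Y_rational_closure : set Y_adelic := closure (range Y_diagonal).

Definition Y_weak_approximation : Prop := Y_rational_closure = setT.

End Adelic.

End Incidence.

Arguments Y_rational_closure q {R} Qv.
Arguments Y_weak_approximation q {R} Qv.

(* Main.v *)
Require Import Defs.
From mathcomp Require Import all_boot all_order all_algebra all_field perm ring lra zify.

(* For a symmetric matrix A of rank 4 with A = B + 0, det B is a square exactly
   when the rulings of the quadric are defined over the ground field, and then B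
   is a multiple of the norm form <1, -a, -b, ab> of a quaternion algebra.  A
   point of Y_P picks a ruling, and the corresponding square root of a principal
   4x4 minor of the pencil is a section of O(4) on Z_P (a quotient of
   determinants, [ruling_root]); so at a rational point of Y_P off a proper
   closed subset the quadric is governed by a quaternion algebra over Q.  If that
   algebra splits at all odd primes and at infinity, then it also splits at 2,
   which Legendre's descent proves without a reciprocity law.

   Q0 lifts to a rational point y0 of Y_P whose algebra is not split at 2, and Q1
   to a point y1 whose algebra is split.  Take the adelic point that is y0 at 2
   and y1 at the remaining places.  Near it the algebra is split at infinity and
   at any finite set of odd primes but not at 2.  If P is general, then there is
   S such that, for odd p not dividing S, all quadrics of P have rank at least 3
   modulo p, so that their algebras split at p: the 3x3 minors of the pencil span
   the cubic forms on P, because they do for one explicit plane.  Hence no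
   rational point of Y_P is close to the adelic point.

   Splitting at v is expressed by the failure of the v-adic Cauchy-Schwarz
   inequality for the bilinear form, which is an open condition. *)

Set Implicit Arguments.
Unset Strict Implicit.
Unset Printing Implicit Defensive.

Import Order.TTheory GRing.Theory Num.Theory.

Local Open Scope ring_scope.

(** * p-adic absolute values *)

(** The tests are inequalities between absolute values of rational numbers: test vectors are always
    rational and no equation is solved in a completion. Up to sign, Q0 is the norm form of the
    algebra (-3, 2), which is ramified at 2 and 3, whereas Q1 is split; near the mixed adelic point
    the algebra would be ramified at 2 alone.

    The discriminant 36 of Q0 is a square, so its rulings are rational, but no 2-plane in them is,
    since Q0 has no rational zero off its vertex. So y0 does not come from a rational point of Z_P.
    It is found over the field generated by theta, with theta^2 = -3: a section is constant on the
    projective line of 2-planes in a ruling, and complex conjugation preserves the ruling, so the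
    values of sections are rational.

    A point of Y_P is a homomorphism on a ring of sections whose structure is never computed. The
    proof evaluates it on polynomials in the coordinates and on [ruling_root], a section of degree 2
    whose square is the 4x4 minor, of degree 4. *)

Section PadicNorm.
Variables (p : nat) (p_prime : prime p).

Let p_gt0 : 0 < p%:R :> rat. Proof. by rewrite ltr0n prime_gt0. Qed.
Let p_neq0 : p%:R != 0 :> rat. Proof. by rewrite gt_eqF. Qed.
Let pX_neq0 k : p%:R ^+ k != 0 :> rat. Proof. by rewrite expf_neq0. Qed.

Lemma padic_norm0 : padic_norm p 0 = 0.
Proof. by rewrite /padic_norm eqxx. Qed.

Lemma padic_norm_frac (n d : int) : n != 0 -> d != 0 ->
  padic_norm p (n%:~R / d%:~R) = p%:R ^+ logn p `|d|%N / p%:R ^+ logn p `|n|%N.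
Proof.
move=> n0 d0; have nd0 : n%:~R / d%:~R != 0 :> rat.
  by rewrite mulf_neq0 ?invr_eq0 ?intr_eq0.
rewrite /padic_norm (negPf nd0); move: (divq_num_den (n%:~R / d%:~R)); set x := n%:~R / d%:~R => xE.
apply/eqP; rewrite eqr_div //; apply/eqP; rewrite -!exprD; congr (_ ^+ _).
rewrite -!lognM ?absz_gt0 ?denq_neq0 ?numq_eq0 //; congr logn.
have : (numq x)%:~R * d%:~R = n%:~R * (denq x)%:~R :> rat.
  by apply/eqP; rewrite -eqr_div ?intr_eq0 ?denq_neq0 // xE.
by rewrite -!intrM => /intr_inj E; rewrite -!abszM mulrC -E mulrC.
Qed.

Lemma padic_norm_int (n : int) : n != 0 ->
  padic_norm p n%:~R = (p%:R ^+ logn p `|n|%N)^-1.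
Proof.
by move=> n0; rewrite -[n%:~R]divr1 -[1]/(1%:~R) padic_norm_frac // logn1 expr0 mul1r.
Qed.

Lemma padic_norm1 : padic_norm p 1 = 1.
Proof. by rewrite (padic_norm_int (n := 1)) // logn1 expr0 invr1. Qed.

Lemma padic_normM (x y : rat) : padic_norm p (x * y) = padic_norm p x * padic_norm p y.
Proof.
have [->|x0] := eqVneq x 0; first by rewrite mul0r padic_norm0 mul0r.
have [->|y0] := eqVneq y 0; first by rewrite mulr0 padic_norm0 mulr0.
rewrite -[x]divq_num_den -[y]divq_num_den mulf_div -!intrM.
rewrite !padic_norm_frac ?mulf_neq0 ?denq_neq0 ?numq_eq0 //.
rewrite !abszM !lognM ?absz_gt0 ?denq_neq0 ?numq_eq0 // !exprD.
by rewrite mulf_div.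
Qed.

Lemma padic_norm_ge0 (x : rat) : 0 <= padic_norm p x.
Proof.
by rewrite /padic_norm; case: ifP => // _; rewrite divr_ge0 ?exprn_ge0 ?ltW.
Qed.

Lemma padic_norm_gt0 (x : rat) : (0 < padic_norm p x) = (x != 0).
Proof.
rewrite /padic_norm; case: eqVneq => //= _.
by rewrite divr_gt0 ?exprn_gt0.
Qed.

Lemma padic_norm_eq0 (x : rat) : (padic_norm p x == 0) = (x == 0).
Proof.
by have := padic_norm_gt0 x; rewrite lt_def padic_norm_ge0 andbT => /negb_inj.
Qed.

Lemma padic_normN (x : rat) : padic_norm p (- x) = padic_norm p x.
Proof. by rewrite /padic_norm oppr_eq0 numqN denqN abszN. Qed.

Lemma padic_normX (x : rat) k : padic_norm p (x ^+ k) = padic_norm p x ^+ k.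
Proof.
by elim: k => [|k IH]; rewrite ?expr0 ?padic_norm1 // !exprS padic_normM IH.
Qed.

Lemma padic_normV (x : rat) : padic_norm p x^-1 = (padic_norm p x)^-1.
Proof.
have [->|x0] := eqVneq x 0; first by rewrite invr0 !padic_norm0 ?invr0.
apply: (mulfI (x := padic_norm p x)); first by rewrite padic_norm_eq0.
by rewrite -padic_normM !divff ?padic_norm1 // padic_norm_eq0.
Qed.

Lemma padic_norm_int_le1 (n : int) : padic_norm p n%:~R <= 1.
Proof.
have [->|n0] := eqVneq n 0; first by rewrite padic_norm0.
rewrite padic_norm_int // invf_le1 ?exprn_gt0 //.
by rewrite -natrX ler1n expn_gt0 prime_gt0.
Qed.

Lemma dvdz_padic_norm k (n : int) :
  ((p ^ k)%N %| n)%Z = (padic_norm p n%:~R <= (p%:R ^+ k)^-1).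
Proof.
have [->|n0] := eqVneq n 0.
  by rewrite dvdz0 padic_norm0 invr_ge0 exprn_ge0 ?ltW.
rewrite padic_norm_int // lef_pV2 ?posrE ?exprn_gt0 //.
rewrite -!natrX ler_nat leq_exp2l ?prime_gt1 //.
by rewrite dvdzE /= pfactor_dvdn // absz_gt0.
Qed.

Lemma padic_norm_int_lt1 (n : int) : (padic_norm p n%:~R < 1) = (p %| n)%Z.
Proof.
have [->|n0] := eqVneq n 0; first by rewrite dvdz0 padic_norm0.
rewrite padic_norm_int // invf_lt1 ?exprn_gt0 //.
rewrite -natrX ltr1n -{1}(expn0 p) ltn_exp2l ?prime_gt1 //.
by rewrite logn_gt0 mem_primes p_prime absz_gt0 n0 dvdzE.
Qed.

Lemma padic_normD_le (c x y : rat) :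
  padic_norm p x <= c -> padic_norm p y <= c -> padic_norm p (x + y) <= c.
Proof.
have [->|x0] := eqVneq x 0; first by rewrite add0r.
have [->|y0] := eqVneq y 0; first by rewrite addr0.
have [->|xy0] := eqVneq (x + y) 0.
  by rewrite padic_norm0 => /(le_trans (padic_norm_ge0 _)).
pose d := (denq x * denq y)%R; have d0 : d != 0 by rewrite mulf_neq0 ?denq_neq0.
have dQ : d%:~R != 0 :> rat by rewrite intr_eq0.
have xE : x = (numq x * denq y)%:~R / d%:~R.
  by rewrite /d -{1}[x]divq_num_den !intrM -mulf_div divff ?mulr1 // intr_eq0 denq_neq0.
have yE : y = (denq x * numq y)%:~R / d%:~R.
  by rewrite /d -{1}[y]divq_num_den !intrM -mulf_div divff ?mul1r // intr_eq0 denq_neq0.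
move: (numq x * denq y) (denq x * numq y) xE yE => n m xE yE.
have xyE : x + y = (n + m)%:~R / d%:~R by rewrite xE yE -mulrDl intrD.
have n0 : n != 0 by apply: contraNneq x0 => n0; rewrite xE n0 mul0r.
have m0 : m != 0 by apply: contraNneq y0 => m0; rewrite yE m0 mul0r.
rewrite xyE xE yE !padic_normM.
pose k := minn (logn p `|n|%N) (logn p `|m|%N).
have kn : padic_norm p n%:~R <= (p%:R ^+ k)^-1.
  by rewrite -dvdz_padic_norm dvdzE /= pfactor_dvdn ?absz_gt0 // geq_minl.
have km : padic_norm p m%:~R <= (p%:R ^+ k)^-1.
  by rewrite -dvdz_padic_norm dvdzE /= pfactor_dvdn ?absz_gt0 // geq_minr.
have knm : padic_norm p (n + m)%:~R <= (p%:R ^+ k)^-1.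
  by rewrite -dvdz_padic_norm rpredD // dvdz_padic_norm.
have v0 := padic_norm_ge0 d%:~R^-1.
move=> H1 H2; apply: le_trans (ler_wpM2r v0 knm) _.
move: H1 H2; rewrite !padic_norm_int // /k.
by case: (leqP (logn p `|n|) (logn p `|m|)).
Qed.

Lemma padic_normD_eq (x y : rat) :
  padic_norm p x < padic_norm p y -> padic_norm p (x + y) = padic_norm p y.
Proof.
move=> xy; apply/eqP; rewrite eq_le.
rewrite (padic_normD_le (ltW xy) (lexx _)) /= leNgt; apply/negP => xy'.
have : padic_norm p y <= Num.max (padic_norm p (x + y)) (padic_norm p x).
  rewrite -[y in leLHS](addKr x) addrC.
  by apply: padic_normD_le; rewrite ?padic_normN le_max lexx ?orbT.
by rewrite leNgt gt_max xy xy'.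
Qed.

(** The valuations of the two sides differ in parity. *)
Lemma padic_norm_sqr_neq (x y : rat) : x != 0 -> y != 0 ->
  padic_norm p x ^+ 2 != p%:R^-1 * padic_norm p y ^+ 2.
Proof.
move=> x0 y0; rewrite /padic_norm (negPf x0) (negPf y0).
move: (logn _ _) (logn _ _) (logn _ _) (logn _ _) => d c b a.
apply/eqP => E.
have : p%:R * (p%:R ^+ a) ^+ 2 * (p%:R ^+ d) ^+ 2 =
       (p%:R ^+ c) ^+ 2 * (p%:R ^+ b) ^+ 2 :> rat.
  transitivity ((p%:R ^+ a / p%:R ^+ b) ^+ 2 *
                (p%:R * (p%:R ^+ b) ^+ 2 * (p%:R ^+ d) ^+ 2) : rat).
    by field; exact: pX_neq0.
  by rewrite E; field; rewrite p_neq0 pX_neq0.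
rewrite -!exprM -exprS -!exprD -!natrX => /eqP.
rewrite eqr_nat eqn_exp2l ?prime_gt1 // => /eqP /(congr1 odd).
by rewrite /= !oddD !oddM !andbF.
Qed.

End PadicNorm.

(** * Quaternionic norm forms and Legendre's descent *)

Lemma place_normM v (x y : rat) : place_norm v (x * y) = place_norm v x * place_norm v y.
Proof. by case: v => [|p p_prime] /=; rewrite ?normrM ?padic_normM. Qed.

Lemma place_norm_gt0 v (x : rat) : (0 < place_norm v x) = (x != 0).
Proof. by case: v => [|p p_prime] /=; rewrite ?normr_gt0 ?padic_norm_gt0. Qed.

(* [nonCS v f] is the failure of the Cauchy-Schwarz inequality
   |f(x, y)|_v^2 <= |f(x, x)|_v |f(y, y)|_v. *)
Definition nonCS (v : place) (V : Type) (f : V -> V -> rat) : Prop :=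
  exists x y, place_norm v (f x x * f y y) < place_norm v (f x y) ^+ 2.

(** Both sides of the inequality scale by [|c|_v ^ 2]. Only the images of the test vectors matter,
    so that [h] may have a kernel, as for a quadric with a vertex. *)
Lemma nonCS_similar v (V W : Type) (f : V -> V -> rat) (g : W -> W -> rat)
    (h : V -> W) (c : rat) :
    c != 0 -> (forall x y, f x y = c * g (h x) (h y)) ->
  nonCS v f -> nonCS v g.
Proof.
move=> c0 fg [x [y]]; rewrite !fg => H; exists (h x), (h y); move: H.
rewrite !place_normM exprMn.
have -> (r s t : rat) : r * s * (r * t) = r ^+ 2 * (s * t) by ring.
by rewrite ltr_pM2l // exprn_gt0 // place_norm_gt0.
Qed.

(* The norm form <1, -a, -b, ab> of the quaternion algebra (a, b). *)
Definition normform (a b : rat) (x y : rat * rat * rat * rat) : rat :=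
  let: (x0, x1, x2, x3) := x in let: (y0, y1, y2, y3) := y in
  x0 * y0 - a * x1 * y1 - b * x2 * y2 + a * b * x3 * y3.

Definition isotropic (V : zmodType) (f : V -> V -> rat) : Prop :=
  exists2 x, x != 0 & f x x = 0.

Lemma isotropic_similar (V W : zmodType) (f : V -> V -> rat) (g : W -> W -> rat)
    (h : V -> W) (h' : W -> V) (c : rat) :
    h 0 = 0 -> cancel h' h -> (forall x y, f x y = c * g (h x) (h y)) ->
  isotropic g -> isotropic f.
Proof.
move=> h0 hK fg [y y0 gy]; exists (h' y); last by rewrite fg hK gy mulr0.
by apply: contra_neq y0 => E; rewrite -(hK y) E h0.
Qed.

Section LocalAnisotropy.
Variables (p : nat) (p_prime : prime p) (a b : int).
Hypothesis a_nonres : forall r : int, ~~ (p %| r ^+ 2 - a)%Z.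
Hypotheses (p_b : (p %| b)%Z) (p2_b : ~~ ((p ^ 2)%N %| b)%Z).
Local Notation norm := (padic_norm p).

Let norm_a : norm a%:~R = 1.
Proof.
apply/eqP; rewrite eq_le padic_norm_int_le1 //= leNgt padic_norm_int_lt1 //.
by have := a_nonres 0; rewrite expr0n /= sub0r dvdzE abszN.
Qed.

Let norm_b : norm b%:~R = p%:R^-1.
Proof.
have b0 : b != 0 by apply: contraNneq p2_b => ->; rewrite dvdz0.
move: p_b p2_b; rewrite -{1}(expn1 p) !dvdzE /= !pfactor_dvdn ?absz_gt0 // => h1 h2.
rewrite padic_norm_int //; have -> : logn p `|b| = 1%N by lia.
by rewrite expr1.
Qed.

(** The denominator of such an [r] is prime to [p], so a smaller value would make [a] a square
    modulo [p]. *)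
Let norm_sub_a (r : rat) : norm r <= 1 -> norm (r ^+ 2 - a%:~R) = 1.
Proof.
move=> r1.
have pd : ~~ (p %| denq r)%Z.
  apply/negP => pd; have pn : ~~ (p %| numq r)%Z.
    apply/negP => pn; have := coprime_num_den r; rewrite /coprime.
    have : (p %| gcdn `|numq r| `|denq r|)%N by rewrite dvdn_gcd; move: pd pn; rewrite !dvdzE /= => -> ->.
    move=> /[swap] /eqP ->; rewrite dvdn1 => /eqP p1.
    by move: p_prime; rewrite p1.
  move: r1; rewrite leNgt => /negP; apply.
  move: pd pn; rewrite -!padic_norm_int_lt1 // => pd; rewrite -leNgt => pn.
  rewrite -[r]divq_num_den padic_normM // padic_normV //.
  rewrite ltr_pdivlMr ?padic_norm_gt0 ?intr_eq0 ?denq_neq0 // mul1r.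
  exact: lt_le_trans pn.
have d1 : norm (denq r)%:~R = 1.
  by apply/eqP; rewrite eq_le padic_norm_int_le1 //= leNgt padic_norm_int_lt1.
suff : norm (numq r ^+ 2 - a * denq r ^+ 2)%:~R = 1.
  have -> : (numq r ^+ 2 - a * denq r ^+ 2)%:~R =
            (r ^+ 2 - a%:~R) * (denq r)%:~R ^+ 2 :> rat.
    rewrite -{3}[r]divq_num_den; field.
    by rewrite intr_eq0 denq_neq0.
  by rewrite padic_normM // padic_normX // d1 expr1n mulr1.
apply/eqP; rewrite eq_le padic_norm_int_le1 //= leNgt padic_norm_int_lt1 //.
apply/negP => pN.
have : coprimez (denq r) p by rewrite coprimezE coprime_sym prime_coprime.
(* [u] inverts the denominator modulo [p], so that [numq r * u] would be an integral square root of
   [a]. *)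
case/coprimezP => -[u w] /= uw.
have /negP := a_nonres (numq r * u); apply.
have -> : (numq r * u) ^+ 2 - a =
    u ^+ 2 * (numq r ^+ 2 - a * denq r ^+ 2) + p%:Z * - (a * w * (u * denq r + 1)).
  have -> : p%:Z * - (a * w * (u * denq r + 1)) = - a * (u * denq r + 1) * (w * p%:Z).
    by ring.
  have -> : w * p%:Z = 1 - u * denq r by rewrite -uw; ring.
  by ring.
by apply: rpredD; [exact: dvdz_mull | exact: dvdz_mulr].
Qed.

(** The value is a norm from the unramified quadratic extension, where no cancellation occurs; [u]
    is the larger of the two coordinates. *)
Let norm_pair (x0 x1 : rat) : exists u,
  [/\ norm x0 <= norm u, norm x1 <= norm u &
      norm (x0 ^+ 2 - a%:~R * x1 ^+ 2) = norm u ^+ 2].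
Proof.
have [x01|x10] := leP (norm x0) (norm x1).
  exists x1; split=> //.
  have [x1_0|x1_n0] := eqVneq x1 0.
    move: x01; rewrite x1_0 padic_norm0 => x00.
    have /eqP -> : x0 == 0 by rewrite -(padic_norm_eq0 p_prime) eq_le x00 padic_norm_ge0.
    by rewrite !expr0n /= mulr0 subr0 !padic_norm0 ?expr0n.
  have -> : x0 ^+ 2 - a%:~R * x1 ^+ 2 = ((x0 / x1) ^+ 2 - a%:~R) * x1 ^+ 2 by field.
  rewrite padic_normM // norm_sub_a ?mul1r ?padic_normX //.
  by rewrite padic_normM // padic_normV // ler_pdivrMr ?mul1r ?padic_norm_gt0.
exists x0; split=> //; first exact: ltW.
rewrite addrC padic_normD_eq // ?padic_normN ?padic_normM ?padic_normX // norm_a mul1r.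
by rewrite ltr_pM ?padic_norm_ge0.
Qed.

(** The parts in [x0], [x1] and in [x2], [x3] have valuations of opposite parity, because [b] has
    valuation 1; so neither can cancel the other. *)
Let norm_diag (x0 x1 x2 x3 : rat) : exists u w,
  [/\ norm x0 <= norm u /\ norm x1 <= norm u, norm x2 <= norm w /\ norm x3 <= norm w,
      norm u ^+ 2 <= norm (normform a%:~R b%:~R (x0, x1, x2, x3) (x0, x1, x2, x3)) &
      p%:R^-1 * norm w ^+ 2 <=
      norm (normform a%:~R b%:~R (x0, x1, x2, x3) (x0, x1, x2, x3))].
Proof.
have [u [u0 u1 uE]] := norm_pair x0 x1; have [w [w2 w3 wE]] := norm_pair x2 x3.
exists u, w.
have -> : normform a%:~R b%:~R (x0, x1, x2, x3) (x0, x1, x2, x3) =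
   (x0 ^+ 2 - a%:~R * x1 ^+ 2) + - (b%:~R * (x2 ^+ 2 - a%:~R * x3 ^+ 2)).
  by rewrite /normform; ring.
move: (x0 ^+ 2 - _) (x2 ^+ 2 - _) uE wE => X Y uE wE.
have YE : norm (- (b%:~R * Y)) = p%:R^-1 * norm w ^+ 2.
  by rewrite padic_normN padic_normM // norm_b wE.
split=> //; rewrite -?uE -?YE.
  have [XY|YX|XY] := ltgtP (norm X) (norm (- (b%:~R * Y))).
  - by rewrite padic_normD_eq // ltW.
  - by rewrite addrC padic_normD_eq.
  (* Equal nonzero norms are excluded by parity. *)
  - move: XY; rewrite uE YE.
    have [->|u_n0] := eqVneq u 0; first by rewrite padic_norm0 expr0n /= padic_norm_ge0.
    have [->|w_n0] := eqVneq w 0.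
      rewrite padic_norm0 expr0n /= mulr0 => /eqP.
      by rewrite sqrf_eq0 padic_norm_eq0 // (negPf u_n0).
    by move/eqP; rewrite (negPf (padic_norm_sqr_neq p_prime u_n0 w_n0)).
have [XY|YX|XY] := ltgtP (norm X) (norm (- (b%:~R * Y))).
- by rewrite padic_normD_eq.
- by rewrite addrC padic_normD_eq // ltW.
- move: XY; rewrite uE YE.
  have [->|w_n0] := eqVneq w 0; first by rewrite padic_norm0 expr0n /= mulr0 padic_norm_ge0.
  have [->|u_n0] := eqVneq u 0.
    rewrite padic_norm0 expr0n /= => /esym/eqP.
    by rewrite mulf_eq0 invr_eq0 sqrf_eq0 padic_norm_eq0 // (negPf w_n0) pnatr_eq0 eqn0Ngt prime_gt0.
  by move/eqP; rewrite (negPf (padic_norm_sqr_neq p_prime u_n0 w_n0)).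
Qed.

(** This is the norm form of a division algebra over the p-adic numbers. Its diagonal values are
    bounded below by both parts in [norm_diag], and the same parts bound the bilinear form from
    above. *)
Lemma normform_padic_CS : ~ nonCS (Padic p_prime) (normform a%:~R b%:~R).
Proof.
move=> [[[[x0 x1] x2] x3] [[[[y0 y1] y2] y3]]] /=.
have [u [w [[xu0 xu1] [xw2 xw3] xu xw]]] := norm_diag x0 x1 x2 x3.
have [u' [w' [[yu0 yu1] [yw2 yw3] yu yw]]] := norm_diag y0 y1 y2 y3.
apply/negP; rewrite -leNgt padic_normM //.
move: (norm (normform _ _ _ (x0, _, _, _))) xu xw => fx xu xw.
move: (norm (normform _ _ (y0, _, _, _) (y0, _, _, _))) yu yw => fy yu yw.
have n0 := padic_norm_ge0 p_prime.
have p0 : 0 <= p%:R^-1 :> rat by rewrite invr_ge0 ler0n.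
(* Each of the four terms of the bilinear form is at most [c], and either candidate for [c] squares
   to a product of lower bounds for the two diagonal values. *)
set c := Num.max (norm u * norm u') (p%:R^-1 * (norm w * norm w')).
have hc : norm (normform a%:~R b%:~R (x0, x1, x2, x3) (y0, y1, y2, y3)) <= c.
  have c_u : norm u * norm u' <= c by rewrite le_max lexx.
  have c_w : p%:R^-1 * (norm w * norm w') <= c by rewrite le_max lexx orbT.
  apply: (padic_normD_le p_prime); last first.
    rewrite -!mulrA !(padic_normM p_prime) norm_a norm_b mul1r.
    by apply: le_trans c_w; apply: ler_wpM2l; rewrite ?ler_pM.
  apply: (padic_normD_le p_prime); last first.
    rewrite padic_normN -!mulrA !(padic_normM p_prime) norm_b.
    by apply: le_trans c_w; apply: ler_wpM2l; rewrite ?ler_pM.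
  apply: (padic_normD_le p_prime); last first.
    rewrite padic_normN -!mulrA !(padic_normM p_prime) norm_a mul1r.
    by apply: le_trans c_u; rewrite ler_pM.
  by rewrite (padic_normM p_prime); apply: le_trans c_u; rewrite ler_pM.
apply: le_trans (_ : c ^+ 2 <= _).
  by rewrite ler_pXn2r // nnegrE ?n0 // le_max mulr_ge0.
rewrite /c; case: (leP (norm u * norm u') _) => _.
  have -> : (p%:R^-1 * (norm w * norm w')) ^+ 2 =
    (p%:R^-1 * norm w ^+ 2) * (p%:R^-1 * norm w' ^+ 2) by ring.
  by apply: ler_pM => //; rewrite mulr_ge0 // sqr_ge0.
by rewrite exprMn; apply: ler_pM => //; rewrite sqr_ge0.
Qed.

End LocalAnisotropy.

(** Split off one prime, coprime to the rest because [n] is squarefree, and combine the two roots by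
    the Chinese remainder theorem. *)
Lemma sqr_mod_squarefree (a : int) (n : nat) : (0 < n)%N ->
    (forall p, prime p -> ~~ (p ^ 2 %| n)%N) ->
    (forall p, prime p -> (p %| n)%N -> exists r : int, (p %| r ^+ 2 - a)%Z) ->
  exists r : int, (n %| r ^+ 2 - a)%Z.
Proof.
elim/ltn_ind: n => n IH n0 n_sqf n_sqr.
have [n1|n1] := leqP n 1.
  have -> : n = 1%N by lia.
  by exists 0; rewrite dvd1z.
have pp := pdiv_prime n1; set p := pdiv n in pp.
have /dvdnP[m nE] : (p %| n)%N := pdiv_dvd n.
have m0 : (0 < m)%N by move: n0; rewrite nE muln_gt0 => /andP[].
have pm : coprime p m.
  rewrite prime_coprime //; apply/negP => pm.
  by have /negP := n_sqf p pp; apply; rewrite nE mulnC dvdn_mul.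
have [|||r2 hr2] := IH m _ m0.
- by rewrite nE -[X in (X < _)%N]muln1 ltn_pmul2l // prime_gt1.
- move=> q qq; apply: contra (n_sqf q qq) => /dvdn_trans; apply.
  by rewrite nE dvdn_mulr.
- by move=> q qq qm; apply: n_sqr => //; rewrite nE dvdn_mulr.
have [|r1 hr1] := n_sqr p pp; first by rewrite nE dvdn_mull.
exists (zchinese p m r1 r2).
have cpm : coprimez p m by rewrite coprimezE.
have -> : (n%:Z = p%:Z * m%:Z)%R by rewrite nE mulnC PoszM.
rewrite Gauss_dvdz //; apply/andP; split.
  rewrite -eqz_mod_dvd -(modzXm 2) zchinese_modl // modzXm.
  by rewrite eqz_mod_dvd.
rewrite -eqz_mod_dvd -(modzXm 2) zchinese_modr // modzXm.
by rewrite eqz_mod_dvd.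
Qed.

(** The factor 2 is what makes the coefficients shrink in the descent. *)
Lemma small_residue (n : nat) (r : int) : (0 < n)%N ->
  exists2 s : int, (n %| r - s)%Z & (2 * `|s| <= n)%N.
Proof.
move=> n0; have nZ : (n : int) != 0 by lia.
have h0 := modz_ge0 r nZ; have h1 := ltz_pmod r (d := n) n0.
have E := divz_eq r n.
have [small|big] := leqP (2 * `|(r %% n)%Z|) n.
  by exists (r %% n)%Z => //; rewrite {1}E addrK dvdz_mull.
exists ((r %% n)%Z - n%:Z); last by lia.
by rewrite {1}E opprB addrA addrAC addrK -[X in _ + X]mul1r -mulrDl dvdz_mull.
Qed.

Definition locally_isotropic (V : Type) (f : V -> V -> rat) : Prop :=
  nonCS Archimedean f /\
  forall p (p_prime : prime p), odd p -> nonCS (Padic p_prime) f.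

Lemma locally_isotropic_similar (V W : Type) (f : V -> V -> rat) (g : W -> W -> rat)
    (h : V -> W) (c : rat) :
    c != 0 -> (forall x y, f x y = c * g (h x) (h y)) ->
  locally_isotropic f -> locally_isotropic g.
Proof.
move=> c0 fg [f_inf f_odd]; split; first exact: nonCS_similar fg f_inf.
by move=> p p_prime p_odd; apply: nonCS_similar fg (f_odd p p_prime p_odd).
Qed.

Lemma normform_isotropicC (a b : rat) :
  isotropic (normform b a) -> isotropic (normform a b).
Proof.
pose swap (x : rat * rat * rat * rat) := let: (x0, x1, x2, x3) := x in (x0, x2, x1, x3).
apply: (@isotropic_similar _ _ _ _ swap swap 1) => //; first by move=> [[[]]].
by move=> [[[? ?] ?] ?] [[[? ?] ?] ?] /=; rewrite /normform; ring.
Qed.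

Lemma normform_locallyC (a b : rat) :
  locally_isotropic (normform a b) -> locally_isotropic (normform b a).
Proof.
pose swap (x : rat * rat * rat * rat) := let: (x0, x1, x2, x3) := x in (x0, x2, x1, x3).
apply: (@locally_isotropic_similar _ _ _ _ swap 1) => //.
by move=> [[[? ?] ?] ?] [[[? ?] ?] ?] /=; rewrite /normform; ring.
Qed.

(* Multiplication by r + sqrt a identifies (r^2 - a)/c <1, -a> with c <1, -a>
   up to the factor c^2. *)
Section Descent.
Variables (a b c r : rat).
Hypotheses (c0 : c != 0) (bc0 : b * c != 0) (bcE : r ^+ 2 - a = b * c).

Let h (x : rat * rat * rat * rat) :=
  let: (x0, x1, x2, x3) := x in (x0, x1, (r * x2 + a * x3) / c, (x2 + r * x3) / c).
Let h' (x : rat * rat * rat * rat) :=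
  let: (x0, x1, x2, x3) := x in
  (x0, x1, (r * x2 - a * x3) * c / (b * c), (r * x3 - x2) * c / (b * c)).

Let hE x y : normform a b x y = 1 * normform a c (h x) (h y).
Proof.
have b0 : b != 0 by apply: contraNneq bc0 => ->; rewrite mul0r.
have -> : b = (r ^+ 2 - a) / c by rewrite bcE mulfK.
case: x => [[[? ?] ?] ?]; case: y => [[[? ?] ?] ?] /=.
by field.
Qed.

Lemma normform_isotropic_descent :
  isotropic (normform a c) -> isotropic (normform a b).
Proof.
apply: (@isotropic_similar _ _ _ _ h h' 1) => //.
  by rewrite /h /= !mulr0 !addr0 !mul0r.
move=> [[[x0 x1] x2] x3] /=; have := bc0; rewrite -bcE => ra0.
by congr (_, _, _, _); field; rewrite c0 ra0.
Qed.

Lemma normform_locally_descent :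
  locally_isotropic (normform a b) -> locally_isotropic (normform a c).
Proof. exact: (@locally_isotropic_similar _ _ _ _ h 1). Qed.
End Descent.

Section SquareFactor.
Variables (a b c : rat).
Hypothesis c0 : c != 0.

Let h (x : rat * rat * rat * rat) :=
  let: (x0, x1, x2, x3) := x in (x0, x1, c * x2, c * x3).
Let h' (x : rat * rat * rat * rat) :=
  let: (x0, x1, x2, x3) := x in (x0, x1, c^-1 * x2, c^-1 * x3).

Lemma normform_isotropic_sqr :
  isotropic (normform a b) -> isotropic (normform a (b * c ^+ 2)).
Proof.
apply: (@isotropic_similar _ _ _ _ h h' 1).
- by rewrite /h /= !mulr0.
- by move=> [[[x0 x1] x2] x3] /=; rewrite !mulVKf.
- by move=> [[[? ?] ?] ?] [[[? ?] ?] ?] /=; rewrite /normform; ring.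
Qed.

Lemma normform_locally_sqr :
  locally_isotropic (normform a (b * c ^+ 2)) -> locally_isotropic (normform a b).
Proof.
apply: (@locally_isotropic_similar _ _ _ _ h 1) => //.
by move=> [[[? ?] ?] ?] [[[? ?] ?] ?] /=; rewrite /normform; ring.
Qed.
End SquareFactor.

(** Lagrange's identity: the defect is the sum of the squares of the six 2x2 minors of the two
    vectors. *)
Lemma normform_real_CS : ~ nonCS Archimedean (normform (-1) (-1)).
Proof.
move=> [[[[x0 x1] x2] x3] [[[[y0 y1] y2] y3]]] /=.
apply/negP; rewrite -leNgt real_normK ?num_real //.
apply: le_trans (ler_norm _).
rewrite -subr_ge0 /normform.
have -> :
  (x0 * x0 - -1 * x1 * x1 - -1 * x2 * x2 + -1 * -1 * x3 * x3) *
  (y0 * y0 - -1 * y1 * y1 - -1 * y2 * y2 + -1 * -1 * y3 * y3) -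
  (x0 * y0 - -1 * x1 * y1 - -1 * x2 * y2 + -1 * -1 * x3 * y3) ^+ 2 =
  (x0 * y1 - x1 * y0) ^+ 2 + (x0 * y2 - x2 * y0) ^+ 2 + (x0 * y3 - x3 * y0) ^+ 2 +
  (x1 * y2 - x2 * y1) ^+ 2 + (x1 * y3 - x3 * y1) ^+ 2 + (x2 * y3 - x3 * y2) ^+ 2.
  by ring.
by rewrite !addr_ge0 ?sqr_ge0.
Qed.

(* Legendre's descent; no condition at 2 is needed as every integer is a
   square modulo 2. *)
Lemma normform_local_global (a b : int) : a != 0 -> b != 0 ->
  locally_isotropic (normform a%:~R b%:~R) -> isotropic (normform a%:~R b%:~R).
Proof.
have [n] := ubnP (`|a| + `|b|)%N; elim: n a b => // n IH a b.
wlog ab : a b / (`|a| <= `|b|)%N.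
  move=> W nab a0 b0 loc; have [ab|/ltnW ba] := leqP `|a| `|b|; first exact: W.
  apply: normform_isotropicC; apply: W => //; first by rewrite addnC.
  exact: normform_locallyC.
rewrite ltnS => nab a0 b0 loc.
(* Among the coefficients 1 and -1 only [a = b = -1] gives an anisotropic form, and it fails at the
   real place. *)
have [b1|b1] := leqP `|b| 1.
  have {}b1 : b = 1 \/ b = -1 by lia.
  have {}a1 : a = 1 \/ a = -1 by lia.
  case: a1 => aE; first by exists (1, 1, 0, 0); rewrite // aE /normform; ring.
  case: b1 => bE; first by exists (1, 0, 1, 0); rewrite // bE /normform; ring.
  by case: loc => /[!aE] /[!bE] /normform_real_CS.
have [[p p_prime p2b]|b_sqf] :
    (exists2 p, prime p & ((p ^ 2)%N %| b)%Z) \/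
    (forall p, prime p -> ~~ (p ^ 2 %| `|b|)%N).
  have [/existsP[p /andP[pp p2]]|H] :=
      boolP [exists p : 'I_(`|b|).+1, prime p && (p ^ 2 %| `|b|)%N].
    by left; exists p.
  right=> p pp; apply: contra H => p2; apply/existsP.
  have pb : (p < `|b|.+1)%N.
    rewrite ltnS; apply: dvdn_leq; first by rewrite absz_gt0.
    by apply: dvdn_trans p2; rewrite dvdn_mulr.
  by exists (Ordinal pb); rewrite /= pp.
  (* A square factor of [b] is absorbed by rescaling the last two coordinates. *)
  have /dvdzP[c bE] := p2b.
  have p1 := prime_gt1 p_prime.
  have pQ : p%:R != 0 :> rat by rewrite pnatr_eq0; lia.
  have bQ : b%:~R = c%:~R * p%:R ^+ 2 :> rat by rewrite bE PoszM !intrM expr2.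
  have c0 : c != 0 by apply: contraNneq b0 => c0; rewrite bE c0 mul0r.
  rewrite bQ; apply: normform_isotropic_sqr => //; apply: IH => //.
    by rewrite bE abszM /= in nab; nia.
  by apply: (normform_locally_sqr (c := p%:R)) => //; rewrite -bQ.
(* If [a] were not a square modulo an odd prime [q] dividing [b], the form would satisfy
   Cauchy-Schwarz at [q]. *)
have [|q q_prime qb|r hr] := @sqr_mod_squarefree a `|b| _ b_sqf.
- by rewrite absz_gt0.
- have [q2|q_odd] := even_prime q_prime.
    exists a; rewrite q2 dvdzE /=.
    have -> : a ^+ 2 - a = a * (a - 1) by ring.
    by rewrite abszM dvdn2 oddM; lia.
  have [/existsP[s sP]|no] :=
      boolP [exists s : 'I_q, (q %| (s : int) ^+ 2 - a)%Z].
    by exists s.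
  have := loc.2 q q_prime q_odd => /normform_padic_CS; case=> //.
  + move=> s; apply: contra no => hs; apply/existsP.
    have q0 := prime_gt0 q_prime.
    have qZ : (q : int) != 0 by lia.
    have h0 := modz_ge0 s qZ; have h1 := ltz_pmod s (d := q) q0.
    have hq : (`|(s %% q)%Z| < q)%N by lia.
    exists (Ordinal hq); rewrite /= gez0_abs // -eqz_mod_dvd modzXm.
    by rewrite eqz_mod_dvd.
  + exact: b_sqf.
(* Now [s ^ 2 - a = c * b] with [|c| <= |b| / 4 + 1 < |b|], so that [b] can be replaced by [c]. *)
have [|s hs s_le] := @small_residue `|b| r; first by rewrite absz_gt0.
have /dvdzP[c sE] : (b %| s ^+ 2 - a)%Z.
  have -> : s ^+ 2 - a = (r ^+ 2 - a) - (r - s) * (r + s) by ring.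
  by rewrite dvdzE -!(dvdzE `|b|%:Z); apply: rpredB => //; apply: dvdz_mulr.
have aE : a = s ^+ 2 - c * b by rewrite -sE; ring.
have [c0|c0] := eqVneq c 0.
  exists (s%:~R, 1, 0, 0); first by rewrite !xpair_eqE oner_eq0 andbF.
  by rewrite aE c0 /normform mul0r subr0 rmorphXn /=; ring.
have bcQ : s%:~R ^+ 2 - a%:~R = b%:~R * c%:~R :> rat.
  by rewrite -rmorphXn -rmorphB -intrM /= sE mulrC.
have bc0 : b%:~R * c%:~R != 0 :> rat by rewrite mulf_neq0 ?intr_eq0.
have cQ : c%:~R != 0 :> rat by rewrite intr_eq0.
apply: (normform_isotropic_descent cQ bc0 bcQ); apply: IH => //.
  suff cb : (`|c| < `|b|)%N by apply: leq_trans nab; rewrite ltn_add2l.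
  have cb : (`|c| * `|b| <= `|s| * `|s| + `|a|)%N.
    rewrite -!abszM -sE -expr2; move: (s ^+ 2) => w; clear; lia.
  move: `|c|%N `|b|%N `|s|%N `|a|%N ab b1 s_le cb; clear=> c b s a ab b1 s_le cb.
  rewrite ltnNge; apply/negP => bc.
  have bb : (b * b <= c * b)%N by rewrite leq_mul2r bc orbT.
  have ss : (2 * s * (2 * s) <= b * b)%N by rewrite leq_mul.
  nia.
exact: (normform_locally_descent cQ bc0 bcQ).
Qed.

(** * Quinary quadratic forms of rank 4 *)

Definition bilin (F : nzRingType) n (A : 'M[F]_n) (x y : 'rV_n) : F :=
  (x *m A *m y^T) 0 0.

Lemma bilin_congr (F : comNzRingType) m n (P : 'M[F]_(m, n)) (A : 'M_n) x y :
  bilin (P *m A *m P^T) x y = bilin A (x *m P) (y *m P).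
Proof. by rewrite /bilin trmx_mul !mulmxA. Qed.

Lemma bilin_diag (F : comNzRingType) n (d : 'rV[F]_n) x y :
  bilin (diag_mx d) x y = \sum_i d 0 i * (x 0 i * y 0 i).
Proof.
rewrite /bilin mul_mx_diag mxE; apply: eq_bigr => i _.
by rewrite !mxE mulrCA mulrA.
Qed.

Lemma bilinZ (F : comNzRingType) n (c : F) (A : 'M_n) x y :
  bilin (c *: A) x y = c * bilin A x y.
Proof. by rewrite /bilin -scalemxAr -scalemxAl mxE. Qed.

Lemma bilinD (F : comNzRingType) n (A B : 'M[F]_n) x y :
  bilin (A + B) x y = bilin A x y + bilin B x y.
Proof. by rewrite /bilin mulmxDr mulmxDl mxE. Qed.

Lemma bilinE (F : comNzRingType) n (A : 'M[F]_n) x y :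
  bilin A x y = \sum_i \sum_j x 0 i * A i j * y 0 j.
Proof.
rewrite /bilin mxE exchange_big; apply: eq_bigr => j _ /=.
by rewrite !mxE mulr_suml.
Qed.

Lemma bilin_delta (F : comNzRingType) n (A : 'M[F]_n) i j :
  bilin A (delta_mx 0 i) (delta_mx 0 j) = A i j.
Proof. by rewrite /bilin -rowE trmx_delta -colE !mxE. Qed.

Lemma bilinDl (F : comNzRingType) n (A : 'M[F]_n) x y z :
  bilin A (x + y) z = bilin A x z + bilin A y z.
Proof. by rewrite /bilin !mulmxDl mxE. Qed.

Lemma bilinDr (F : comNzRingType) n (A : 'M[F]_n) x y z :
  bilin A x (y + z) = bilin A x y + bilin A x z.
Proof. by rewrite /bilin linearD mulmxDr mxE. Qed.

Lemma bilinZl (F : comNzRingType) n (A : 'M[F]_n) c x y :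
  bilin A (c *: x) y = c * bilin A x y.
Proof. by rewrite /bilin -!scalemxAl mxE. Qed.

Lemma bilinZr (F : comNzRingType) n (A : 'M[F]_n) c x y :
  bilin A x (c *: y) = c * bilin A x y.
Proof. by rewrite /bilin linearZ -scalemxAr mxE. Qed.

Lemma bilinC (F : comNzRingType) n (A : 'M[F]_n) x y :
  A^T = A -> bilin A x y = bilin A y x.
Proof.
move=> symA; rewrite /bilin -[in LHS](trmxK (x *m A *m y^T)) mxE.
by rewrite !trmx_mul trmxK symA mulmxA.
Qed.

(** * Diagonalization of symmetric matrices *)

Section Diagonalization.
Variable F : fieldType.
Hypothesis two_neq0 : 2%:R != 0 :> F.

Let nonisotropic n (A : 'M[F]_n) : A^T = A -> A != 0 -> exists v, bilin A v v != 0.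
Proof.
move=> symA A0.
have [/existsP[i Aii]|] := boolP [exists i, A i i != 0].
  by exists (delta_mx 0 i); rewrite bilin_delta.
rewrite negb_exists => /forallP diag0.
have [/existsP[ij Aij]|] := boolP [exists ij, A ij.1 ij.2 != 0]; last first.
  rewrite negb_exists => /forallP A00; case/eqP: A0.
  by apply/matrixP=> i j; rewrite mxE; have /negPn/eqP := A00 (i, j).
exists (delta_mx 0 ij.1 + delta_mx 0 ij.2).
rewrite bilinDl !bilinDr (bilinC (delta_mx 0 ij.2) (delta_mx 0 ij.1)) //.
rewrite !bilin_delta (eqP (negPn (diag0 _))) (eqP (negPn (diag0 _))) add0r addr0.
by rewrite -mulr2n -mulr_natl mulf_neq0.
Qed.

(** A vector with nonzero value is completed to a basis, and the Schur complement of that value is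
    diagonalized by induction. *)
Lemma symmetric_diagonalizable n (A : 'M[F]_n) : A^T = A ->
  exists2 P : 'M_n, P \in unitmx & exists d, A = P *m diag_mx d *m P^T.
Proof.
elim: n A => [|n IH] A symA.
  by exists 1%:M; rewrite ?unitmx1 //; exists 0; apply/matrixP => -[].
have [->|A0] := eqVneq A 0.
  by exists 1%:M; rewrite ?unitmx1 //; exists 0; rewrite raddf0 mulmx0 mul0mx.
have [v vv] := nonisotropic symA A0.
have v0 : v != 0 by apply: contraNneq vv => ->; rewrite /bilin !mul0mx mxE.
pose Q := row_ebase v; have Qu : Q \in unitmx := row_ebase_unit v.
(* [row_ebase v] is an invertible matrix whose first row is proportional to [v]. *)
have [c vE] : exists c, v = c *: row 0 Q.
  exists (col_ebase v 0 0).
  rewrite -[LHS](mulmx_ebase v) rank_rV v0 [col_ebase v]mx11_scalar.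
  rewrite mul_scalar_mx -scalemxAl rowE.
  have -> (c : F) : c%:M 0 0 = c by rewrite mxE.
  congr (_ *: (_ *m _)).
  by apply/matrixP=> i j; rewrite !mxE !ord1 andbT eq_sym.
pose A1 : 'M_(1 + n) := Q *m A *m Q^T.
have symA1 : A1^T = A1 by rewrite /A1 !trmx_mul trmxK symA mulmxA.
pose a := A1 0 0.
have a0 : a != 0.
  apply: contraNneq vv; rewrite /a -bilin_delta bilin_congr -!rowE => aE.
  by rewrite vE bilinZl bilinZr aE !mulr0.
pose c1 : 'cV_n := dlsubmx A1; pose D := drsubmx A1.
have A1E : A1 = block_mx a%:M c1^T c1 D.
  rewrite -[A1]submxK -/c1 -/D; congr block_mx.
    rewrite [LHS]mx11_scalar /a; congr (_%:M).
    have -> : A1 0 0 = A1 (lshift n 0) (lshift n 0) by congr (A1 _ _); apply/val_inj.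
    by move: (A1) => A2; rewrite !mxE.
  by rewrite /c1 trmx_dlsub symA1.
have symD : D^T = D by rewrite /D trmx_drsub symA1.
have [|P Pu [d dE]] := IH (D - a^-1 *: (c1 *m c1^T)) _.
  by rewrite linearB /= linearZ /= trmx_mul trmxK symD.
pose L : 'M_(1 + n) := block_mx 1%:M 0 (a^-1 *: c1) P.
have Lu : L \in unitmx by rewrite unitmxE det_lblock det1 mul1r -unitmxE.
have A1L : A1 = L *m diag_mx (row_mx a%:M d) *m L^T.
  rewrite A1E diag_mx_row tr_block_mx !mulmx_block !(mul1mx, mulmx0, mul0mx, addr0, add0r, trmx1, trmx0, mulmx1).
  have -> : diag_mx a%:M = a%:M :> 'M[F]_1.
    by apply/matrixP=> i j; rewrite !mxE !ord1.
  rewrite -dE linearZ /= mul_scalar_mx -!scalemxAl scalerA mulfV // scale1r.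
  congr block_mx; first by rewrite mul_mx_scalar scalerA mulVf // scale1r.
  by rewrite mul_mx_scalar -scalemxAl scalerA mulVf // scale1r -scalemxAr addrC subrK.
exists (invmx Q *m L); first by rewrite unitmx_mul unitmx_inv Qu.
exists (row_mx a%:M d); rewrite trmx_mul !mulmxA -(mulmxA (invmx Q)) -(mulmxA (invmx Q)).
rewrite -A1L /A1 !mulmxA mulVmx // mul1mx -mulmxA trmx_inv mulmxV ?mulmx1 //.
  by rewrite unitmx_tr.
Qed.
End Diagonalization.

(** Modulo squares a rational coefficient is the integer [numq c * denq c]. *)
Lemma normform_local_global_rat (a b : rat) : a != 0 -> b != 0 ->
  locally_isotropic (normform a b) -> isotropic (normform a b).
Proof.
have intE (c : rat) : c != 0 ->
    exists2 n : int, n != 0 & c = n%:~R * ((denq c)%:~R^-1) ^+ 2.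
  move=> c0; exists (numq c * denq c); first by rewrite mulf_neq0 ?numq_eq0 ?denq_neq0.
  rewrite -{1}[c]divq_num_den intrM; field.
  by rewrite intr_eq0 denq_neq0.
move=> /intE[m m0 aE] /intE[n n0 bE].
have da : (denq a)%:~R^-1 != 0 :> rat by rewrite invr_eq0 intr_eq0 denq_neq0.
have db : (denq b)%:~R^-1 != 0 :> rat by rewrite invr_eq0 intr_eq0 denq_neq0.
rewrite bE => loc; apply: normform_isotropic_sqr => //.
move/normform_locally_sqr/normform_locallyC: loc.
rewrite aE => loc; apply/normform_isotropicC/normform_isotropic_sqr => //.
by apply: normform_local_global => //; apply: normform_locally_sqr loc.
Qed.

(** As the determinant is a square, the last diagonal entry is [d1 * d2 / d0] up to the square of
    [w], and the form is [d0] times a norm form. *)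
Lemma quaternary_local_global (B : 'M[rat]_4) (s : rat) :
    B^T = B -> \det B = s ^+ 2 -> s != 0 ->
  locally_isotropic (bilin B) -> isotropic (bilin B).
Proof.
move=> symB detB s0.
have [P Pu [d BE]] := symmetric_diagonalizable (isT : 2%:R != 0 :> rat) symB.
have dP : \det P != 0 by rewrite -unitfE -unitmxE.
pose d0 := d 0 0; pose d1 := d 0 1; pose d2 := d 0 2%:R; pose d3 := d 0 3%:R.
have d_prod : d0 * d1 * d2 * d3 = (s / \det P) ^+ 2.
  rewrite expr_div_n -detB BE !det_mulmx det_tr det_diag.
  rewrite !big_ord_recl big_ord0 mulr1.
  have -> : d 0 ord0 = d0 by [].
  have -> : d 0 (lift ord0 ord0) = d1 by congr (d _ _); apply/val_inj.
  have -> : d 0 (lift ord0 (lift ord0 ord0)) = d2 by congr (d _ _); apply/val_inj.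
  have -> : d 0 (lift ord0 (lift ord0 (lift ord0 ord0))) = d3.
    by congr (d _ _); apply/val_inj.
  by field.
have : d0 * d1 * d2 * d3 != 0 by rewrite d_prod expf_neq0 // mulf_neq0 ?invr_eq0.
rewrite !mulf_eq0 !negb_or -!andbA => /and4P[d0_n0 d1_n0 d2_n0 d3_n0].
pose w := s / \det P / (d1 * d2).
have w0 : w != 0 by rewrite !mulf_neq0 ?invr_eq0 ?mulf_neq0.
have d3E : d3 = d1 * d2 * w ^+ 2 / d0.
  rewrite /w expr_div_n -d_prod; field.
  by rewrite d0_n0 d1_n0 d2_n0.
pose h (x : 'rV[rat]_4) := let y := x *m P in (y 0 0, y 0 1, y 0 2%:R, y 0 3%:R * w).
pose h' (x : rat * rat * rat * rat) : 'rV[rat]_4 :=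
  let: (x0, x1, x2, x3) := x in
  (\row_i nth 0 [:: x0; x1; x2; x3 / w] i) *m invmx P.
have hE x y : bilin B x y = d0 * normform (- d1 / d0) (- d2 / d0) (h x) (h y).
  rewrite BE bilin_congr bilin_diag /h; move: (x *m P) (y *m P) => {}x {}y.
  rewrite !big_ord_recl big_ord0 addr0.
  have -> : lift ord0 ord0 = 1 :> 'I_4 by apply/val_inj.
  have -> : lift ord0 (lift ord0 ord0) = 2%:R :> 'I_4 by apply/val_inj.
  have -> : lift ord0 (lift ord0 (lift ord0 ord0)) = 3%:R :> 'I_4 by apply/val_inj.
  rewrite -/d0 -/d1 -/d2 -/d3 d3E /normform.
  by field.
move=> loc.
apply: (@isotropic_similar _ _ _ _ h h' d0 _ _ hE).
- by rewrite /h mul0mx !mxE mul0r.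
- move=> [[[x0 x1] x2] x3]; rewrite /h /h' mulmxKV // !mxE /=.
  by rewrite mulfVK.
apply: normform_local_global_rat; rewrite ?mulf_neq0 ?oppr_eq0 ?invr_eq0 //.
exact: locally_isotropic_similar hE loc.
Qed.

(** The corner is invertible and [\det A = 0], so its Schur complement vanishes: [A] is the pullback
    of the corner under the projection [R] from the vertex. *)
Lemma quinary_local_global (A : 'M[rat]_(4 + 1)) (s : rat) :
    A^T = A -> \det A = 0 -> \det (ulsubmx A) = s ^+ 2 -> s != 0 ->
  locally_isotropic (bilin A) -> isotropic (bilin (ulsubmx A)).
Proof.
move=> symA detA detB s0; set B := ulsubmx A in detB *.
have symB : B^T = B by rewrite /B trmx_ulsub symA.
have Bu : B \in unitmx by rewrite unitmxE unitfE detB expf_neq0.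
pose c := ursubmx A; pose d := drsubmx A.
have AE : A = block_mx B c c^T d.
  by rewrite -[LHS]submxK -/B -/c -/d /c trmx_ursub symA.
have dE : d = c^T *m invmx B *m c.
  apply/eqP; rewrite -subr_eq0; apply/eqP; rewrite [LHS]mx11_scalar.
  suff : \det B * \det (d - c^T *m invmx B *m c) = 0.
    move/eqP; rewrite mulf_eq0 detB (negPf (expf_neq0 _ s0)) /= det_mx11 => /eqP ->.
    by rewrite scalemx0 || rewrite raddf0.
  rewrite -(det_ublock B c) -[RHS]detA -[RHS]mul1r -(@det1 rat (4 + 1)).
  have -> : \det (1%:M : 'M[rat]_(4 + 1)) = \det (block_mx 1%:M 0 (- (c^T *m invmx B)) 1%:M : 'M[rat]_(4 + 1)).
    by rewrite det_lblock !det1 mulr1.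
  rewrite -det_mulmx AE mulmx_block !mul1mx !mul0mx !addr0 !mulNmx.
  by rewrite -[c^T *m _ *m B]mulmxA mulVmx // mulmx1 addNr addrC.
move=> loc; apply: (quaternary_local_global symB detB s0).
pose R : 'M[rat]_(4 + 1, 4) := col_mx 1%:M (c^T *m invmx B).
apply: (@locally_isotropic_similar _ _ (bilin A) _ (mulmx^~ R) 1) => // x y.
rewrite mul1r -bilin_congr; congr (bilin _ x y).
rewrite AE /R tr_col_mx trmx1 mul_col_mx mul1mx -mulmxA mulVmx // mulmx1.
rewrite mul_col_row !mulmx1; congr block_mx.
  by rewrite trmx_mul trmxK trmx_inv symB mulmxA mulmxV // mul1mx.
by rewrite trmx_mul trmxK trmx_inv symB mulmxA.
Qed.

(** * Reduction modulo odd primes and modulo 16 *)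

(** The fibres of squaring have at most two elements, and the fibre over 0 has only one. *)
Lemma card_squares (F : finFieldType) : (#|F| < 2 * #|[set x ^+ 2 | x : F]|)%N.
Proof.
set S := [set x ^+ 2 | x : F]; have S0 : 0 \in S.
  by apply/imsetP; exists 0; rewrite // expr0n.
have -> : #|F| = (\sum_(s in S) #|[set x : F | x ^+ 2 == s]|)%N.
  rewrite -sum1_card (partition_big (fun x : F => x ^+ 2) (mem S)) /=; last first.
    by move=> x _; apply: imset_f.
  by apply: eq_bigr => s _; rewrite sum1dep_card.
rewrite (bigD1 0) //= (cardsD1 0 S) S0.
have -> : [set x : F | x ^+ 2 == 0] = [set 0] by apply/setP=> x; rewrite !inE sqrf_eq0.
rewrite cards1.
apply: (@leq_ltn_trans (1 + 2 * #|S :\ 0%R|)); last by rewrite mulnDr ltn_add2r.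
rewrite leq_add2l.
have -> : (2 * #|S :\ 0%R| = \sum_(s in S | s != 0%R) 2)%N.
  by rewrite sum_nat_const mulnC; congr (_ * _)%N; apply: eq_card => s; rewrite !inE andbC.
apply: leq_sum => s /andP[/imsetP[r _ ->] _].
apply: (@leq_trans #|[set r; - r]|); last by rewrite cards2; case: eqP.
by apply/subset_leq_card/subsetP => x; rewrite !inE eqf_sqr.
Qed.

(** Pigeonhole: the values of [u * x ^ 2] and of [c - w * y ^ 2] each fill more than half of the
    field. *)
Lemma binary_form_surjective (F : finFieldType) (u w c : F) : u != 0 -> w != 0 ->
  exists x y, u * x ^+ 2 + w * y ^+ 2 = c.
Proof.
move=> u0 w0; set S := [set x ^+ 2 | x : F].
pose A := [set u * s | s in S]; pose B := [set c - w * s | s in S].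
have cA : #|A| = #|S| by rewrite card_imset //; exact: mulfI.
have cB : #|B| = #|S|.
  by rewrite card_imset // => s t /addrI /oppr_inj; exact: mulfI.
have /set0Pn[z] : A :&: B != set0.
  apply/eqP => AB; have := card_squares F; rewrite -/S mul2n -addnn -{1}cA -cB.
  by rewrite -cardsUI AB cards0 addn0 ltnNge max_card.
rewrite inE => /andP[/imsetP[_ /imsetP[x _ ->] zx] /imsetP[_ /imsetP[y _ ->] zy]].
by exists x, y; rewrite -zx zy subrK.
Qed.

(** After diagonalization three coefficients are nonzero, and the binary form on two of them
    represents minus the third. The resulting zero lies outside the radical. *)
Lemma smooth_isotropic (F : finFieldType) n (A : 'M[F]_n) (f g : 'I_3 -> 'I_n) :
    2%:R != 0 :> F -> A^T = A -> \det (mxsub f g A) != 0 ->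
  exists x y, bilin A x x = 0 /\ bilin A x y != 0.
Proof.
move=> F2 symA; have [P Pu [d AE]] := symmetric_diagonalizable F2 symA.
pose T := [set i | d 0 i != 0]; have [T3|T2] := ltnP 2 #|T|; last first.
  (* With at most two nonzero diagonal entries the form factors through [E], of rank at most 2, and
     all 3x3 minors vanish. *)
  pose E : 'M[F]_(#|T|, n) := rowsub enum_val 1%:M.
  have dE : diag_mx d = diag_mx d *m E^T *m E.
    apply/matrixP=> i j; rewrite -mulmxA !mxE (bigD1 i) //= big1 => [|k ki]; last first.
      by rewrite !mxE eq_sym (negPf ki) mul0r.
    rewrite addr0 !mxE eqxx mulr1n.
    have [->|di] := eqVneq (d 0 i) 0; first by rewrite mul0r mul0rn.
    have iT : i \in T by rewrite inE.
    rewrite (bigD1 (enum_rank_in iT i)) //= big1 => [|k ki]; last first.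
      rewrite -(inj_eq enum_val_inj) enum_rankK_in // in ki.
      by rewrite !mxE (negPf ki) mul0r.
    by rewrite !mxE enum_rankK_in // eqxx mul1r addr0 mulr_natr.
  rewrite AE dE -!mulmxA mulmxA !mulmxA => det0.
  have : \rank (mxsub f g (P *m diag_mx d *m E^T *m E *m P^T)) = 3%N.
    by apply: mxrank_unit; rewrite unitmxE unitfE.
  rewrite -mulmxA mxsub_mul => r3; have := leq_trans (mxrankM_maxl _ _) (rank_leq_col (rowsub f (P *m diag_mx d *m E^T))).
  by move=> /(_ _ (colsub g (E *m P^T))); rewrite r3 ltnNge in T2 *; rewrite T2.
move=> _; case/card_gt2P: T3 => i [j [k [[iT jT kT] [ij jk ki]]]].
rewrite !inE in iT jT kT.
have [a [b abE]] := binary_form_surjective (- d 0 k) iT jT.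
pose v : 'rV_n := a *: delta_mx 0 i + b *: delta_mx 0 j + delta_mx 0 k.
have bE x y : bilin A (x *m invmx P) (y *m invmx P) = bilin (diag_mx d) x y.
  by rewrite AE bilin_congr !mulmxKV.
exists (v *m invmx P), (delta_mx 0 k *m invmx P); rewrite !bE /v.
have dd x y : bilin (diag_mx d) (delta_mx 0 x) (delta_mx 0 y) = d 0 x *+ (x == y).
  by rewrite bilin_delta mxE.
rewrite !(bilinDl, bilinDr, bilinZl, bilinZr) !dd !eqxx.
rewrite !(eq_sym j i, eq_sym i k, eq_sym k j) (negPf ij) (negPf jk) (negPf ki).
rewrite !(mulr0n, mulr0, addr0, add0r, mulr1n); split=> //.
apply/eqP; rewrite addr_eq0; apply/eqP; rewrite -abE; ring.
Qed.

(** Lift a zero modulo [p] outside the radical to integral vectors: the value at [x] is divisible by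
    [p], the value at [y] is integral, and their pairing is a unit. *)
Lemma nonCS_padic_minor p (p_prime : prime p) n (C : 'M[int]_n) (f g : 'I_3 -> 'I_n) :
    odd p -> C^T = C -> ~~ (p %| \det (mxsub f g C))%Z ->
  nonCS (Padic p_prime) (bilin (map_mx intr C)).
Proof.
move=> p_odd symC minor0; have pF := pchar_Fp p_prime.
pose red : {rmorphism int -> 'F_p} := (intr : int -> 'F_p).
have red0 (m : int) : (red m == 0) = (p %| m)%Z by rewrite (dvdz_pcharf pF).
have [||| x [y [xx xy]]] := @smooth_isotropic _ _ (map_mx red C) f g.
- rewrite -(dvdn_pcharf pF); apply/negP => /(@dvdn_leq _ 2 isT) p2.
  by move: p_odd (prime_gt1 p_prime) p2; case: (p) => [|[|[|]]].
- by rewrite map_trmx symC.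
- by rewrite -map_mxsub det_map_mx /= red0.
pose lift (x : 'rV['F_p]_n) : 'rV[int]_n := map_mx (fun u : 'F_p => (u : nat)%:Z) x.
have liftK z : map_mx red (lift z) = z.
  by apply/matrixP=> i j; rewrite !mxE; exact: natr_Zp.
have bE z z' : red (bilin C (lift z) (lift z')) = bilin (map_mx red C) z z'.
  by rewrite /bilin -[in RHS](liftK z) -[in RHS](liftK z') [in RHS]map_trmx -!map_mxM [RHS]mxE.
have bQ z z' : bilin (map_mx intr C) (map_mx intr z) (map_mx intr z') =
    (bilin C z z')%:~R :> rat.
  by rewrite /bilin map_trmx -!map_mxM [LHS]mxE.
exists (map_mx intr (lift x)), (map_mx intr (lift y)); rewrite !bQ /=.
rewrite padic_normM //.
have h1 : padic_norm p (bilin C (lift x) (lift x))%:~R < 1.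
  by rewrite padic_norm_int_lt1 // -red0 bE xx.
have h2 : padic_norm p (bilin C (lift y) (lift y))%:~R <= 1 := padic_norm_int_le1 p_prime _.
have -> : padic_norm p (bilin C (lift x) (lift y))%:~R = 1.
  apply/eqP; rewrite eq_le padic_norm_int_le1 //= leNgt padic_norm_int_lt1 //.
  by rewrite -red0 bE.
rewrite expr1n; apply: le_lt_trans h1.
by rewrite ler_piMr // padic_norm_ge0.
Qed.

Lemma padic_norm_sum_lt p (p_prime : prime p) (I : finType) (F : I -> rat) (c : rat) :
  0 < c -> (forall i, padic_norm p (F i) < c) -> padic_norm p (\sum_i F i) < c.
Proof.
move=> c0 Fc; apply: (big_ind (fun s => padic_norm p s < c)) => [|s t hs ht|i _] //.
have [st|/ltW ts] := leP (padic_norm p s) (padic_norm p t).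
  exact: le_lt_trans (padic_normD_le p_prime st (lexx _)) ht.
exact: le_lt_trans (padic_normD_le p_prime (lexx _) ts) hs.
Qed.

Lemma padic_norm_bilin_lt p (p_prime : prime p) n (E : 'M[rat]_n) (z : 'rV[int]_n) c :
    0 < c -> (forall i j, padic_norm p (E i j) < c) ->
  padic_norm p (bilin E (map_mx intr z) (map_mx intr z)) < c.
Proof.
move=> c0 Ec; rewrite bilinE; apply: (padic_norm_sum_lt p_prime c0) => i.
apply: (padic_norm_sum_lt p_prime c0) => j.
rewrite !mxE mulrAC mulrC !(padic_normM p_prime).
apply: le_lt_trans (Ec i j); rewrite ler_piMr ?padic_norm_ge0 //.
by rewrite mulr_ile1 ?padic_norm_ge0 ?padic_norm_int_le1.
Qed.

Lemma primitive_multiple n (x : 'rV[rat]_n) : x != 0 ->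
  exists (c : rat) (z : 'rV[int]_n), [/\ c != 0, x = c *: map_mx intr z &
    forall p, prime p -> exists i, ~~ (p %| z 0%R i)%Z].
Proof.
move=> x0; pose D := \prod_i denq (x 0 i).
have D0 : D != 0 by apply/prodf_neq0 => i _; rewrite denq_neq0.
have DQ : D%:~R != 0 :> rat by rewrite intr_eq0.
pose w i := numq (x 0 i * D%:~R).
have wE i : (w i)%:~R = x 0 i * D%:~R.
  have : x 0 i * D%:~R \is a Num.int.
    rewrite /D (bigD1 i) //= intrM mulrA -[X in X * _ * _](divq_num_den (x 0 i)).
    by rewrite divfK ?intr_eq0 ?denq_neq0 // rpredM ?intr_int.
  by rewrite Qint_def => /eqP dE; rewrite -[RHS]divq_num_den dE divr1.
pose g := \big[gcdn/0%N]_i `|w i|%N.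
have gw i : (g %| `|w i|)%N by apply: (@biggcdn_inf _ i).
have [i xi] : exists i, x 0 i != 0.
  by apply/existsP; apply: contraNT x0; rewrite negb_exists => /forallP x0;
     apply/eqP/rowP => i; rewrite mxE; exact/eqP/negPn.
have g0 : (0 < g)%N.
  have wi : w i != 0 by rewrite -(intr_eq0 rat) wE mulf_neq0.
  by apply: dvdn_gt0 (gw i); rewrite absz_gt0.
have gQ : g%:R != 0 :> rat by rewrite pnatr_eq0 -lt0n.
exists (g%:R / D%:~R), (\row_i (w i %/ g)%Z); split.
- by rewrite mulf_neq0 ?invr_eq0.
- apply/rowP => j; rewrite !mxE -[x 0 j](mulfK DQ) -wE.
  rewrite mulrAC; congr (_ / _).
  have /dvdzP[q qE] : (g %| w j)%Z by rewrite dvdzE gw.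
  rewrite qE mulzK; last by rewrite -lt0n in g0 *; case: (g) g0.
  by rewrite intrM mulrC.
move=> p p_prime; apply/existsP; apply: contraT; rewrite negb_exists => /forallP H; exfalso.
(* A prime dividing all reduced coordinates could be absorbed into their greatest common divisor
   [g]. *)
have : (p * g %| g)%N.
  apply/dvdn_biggcdP => j _.
  have := H j; rewrite negbK mxE => /dvdzP[q qE].
  have /dvdzP[r rE] : (g %| w j)%Z by rewrite dvdzE gw.
  move: qE; rewrite rE mulzK; last by case: (g) g0.
  by move=> ->; rewrite !abszM /= -mulnA dvdn_mull.
by rewrite -[X in (_ %| X)%N]mul1n dvdn_pmul2r // dvdn1 => /eqP p1; rewrite p1 in p_prime.
Qed.

Lemma sqr_mod32 (z : int) :
  (exists t, z ^+ 2 = 8 * t + 1) \/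
  ((2 %| z)%Z /\ exists t, z ^+ 2 = 16 * t \/ z ^+ 2 = 32 * t + 4).
Proof.
have odd_case (y : int) : ~~ (2 %| y)%Z -> exists t, y ^+ 2 = 8 * t + 1.
  move=> y_odd; have [k kE] : exists k : int, y = 2 * k + 1.
    by exists (y %/ 2)%Z; lia.
  have [t tE] : exists t : int, k * (k + 1) = 2 * t.
    have [/dvdzP[m ->]|k_odd] := boolP (2 %| k)%Z; first by exists (m * (m * 2 + 1)); ring.
    have -> : k = 2 * (k %/ 2)%Z + 1 by lia.
    by exists ((2 * (k %/ 2)%Z + 1) * ((k %/ 2)%Z + 1)); ring.
  exists t; have -> : 8 * t = 4 * (2 * t) by ring.
  by rewrite -tE kE; ring.
have [z2|/odd_case] := boolP (2 %| z)%Z; last by left.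
right; split=> //; have /dvdzP[y ->] := z2.
have [/dvdzP[k ->]|/odd_case[t tE]] := boolP (2 %| y)%Z.
  by exists (k ^+ 2); left; ring.
by exists t; right; rewrite exprMn tE; ring.
Qed.

(** Up to sign and order this is [<1, 3, -2, -6>], the norm form of the algebra [(-3, 2)], which is
    a division algebra at 2. The classes of squares in [sqr_mod32] leave finitely many cases. *)
Lemma Q0_anisotropic_mod16 (z0 z1 z2 z3 : int) :
    (16 %| 6 * z0 ^+ 2 - 3 * z1 ^+ 2 + 2 * z2 ^+ 2 - z3 ^+ 2)%Z ->
  [/\ (2 %| z0)%Z, (2 %| z1)%Z, (2 %| z2)%Z & (2 %| z3)%Z].
Proof.
move=> /dvdzP[k]; move: (sqr_mod32 z0) (sqr_mod32 z1) (sqr_mod32 z2) (sqr_mod32 z3).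
move: (z0 ^+ 2) (z1 ^+ 2) (z2 ^+ 2) (z3 ^+ 2) => s0 s1 s2 s3.
case=> [[t0 e0]|[d0 [t0 [e0|e0]]]]; case=> [[t1 e1]|[d1 [t1 [e1|e1]]]];
case=> [[t2 e2]|[d2 [t2 [e2|e2]]]]; case=> [[t3 e3]|[d3 [t3 [e3|e3]]]];
  first [by split | by clear -e0 e1 e2 e3; move=> E; exfalso; lia].
Qed.

(** Twice the coefficients of Q0, as in its polar matrix. *)
Definition Q0_diag : 'rV[int]_4 := \row_i nth 0 [:: 12; -6; 4; -2] i.

(** The pencil is known up to scale only, so closeness to Q0 is measured against [e], which will be
    the last diagonal entry of [B]. If [B] is [c] times the diagonal matrix of [Q0_diag], that entry
    is [-2 * c] and the left side vanishes. At a primitive isotropic vector of [B], closeness makes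
    the value of Q0 divisible by 16. *)
Lemma near_Q0_anisotropic (B : 'M[rat]_4) (e : rat) :
    (forall i j, padic_norm 2 (2 * B i j + e * (Q0_diag 0 i *+ (i == j))%:~R) <
       padic_norm 2 (16 * e)) ->
  ~ isotropic (bilin B).
Proof.
move=> near [x x0 xB].
have [c [z [c0 xE z_prim]]] := primitive_multiple x0.
have pn : prime 2 by [].
have Bz : bilin B (map_mx intr z) (map_mx intr z) = 0.
  apply/eqP; move: xB; rewrite xE bilinZl bilinZr => /eqP.
  by rewrite !mulf_eq0 (negPf c0).
pose v := 6 * z 0 0 ^+ 2 - 3 * z 0 1 ^+ 2 + 2 * z 0 2%:R ^+ 2 - z 0 3%:R ^+ 2.
have e0 : e != 0.
  have := near 0 0; apply: contraTneq => ->.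
  by rewrite mulr0 padic_norm0 -leNgt padic_norm_ge0.
pose E := 2 *: B + e *: map_mx intr (diag_mx Q0_diag).
have vE : 2 * e * v%:~R = bilin E (map_mx intr z) (map_mx intr z).
  rewrite bilinD !bilinZ Bz mulr0 add0r -mulrA mulrCA; congr (_ * _).
  have -> : map_mx intr (diag_mx Q0_diag) = diag_mx (map_mx intr Q0_diag) :> 'M[rat]_4.
    by apply/matrixP=> i j; rewrite !mxE rmorphMn.
  rewrite bilin_diag !big_ord_recl big_ord0 addr0 !mxE /=.
  have -> : lift ord0 ord0 = 1 :> 'I_4 by apply/val_inj.
  have -> : lift ord0 (lift ord0 ord0) = 2%:R :> 'I_4 by apply/val_inj.
  have -> : lift ord0 (lift ord0 (lift ord0 ord0)) = 3%:R :> 'I_4 by apply/val_inj.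
  by rewrite /v !(rmorphD, rmorphB, rmorphM, rmorphXn) /=; ring.
have lt_v : padic_norm 2 (2 * e * v%:~R) < padic_norm 2 (16 * e).
  have pos : 0 < padic_norm 2 (16 * e) by rewrite padic_norm_gt0 // mulf_neq0.
  rewrite vE; apply: (padic_norm_bilin_lt pn _ pos) => i j.
  by have := near i j; rewrite !mxE.
have v16 : (16 %| v)%Z.
  (* Cancelling [2 * e] leaves [|v| < |8|]; being strict, this gives a fourth factor 2. *)
  have v8 : padic_norm 2 v%:~R < padic_norm 2 (2 ^ 3)%N%:Z%:~R.
    move: lt_v; have -> : 16 * e = 2 * e * (2 ^ 3)%N%:Z%:~R by ring.
    rewrite !(padic_normM pn (2 * e)) ltr_pM2l // (padic_norm_gt0 pn).
    by rewrite mulf_neq0.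
  have [->//|v0] := eqVneq v 0.
  have : (padic_norm 2 v%:~R <= (2%:R ^+ 4)^-1).
    move: v8; rewrite !padic_norm_int // pfactorK //.
    rewrite ltf_pV2 ?posrE ?exprn_gt0 // lef_pV2 ?posrE ?exprn_gt0 //.
    by rewrite -!natrX ltr_nat ler_nat ltn_exp2l // leq_exp2l.
  by rewrite -(dvdz_padic_norm pn 4).
have [h0 h1 h2 h3] := Q0_anisotropic_mod16 v16.
have [i] := z_prim 2 pn; case/negP.
case: i => -[|[|[|[|//]]]] lt; [move: h0|move: h1|move: h2|move: h3];
  congr (_ %| z 0%R _)%Z; exact/val_inj.
Qed.

(** * The determinant that separates the rulings *)

Section Determinants.
Variable F : comNzRingType.

Lemma det_antiblock n (Y Z R : 'M[F]_n) :
  \det (block_mx 0 Y Z R) = (-1) ^+ n * (\det Y * \det Z).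
Proof.
pose J : 'M[F]_(n + n) := block_mx 0 1%:M (- 1%:M) 0.
have detJ : \det J = 1.
  have -> : J = block_mx 1%:M 1%:M 0 1%:M *m block_mx 1%:M 0 (- 1%:M) 1%:M
                *m block_mx 1%:M 1%:M 0 1%:M.
    rewrite !mulmx_block !(mul1mx, mulmx1, mul0mx, mulmx0, addr0, add0r, mulNmx).
    by rewrite subrr !(mul0mx, add0r, mul1mx, addNr).
  by rewrite !det_mulmx !det_ublock det_lblock !det1 !mulr1.
rewrite -[LHS]mulr1 -[X in _ * X = _]detJ -det_mulmx mulmx_block.
rewrite !(mul0mx, mulmx0, mulmx1, addr0, add0r, mulmxN).
by rewrite det_lblock -scaleN1r detZ mulrA.
Qed.

Definition last_col n : 'cV[F]_(n + 1) := col_mx 0 1%:M.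

Lemma last_colE n i : last_col n i 0 = (i == rshift n (0 : 'I_1))%:R.
Proof.
rewrite /last_col; case: (split_ordP i) => j ->.
  by rewrite col_mxEu mxE eq_lrshift.
by rewrite col_mxEd mxE (inj_eq (@rshift_inj _ _)).
Qed.

(** Bordering by the last unit vector deletes the last row and column: unipotent operations with [f]
    and [g] first clear them in [A]. *)
Lemma det_bordered n (A : 'M[F]_(n + 1)) :
  \det (block_mx A (last_col n) (last_col n)^T 0) = - \det (ulsubmx A).
Proof.
set e := last_col n; have ee : e^T *m e = 1%:M.
  by rewrite /e tr_col_mx mul_row_col trmx0 mul0mx add0r trmx1 mul1mx.
have eE : e *m e^T = block_mx 0 0 0 1%:M.
  by rewrite /e tr_col_mx mul_col_row trmx0 trmx1 !(mul0mx, mul1mx, mulmx0).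
pose f : 'cV[F]_(n + 1) := col_mx (ursubmx A) (drsubmx A).
pose g : 'cV[F]_(n + 1) := col_mx (dlsubmx A)^T 0.
pose D : 'M[F]_(n + 1) := block_mx (ulsubmx A) 0 0 1%:M.
have AE : A = (D - e *m e^T) + f *m e^T + e *m g^T.
  rewrite eE /D /e /f /g !tr_col_mx !mul_col_row opp_block_mx !add_block_mx.
  rewrite !(trmx0, trmx1, trmxK, mul0mx, mulmx0, mul1mx, mulmx1, addr0, add0r, oppr0, subrr).
  by rewrite submxK.
have De : D *m e = e by rewrite /D /e mul_block_col !(mulmx0, mul0mx, mul1mx, addr0, add0r).
have -> : block_mx A e e^T 0 =
    block_mx 1%:M f 0 1%:M *m block_mx (D - e *m e^T) e e^T 0 *m block_mx 1%:M 0 g^T 1%:M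
    :> 'M_(n + 1 + 1).
  rewrite !mulmx_block !(mul1mx, mulmx1, mul0mx, mulmx0, addr0, add0r).
  by rewrite -AE.
have -> : block_mx (D - e *m e^T) e e^T 0 =
    block_mx D 0 0 1%:M *m (block_mx 1%:M (- e) 0 1%:M *m block_mx 1%:M 0 e^T (- 1%:M)
      *m block_mx 1%:M e 0 1%:M) :> 'M_(n + 1 + 1).
  rewrite !mulmx_block !(mul1mx, mulmx1, mul0mx, mulmx0, addr0, add0r, mulNmx, mulmxN, opprK).
  rewrite mulmxBl mul1mx -mulmxA ee mulmx1 !subrr add0r De.
  by rewrite mulmxBr mulmx1 mulmxA De.
rewrite !(det_mulmx, det_ublock, det_lblock, det1, mulr1, mul1r).
by rewrite det_mx11 !mxE mulrN1.
Qed.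
End Determinants.

Section Ruling.
Variable F : fieldType.
Variables (A : 'M[F]_(4 + 1)) (M : 'M[F]_(3, 4 + 1)).
Hypotheses (symA : A^T = A) (MAM : M *m A *m M^T = 0).

(** The isotropic space [M] pairs through [A] with a complement spanned by [U]; the column of last
    coordinates completes this 3x2 matrix to a square one. The quotient by [ruling_den] does not
    depend on [U], and its square is the 4x4 corner minor of [A]. *)
Definition ruling_num (U : 'M[F]_(2, 4 + 1)) : F :=
  \det (row_mx (M *m A *m U^T) (M *m last_col F 4) : 'M_(2 + 1)).

Definition ruling_den (U : 'M[F]_(2, 4 + 1)) : F := \det (col_mx M U : 'M_(3 + 2)).

(** Another choice is [V = X M + T U]. As [M] is isotropic, numerator and denominator are both
    multiplied by [\det T]. *)
Lemma ruling_ratio_indep U V : ruling_den U != 0 ->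
  ruling_num V * ruling_den U = ruling_num U * ruling_den V.
Proof.
move=> U0; pose P : 'M_(3 + 2) := col_mx M U.
have Pu : P \in unitmx by rewrite unitmxE unitfE.
pose XT : 'M_(2, 3 + 2) := V *m invmx P.
have VE : V = lsubmx XT *m M + rsubmx XT *m U.
  by rewrite -mul_row_col hsubmxK mulmxKV.
set X := lsubmx _ in VE; set T := rsubmx _ in VE.
have -> : ruling_num V = ruling_num U * \det T.
  rewrite /ruling_num -(det_tr T) -[\det T^T]mulr1 -(@det1 F 1) -(det_lblock T^T 0 1%:M).
  rewrite -det_mulmx; congr (\det _).
  rewrite mul_row_block mulmx1 !mulmx0 addr0 add0r.
  have -> : V^T = M^T *m X^T + U^T *m T^T by rewrite {1}VE linearD /= !trmx_mul.
  by rewrite mulmxDr !mulmxA MAM mul0mx add0r.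
have -> : ruling_den V = ruling_den U * \det T.
  rewrite /ruling_den mulrC -[\det T]mul1r -(@det1 F 3) -(det_lblock 1%:M X T) -det_mulmx.
  by congr (\det _); rewrite mul_block_col mul1mx mul0mx addr0 -VE.
by rewrite mulrAC mulrA.
Qed.

(** In the basis given by [M] and [U] the bordered matrix has a 3x3 zero block, flanked by the
    matrix of [ruling_num] and its transpose. Its determinant is therefore minus a square, and
    [det_bordered] computes it again. *)
Lemma ruling_num_sqr U :
  ruling_num U ^+ 2 = ruling_den U ^+ 2 * \det (ulsubmx A).
Proof.
set m := M *m last_col F 4; set N := M *m A *m U^T.
pose e := last_col F 4; pose P : 'M_(3 + 2, 4 + 1) := col_mx M U.
have E : block_mx P 0 0 1%:M *m block_mx A e e^T 0 *m block_mx P^T 0 0 1%:M =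
  block_mx 0 (row_mx N m) (col_mx N^T m^T)
    (block_mx (U *m A *m U^T) (U *m e) (U *m e)^T 0) :> 'M_(3 + 3).
  (* The sizes [3 + (2 + 1)] and [(3 + 2) + 1] are convertible, so the cast is the identity. *)
  rewrite block_mxA (_ : esym _ = erefl); last exact: eq_irrelevance.
  rewrite castmx_id !mulmx_block !(mul0mx, mulmx0, mulmx1, mul1mx, addr0, add0r).
  have -> : P *m A *m P^T = block_mx 0 N N^T (U *m A *m U^T).
    rewrite /P tr_col_mx mul_col_mx mul_col_row MAM.
    by rewrite /N !trmx_mul trmxK symA mulmxA.
  have -> : P *m e = col_mx m (U *m e) by rewrite /P mul_col_mx.
  by rewrite -trmx_mul /P mul_col_mx tr_col_mx.
pose P6 : 'M_6 := block_mx P 0 0 1%:M.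
pose A6 : 'M_6 := block_mx A e e^T 0.
pose Q6 : 'M_6 := block_mx P^T 0 0 1%:M.
have detP6 : \det P6 = ruling_den U.
  by apply: etrans (det_ublock (P : 'M_5) 0 1%:M) _; rewrite det1 mulr1.
have detQ6 : \det Q6 = ruling_den U.
  by apply: etrans (det_ublock (P^T : 'M_5) 0 1%:M) _; rewrite det1 mulr1 det_tr.
have detA6 : \det A6 = - \det (ulsubmx A) := det_bordered A.
have : \det (P6 *m A6 *m Q6) = \det (block_mx 0 (row_mx N m) (col_mx N^T m^T)
    (block_mx (U *m A *m U^T) (U *m e) (U *m e)^T 0) : 'M_(3 + 3)) by rewrite -E.
rewrite !det_mulmx detP6 detQ6 detA6 det_antiblock.
have -> : col_mx N^T m^T = (row_mx N m)^T by rewrite tr_row_mx.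
rewrite det_tr -/(ruling_num U) => H; apply: oppr_inj.
transitivity ((-1) ^+ 3 * (ruling_num U * ruling_num U)); first by ring.
by rewrite -[LHS]H; ring.
Qed.

(** Otherwise [M *m A] and [M] would be orthogonal of rank 3 in a space of dimension 5. *)
Lemma isotropic_det0 : \rank M = 3%N -> \det A = 0.
Proof.
move=> rM; apply/eqP/negPn/negP => A0.
have Au : A \in unitmx by rewrite unitmxE unitfE.
have := mulmx0_rank_max MAM; rewrite mxrank_tr mxrankMfree ?rM //.
by rewrite row_free_unit.
Qed.
End Ruling.

(** Cauchy-Binet, summed over all maps as in the indexing of [plucker]. *)
Lemma det_mulmx_expand (R : comNzRingType) k n (M : 'M[R]_(k, n)) (W : 'M[R]_(n, k)) :
  \det (M *m W) = \sum_(f : {ffun 'I_k -> 'I_n}) (\prod_c W (f c) c) * \det (colsub f M).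
Proof.
rewrite -det_tr; under eq_bigr do rewrite -det_tr.
rewrite /determinant; under [RHS]eq_bigr do rewrite mulr_sumr.
rewrite exchange_big /=; apply: eq_bigr => s _.
under eq_bigr do rewrite !mxE.
rewrite bigA_distr_bigA /= mulr_sumr; apply: eq_bigr => f _.
rewrite mulrCA; congr (_ * _).
rewrite -big_split /=; apply: eq_bigr => c _.
by rewrite !mxE mulrC.
Qed.

Lemma colsub_injective (R : comNzRingType) k n (M : 'M[R]_(k, n)) (f : 'I_k -> 'I_n) :
  \det (colsub f M) != 0 -> injective f.
Proof.
move=> f0 i j fij; apply/eqP/negPn/negP => ij; case/eqP: f0.
by rewrite -det_tr (determinant_alternate ij) // => c; rewrite !mxE fij.
Qed.

Lemma extend_to_perm k l (f : 'I_k -> 'I_(k + l)) : injective f ->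
  exists s : 'S_(k + l), forall i, s (lshift l i) = f i.
Proof.
move=> f_inj; pose S := ~: [set f i | i : 'I_k].
have cS : #|S| = l by rewrite cardsCs setCK card_imset // !card_ord addKn.
pose g (x : 'I_(k + l)) := match fintype.split x with
  | inl i => f i | inr j => enum_val (cast_ord (esym cS) j) end.
have gl i : g (lshift l i) = f i by rewrite /g (unsplitK (inl i)).
have gr j : g (rshift k j) = enum_val (cast_ord (esym cS) j).
  by rewrite /g (unsplitK (inr j)).
have fS i j : f i != g (rshift k j).
  apply: contraTneq (enum_valP (cast_ord (esym cS) j)) => E.
  by rewrite -gr -E inE negbK imset_f.
have g_inj : injective g.
  move=> x y; case: (split_ordP x) => i ->; case: (split_ordP y) => j ->.
  - by rewrite !gl => /f_inj ->.
  - by rewrite gl => /eqP E; have := fS i j; rewrite E.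
  - by rewrite gl => /esym/eqP E; have := fS j i; rewrite E.
  - by rewrite !gr => /enum_val_inj /cast_ord_inj ->.
by exists (perm g_inj) => i; rewrite permE gl.
Qed.

(** Completing [M] by the unit vectors outside three chosen columns makes [ruling_den] a Pluecker
    coordinate up to sign. *)
Lemma det_row_extension (F : comNzRingType) (M : 'M[F]_(3, 3 + 2)) (s : 'S_(3 + 2)) :
  \det (col_mx M (rowsub (s \o @rshift 3 2) 1%:M)) =
  (-1) ^+ s * \det (colsub (s \o @lshift 3 2) M).
Proof.
set X := col_mx _ _; have -> : \det X = (-1) ^+ s * \det (col_perm s X).
  by rewrite col_permE det_mulmx det_perm odd_permV mulrCA -signr_addb addbb mulr1.
congr (_ * _); rewrite -[RHS]mulr1 -(@det1 F 2).
rewrite -(det_ublock _ (colsub (s \o @rshift 3 2) M)); congr (\det _).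
have splitl (k : 'I_3) : fintype.split (lshift 2 k) = inl k := unsplitK (inl k).
have splitr (k : 'I_2) : fintype.split (rshift 3 k) = inr k := unsplitK (inr k).
apply/matrixP=> i j; rewrite [LHS]mxE.
case: (split_ordP i) => i' ->; case: (split_ordP j) => j' ->;
  rewrite !(mxE, splitl, splitr) //=.
- by rewrite (inj_eq (@perm_inj _ s)) eq_rlshift.
- by rewrite (inj_eq (@perm_inj _ s)) (inj_eq (@rshift_inj _ _)).
Qed.

Lemma row_free_minor (F : fieldType) k l (M : 'M[F]_(k, k + l)) : \rank M = k ->
  exists s : 'S_(k + l), \det (colsub (s \o @lshift k l) M) != 0.
Proof.
move=> rM; have Mf : row_free M by rewrite /row_free rM.
have /row_freeP[W MW] := Mf.
have : \det (M *m W) != 0 by rewrite MW det1 oner_neq0.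
rewrite det_mulmx_expand => sum0.
have /existsP[f f0] : [exists f : {ffun 'I_k -> 'I_(k + l)}, \det (colsub f M) != 0].
  apply: contraNT sum0; rewrite negb_exists => /forallP H.
  by rewrite big1 // => f _; have := H f; rewrite negbK => /eqP ->; rewrite mulr0.
have [s sE] := extend_to_perm (colsub_injective f0).
exists s; rewrite (_ : colsub _ M = colsub f M) //.
by apply/matrixP=> i j; rewrite !mxE /= sE.
Qed.

(** * Regular functions on the projective line *)

Section RegularFunctions.
Variable F : closedFieldType.

Lemma poly_funext (p r : {poly F}) : (forall x, p.[x] = r.[x]) -> p = r.
Proof.
move=> pr; apply/eqP; rewrite -subr_eq0; apply/negPn/negP => /closed_nonrootP[x].
by rewrite rootE !hornerE pr subrr eqxx.
Qed.

Definition regular (h : F -> F) : Prop := forall x0, exists f g : {poly F},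
  g.[x0] != 0 /\ forall x, g.[x] != 0 -> h x = f.[x] / g.[x].

(** Write [h] near 0 as a quotient in lowest terms. Its denominator divides every local denominator,
    so a root of it would contradict regularity there. *)
Lemma regular_polynomial (h : F -> F) : regular h -> exists p, forall x, h x = p.[x].
Proof.
move=> reg; have [f0 [g0 [g0_0 h0]]] := reg 0.
have g0N : g0 != 0 by apply: contraNneq g0_0 => ->; rewrite horner0.
pose d := gcdp f0 g0.
have dN : d != 0 by rewrite gcdp_eq0 negb_and g0N orbT.
pose f1 := f0 %/ d; pose g1 := g0 %/ d.
have f0E : f0 = f1 * d by rewrite /f1 divpK ?dvdp_gcdl.
have g0E : g0 = g1 * d by rewrite /g1 divpK ?dvdp_gcdr.
have cop : coprimep f1 g1 by apply: coprimep_div_gcd; rewrite g0N orbT.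
have local x0 : exists f g : {poly F}, [/\ g.[x0] != 0, h x0 = f.[x0] / g.[x0] & f * g1 = f1 * g].
  have [f [g [gx hE]]] := reg x0; exists f, g; split=> //; first exact: hE.
  have gN : g != 0 by apply: contraNneq gx => ->; rewrite horner0.
  have : f * g0 * (g * g0) = f0 * g * (g * g0).
    apply: poly_funext => x; rewrite !hornerM.
    have [->|gx0] := eqVneq g.[x] 0; first by ring.
    have [->|g0x0] := eqVneq g0.[x] 0; first by ring.
    congr (_ * _); have := hE x gx0; rewrite (h0 x g0x0) => /eqP.
    by rewrite eqr_div // => /eqP ->.
  move/(mulIf (mulf_neq0 gN g0N)).
  by rewrite {1}g0E {1}f0E mulrA [RHS]mulrAC => /(mulIf dN) ->.
have g1_size : size g1 = 1%N.
  apply/eqP/negPn/negP => /closed_rootP[x0 /eqP g1x].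
  have [f [g [gx _ fg]]] := local x0.
  have cop2 : coprimep g1 f1 by rewrite coprimep_sym.
  have : g1 %| g.
    by rewrite -(Gauss_dvdpr g cop2) -fg dvdp_mull.
  by case/dvdpP => e gE; rewrite gE hornerM g1x mulr0 eqxx in gx.
have [c c0 g1E] : exists2 c, c != 0 & g1 = c%:P by apply/size_poly1P/eqP.
exists (c^-1 *: f1) => x; have [f [g [gx -> fg]]] := local x.
rewrite hornerZ; have := congr1 (fun p => p.[x]) fg.
rewrite g1E !hornerM hornerC => E.
apply: (mulIf gx); rewrite divfK // -mulrA -E; by rewrite mulrC mulfK.
Qed.

(** [h] and [k] are one regular function on the projective line in its two charts, hence constant;
    the points 0 of the charts are 0 and infinity. *)
Lemma regular_inverse_constant (h k : F -> F) : regular h -> regular k ->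
  (forall x, x != 0 -> h x = k x^-1) -> h 0 = k 0.
Proof.
move=> /regular_polynomial[p hp] /regular_polynomial[r kr] hk.
(* [rr] is [x ^ n * r(1 / x)]; comparing degrees in [p * 'X^n = rr] shows that [p] is constant. *)
pose n := size r; pose rr := \poly_(i < n.+1) r`_(n - i).
have E : p * 'X^n = rr.
  (* The extra factor makes the identity hold also at 0, where the hypothesis says nothing. *)
  suff : p * 'X^n * 'X = rr * 'X by move/(mulIf (monic_neq0 (monicX F))).
  apply: poly_funext => x; rewrite !hornerM !hornerXn !hornerX.
  have [->|x0] := eqVneq x 0; first by rewrite !mulr0.
  congr (_ * _); rewrite -hp hk // kr horner_poly.
  rewrite (@horner_coef_wide _ n.+1 r _ (leqnSn _)).
  rewrite mulr_suml (reindex_inj rev_ord_inj) /=; apply: eq_bigr => i _.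
  rewrite subSS -mulrA; congr (_ * _).
  have -> : x ^+ n = x ^+ (n - i) * x ^+ i by rewrite -exprD subnK // -ltnS.
  by rewrite exprVn mulKf // expf_neq0.
have szp : (size p <= 1)%N.
  have [->|pN] := eqVneq p 0; first by rewrite size_poly0.
  have := size_poly n.+1 (fun i => r`_(n - i)); rewrite -/rr -E size_mulXn //.
  by rewrite -[n.+1]addn1 leq_add2l.
have [c pE] : exists c, p = c%:P by apply/size_polyC_leq1 || by exists p`_0; apply: size1_polyC.
have kc x : x != 0 -> k x = c.
  by move=> x0; rewrite -[x]invrK -hk ?invr_eq0 // hp pE hornerC.
rewrite hp pE hornerC kr.
have -> : r = c%:P; last by rewrite hornerC.
apply: (mulIf (monic_neq0 (monicX F))); apply: poly_funext => x.
rewrite !hornerM hornerX hornerC; have [->|x0] := eqVneq x 0; first by rewrite !mulr0.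
by rewrite -kr kc.
Qed.
End RegularFunctions.

From mathcomp Require Import all_classical reals topology.
From mathcomp Require Import -(notations) mpoly.

(** * Polar matrices and homogeneous polynomials *)

Lemma homogeneousP n (K : fieldType) d (g : mpoly n K) :
  reflect {in msupp g, forall m, mdeg m = d} (homogeneous d g).
Proof. exact: dhomogP. Qed.

(* The matrix of the bilinear form g(x + y) - g(x) - g(y). *)
Definition polar (K : fieldType) (g : form5 K) : 'M[K]_5 :=
  \matrix_(i, j) (quad_coef g (i, j) *+ (1 + (i == j))).

Lemma polar_sym (K : fieldType) (g : form5 K) : (polar g)^T = polar g.
Proof.
apply/matrixP=> i j; rewrite !mxE eq_sym /quad_coef /=.
by congr (mcoeff _ _ *+ _); apply/mnmP => k; rewrite !mnmDE addnC.
Qed.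

Lemma quad_coef_sum (K : fieldType) (c : 'I_5 -> K) (q : 'I_5 -> form5 K) ij :
  quad_coef (\sum_k c k *: q k) ij = \sum_k c k * quad_coef (q k) ij.
Proof.
by rewrite /quad_coef raddf_sum /=; apply: eq_bigr => k _; rewrite mcoeffZ.
Qed.

Lemma polar_sum (K : fieldType) (c : 'I_5 -> K) (q : 'I_5 -> form5 K) :
  polar (\sum_i c i *: q i) = \sum_i c i *: polar (q i).
Proof.
apply/matrixP=> i j; rewrite mxE quad_coef_sum summxE -sumrMnl.
by apply: eq_bigr => k _; rewrite !mxE mulrnAr.
Qed.

Lemma polarD (K : fieldType) (g h : form5 K) : polar (g + h) = polar g + polar h.
Proof. by apply/matrixP=> i j; rewrite !mxE /quad_coef mcoeffD mulrnDl. Qed.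

Lemma polarZ (K : fieldType) (c : K) (g : form5 K) : polar (c *: g) = c *: polar g.
Proof. by apply/matrixP=> i j; rewrite !mxE /quad_coef mcoeffZ mulrnAr. Qed.

Lemma polar_map (K L : fieldType) (f : {rmorphism K -> L}) (g : form5 K) :
  polar (map_mpoly f g) = map_mx f (polar g).
Proof.
by apply/matrixP=> i j; rewrite !mxE /quad_coef mcoeff_map_mpoly rmorphMn.
Qed.

Lemma mdeg2P n (m : multinom n) : mdeg m = 2%N -> exists i j, m = mnm_add (mnm1 i) (mnm1 j).
Proof.
move=> m2; have [i mi] : exists i, m i != 0%N.
  apply/existsP; apply: contraPT m2; rewrite negb_exists => /forallP m0.
  by rewrite mdegE big1 // => i _; apply/eqP/negPn.
have mE : mnm_add (mnm_sub m (mnm1 i)) (mnm1 i) = m by apply: submK; rewrite lep1mP.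
have /mdeg1P[j /eqP jE] : mdeg (mnm_sub m (mnm1 i)) == 1%N.
  by have := congr1 mdeg mE; rewrite mdegD mdeg1 m2 addn1 => -[->].
by exists j, i; rewrite -jE.
Qed.

Lemma eq_mnm1D n (i j k l : 'I_n) :
  (mnm_add (mnm1 i) (mnm1 j) == mnm_add (mnm1 k) (mnm1 l)) =
  (i == k) && (j == l) || (i == l) && (j == k).
Proof.
apply/eqP/orP => [/mnmP E|[/andP[/eqP-> /eqP->]|/andP[/eqP-> /eqP->]]] //; last first.
  by apply/mnmP => h; rewrite !mnmDE addnC.
have cancel (a b c : 'I_n) :
    (forall h, (mnm_add (mnm1 a) (mnm1 b)) h = (mnm_add (mnm1 a) (mnm1 c)) h) -> b == c.
  move=> H; rewrite -eq_mnm1; apply/eqP/mnmP => h.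
  by have := H h; rewrite !mnmDE => /addnI.
have : (k == i) || (l == i).
  have := E i; rewrite !mnmDE !mnm1E eqxx.
  by case: (k == i) => //; case: (l == i).
case/orP => /eqP ki; [left|right]; rewrite eq_sym ki eqxx /=; apply: (@cancel i) => h.
  by rewrite E ki.
by rewrite E -ki !mnmDE addnC.
Qed.

Lemma polar_mulX (K : fieldType) (i j : 'I_5) :
  polar (mpolyX K (mnm1 i) * mpolyX K (mnm1 j)) = delta_mx i j + delta_mx j i.
Proof.
rewrite -mpolyXD.
apply/matrixP=> k l; rewrite !mxE /quad_coef mcoeffX /= eq_mnm1D.
rewrite (eq_sym i k) (eq_sym j l) (eq_sym i l) (eq_sym j k).
have [->|ki] := eqVneq k i; have [->|li] := eqVneq l i.
- by case: (i == j); rewrite /= ?mul0rn ?addr0 // mulr2n.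
- by rewrite andbF addr0 orbF addn0 mulr1n.
- by rewrite (negPf ki) andbT add0r addn0 mulr1n.
- by rewrite andbF mul0rn addr0.
Qed.

Lemma meval_polar (K : fieldType) (g : form5 K) (x : 'rV_5) :
  homogeneous 2 g -> 2%:R * meval (x 0) g = bilin (polar g) x x.
Proof.
move/homogeneousP => g2.
have -> : polar g = \sum_(m <- msupp g) mcoeff m g *: polar (mpolyX K m).
  apply/matrixP => i j; rewrite mxE /quad_coef {1}[g]mpolyE raddf_sum summxE -sumrMnl.
  by apply: eq_bigr => m _; rewrite !mxE /quad_coef /= mcoeffZ mulrnAr.
rewrite {1}[g]mpolyE raddf_sum mulr_sumr /bilin mulmx_sumr mulmx_suml summxE.
apply: eq_big_seq => m /g2 /mdeg2P[i [j ->]].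
rewrite /= mevalZ -scalemxAr -scalemxAl mxE mulrCA; congr (_ * _).
rewrite mpolyXD mevalM !mevalXU polar_mulX.
rewrite /bilin mulmxDr mulmxDl mxE -!/(bilin _ _ _) !bilinE.
have sumE a b : \sum_k \sum_l x 0 k * delta_mx a b k l * x 0 l = x 0 a * x 0 b.
  have inner k : \sum_l x 0 k * delta_mx a b k l * x 0 l = x 0 k * (k == a)%:R * x 0 b.
    rewrite (bigD1 b) //= mxE eqxx andbT [X in _ + X]big1 ?addr0 // => l lb.
    by rewrite mxE (negPf lb) andbF mulr0 mul0r.
  rewrite (eq_bigr _ (fun k _ => inner k)) (bigD1 a) //= eqxx mulr1.
  rewrite [X in _ + X]big1 ?addr0 // => k ka.
  by rewrite (negPf ka) mulr0 mul0r.
by rewrite !sumE; ring.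
Qed.

Lemma map_Q0 (K L : fieldType) (f : {rmorphism K -> L}) : map_mpoly f (Q0 K) = Q0 L.
Proof.
by rewrite /Q0 rmorphB rmorphD rmorphB /= !map_mpolyZ !rmorphXn /= !map_mpolyX !rmorph_nat.
Qed.

Lemma map_Q1 (K L : fieldType) (f : {rmorphism K -> L}) : map_mpoly f (Q1 K) = Q1 L.
Proof. by rewrite /Q1 rmorphD !rmorphM /= !map_mpolyX. Qed.

Section WeightedHomogeneity.
Variables (n : nat) (K : fieldType) (w : multinom n -> nat).
Hypothesis wD : forall m1 m2, w (mnm_add m1 m2) = (w m1 + w m2)%N.
Implicit Types F G : mpoly n K.

(** An arbitrary additive weight covers the total degree as well as the two partial degrees on
    Z_P. *)
Definition weight_homogeneous d F := all (fun m => w m == d) (msupp F).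

Lemma weight_homogeneousP d F :
  reflect {in msupp F, forall m, w m = d} (weight_homogeneous d F).
Proof. by apply: (iffP allP) => H m /H => [/eqP|->]. Qed.

Lemma weight_homogeneous0 d : weight_homogeneous d 0.
Proof. by rewrite /weight_homogeneous msupp0. Qed.

Lemma weight_homogeneousX d m : w m = d -> weight_homogeneous d (mpolyX K m).
Proof. by move=> <-; rewrite /weight_homogeneous msuppX /= eqxx. Qed.

Lemma weight_homogeneousD d F G :
  weight_homogeneous d F -> weight_homogeneous d G -> weight_homogeneous d (F + G).
Proof.
move=> /weight_homogeneousP hF /weight_homogeneousP hG.
apply/weight_homogeneousP => m /msuppD_le; rewrite mem_cat.
by case/orP => [/hF|/hG].
Qed.

Lemma weight_homogeneousZ d (c : K) F :
  weight_homogeneous d F -> weight_homogeneous d (c *: F).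
Proof.
by move=> /weight_homogeneousP hF; apply/weight_homogeneousP => m /msuppZ_le /hF.
Qed.

Lemma weight_homogeneous_sum (I : Type) (r : seq I) (P : pred I) d (F : I -> mpoly n K) :
  (forall i, P i -> weight_homogeneous d (F i)) ->
  weight_homogeneous d (\sum_(i <- r | P i) F i).
Proof.
move=> hF; apply: (big_ind (fun G => weight_homogeneous d G)) => //.
  exact: weight_homogeneous0.
by move=> G1 G2; exact: weight_homogeneousD.
Qed.

Lemma weight_homogeneousM d e F G :
  weight_homogeneous d F -> weight_homogeneous e G ->
  weight_homogeneous (d + e)%N (F * G).
Proof.
move=> /weight_homogeneousP hF /weight_homogeneousP hG.
apply/weight_homogeneousP => m /msuppM_le /allpairsP[[m1 m2] /= [/hF e1 /hG e2 ->]].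
by rewrite wD e1 e2.
Qed.

Lemma weight_homogeneousC (c : K) : weight_homogeneous 0 (mpolyC n c).
Proof.
have w0 : w mnm0 = 0%N.
  by have := wD mnm0 mnm0; rewrite add0m => /eqP; rewrite -{1}[w _]addn0 eqn_add2l => /eqP.
have -> : mpolyC n c = c *: mpolyX K mnm0 by rewrite mpolyX0 -mul_mpolyC mulr1.
by apply/weight_homogeneousZ/weight_homogeneousX.
Qed.

Lemma weight_homogeneous_prod (I : Type) (r : seq I) d (F : I -> mpoly n K) :
  (forall i, weight_homogeneous d (F i)) ->
  weight_homogeneous (size r * d)%N (\prod_(i <- r) F i).
Proof.
move=> hF; elim: r => [|i r IH]; first by rewrite big_nil; exact: (weight_homogeneousC 1).
by rewrite big_cons /= mulSn; exact: weight_homogeneousM.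
Qed.

Lemma weight_homogeneous_det k d (M : 'M[mpoly n K]_k) :
  (forall i j, weight_homogeneous d (M i j)) -> weight_homogeneous (k * d)%N (\det M).
Proof.
move=> hM; apply: weight_homogeneous_sum => s _.
have hP : weight_homogeneous (k * d)%N (\prod_i M i (s i)).
  have := weight_homogeneous_prod (index_enum 'I_k) (fun i => hM i (s i)).
  by rewrite -sum1_size big_const_ord iter_addn_0 mul1n.
rewrite mulr_sign; case: ifP => // _.
by rewrite -scaleN1r; exact: weight_homogeneousZ.
Qed.
End WeightedHomogeneity.

(** * Planes whose 3x3 minors span the cubics *)

(* The cubic monomials in t_0, ..., t_4 are indexed by their exponents, those of
   t_(h 0) t_(h 1) t_(h 2) being [exponents h]. *)
Definition exponents (h : {ffun 'I_3 -> 'I_5}) : {ffun 'I_5 -> 'I_4} :=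
  [ffun k => inord #|[set c | h c == k]|].

Definition cubic_exponents : {set {ffun 'I_5 -> 'I_4}} := [set exponents h | h : {ffun 'I_3 -> 'I_5}].

Notation ncubics := #|cubic_exponents|.

Lemma exponentsE h k : nat_of_ord (exponents h k) = #|[set c | h c == k]|.
Proof. by rewrite ffunE inordK // ltnS (leq_trans (max_card _)) // card_ord. Qed.

Lemma exponents_cubic h : exponents h \in cubic_exponents.
Proof. exact: imset_f. Qed.

Definition cubic_index (h : {ffun 'I_3 -> 'I_5}) : 'I_ncubics :=
  enum_rank_in (exponents_cubic h) (exponents h).

Lemma cubic_indexK h : enum_val (cubic_index h) = exponents h.
Proof. by rewrite enum_rankK_in ?exponents_cubic. Qed.

Section MinorCoefficients.
Variable R : comNzRingType.
Implicit Types (H : 'I_5 -> 'M[R]_5) (t : 'I_5 -> R).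

Definition cubic_monomial t (a : 'I_ncubics) : R := \prod_k t k ^+ enum_val a k.

Lemma cubic_monomialE t h : cubic_monomial t (cubic_index h) = \prod_c t (h c).
Proof.
rewrite /cubic_monomial cubic_indexK [RHS](partition_big h predT) //=.
apply: eq_bigr => k _; rewrite exponentsE.
under eq_bigr => c /eqP -> do [].
by rewrite prodr_const; congr (_ ^+ _); apply: eq_card => c; rewrite !inE.
Qed.

(** The coefficient of the monomial [a] in a minor of the pencil: by multilinearity, [h] picks one
    of the five matrices for each row. *)
Definition minor_coef H (f g : 'I_3 -> 'I_5) (a : 'I_ncubics) : R :=
  \sum_(h : {ffun 'I_3 -> 'I_5} | cubic_index h == a)
    \det (\matrix_(c, c') H (h c) (f c) (g c')).

Lemma minor_expand H t f g :
  \det (mxsub f g (\sum_k t k *: H k)) = \sum_a cubic_monomial t a * minor_coef H f g a.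
Proof.
under [RHS]eq_bigr do rewrite /minor_coef mulr_sumr.
transitivity (\sum_(h : {ffun 'I_3 -> 'I_5})
   cubic_monomial t (cubic_index h) * \det (\matrix_(c, c') H (h c) (f c) (g c'))); last first.
  rewrite (partition_big cubic_index predT) //=; apply: eq_bigr => a _.
  by apply: eq_bigr => h /eqP ->.
rewrite /determinant; under [RHS]eq_bigr do rewrite mulr_sumr.
rewrite exchange_big /=; apply: eq_bigr => s _.
under eq_bigr do rewrite !mxE summxE.
rewrite bigA_distr_bigA /= mulr_sumr; apply: eq_bigr => h _.
rewrite mulrCA; congr (_ * _); rewrite cubic_monomialE -big_split /=.
by apply: eq_bigr => c _; rewrite !mxE.
Qed.
End MinorCoefficients.

Lemma minor_coef_map (R S : comNzRingType) (u : {rmorphism R -> S}) (H : 'I_5 -> 'M[R]_5) f g a :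
  u (minor_coef H f g a) = minor_coef (fun k => map_mx u (H k)) f g a.
Proof.
rewrite rmorph_sum; apply: eq_bigr => h _; rewrite -det_map_mx; congr (\det _).
by apply/matrixP=> c c'; rewrite !mxE.
Qed.

Notation minor_index := ({ffun 'I_3 -> 'I_5} * {ffun 'I_3 -> 'I_5})%type.

(** The coefficients of [ncubics] fixed combinations [C] of the minors. One nonzero determinant then
    certifies that the minors span the cubics. *)
Definition minor_matrix (R : comNzRingType) (u : rat -> R) (C : minor_index -> 'I_ncubics -> rat)
    (H : 'I_5 -> 'M[R]_5) : 'M[R]_ncubics :=
  \matrix_(a, e) \sum_fg u (C fg e) * minor_coef H fg.1 fg.2 a.

Lemma det_minor_matrix_map (R S : comNzRingType) (u : {rmorphism R -> S}) (i : rat -> R) C H :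
  u (\det (minor_matrix i C H)) = \det (minor_matrix (u \o i) C (fun k => map_mx u (H k))).
Proof.
rewrite -det_map_mx; congr (\det _); apply/matrixP => a e; rewrite !mxE rmorph_sum.
by apply: eq_bigr => fg _; rewrite rmorphM minor_coef_map.
Qed.

(** The inverse matrix expresses every cubic monomial through minors; the cubes of the coordinates
    are enough to exclude a common zero of all minors. *)
Lemma cubics_from_minors (K : fieldType) (u : rat -> K) C (H : 'I_5 -> 'M[K]_5) :
    minor_matrix u C H \in unitmx ->
  exists D : 'I_5 -> minor_index -> K, forall t i,
    t i ^+ 3 = \sum_fg D i fg * \det (mxsub fg.1 fg.2 (\sum_k t k *: H k)).
Proof.
set M := minor_matrix u C H => Mu.
pose D i fg := \sum_e u (C fg e) * invmx M e (cubic_index [ffun=> i]).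
exists D => t i; pose tau : 'rV[K]_ncubics := \row_a cubic_monomial t a.
have -> : t i ^+ 3 = tau 0 (cubic_index [ffun=> i]).
  by rewrite mxE cubic_monomialE; under eq_bigr do rewrite ffunE; rewrite prodr_const card_ord.
have tM e : (tau *m M) 0 e =
    \sum_fg u (C fg e) * \det (mxsub fg.1 fg.2 (\sum_k t k *: H k)).
  rewrite mxE; under eq_bigr do rewrite /tau /M /minor_matrix !mxE mulr_sumr.
  rewrite exchange_big /=; apply: eq_bigr => fg _.
  by rewrite minor_expand mulr_sumr; apply: eq_bigr => a _; rewrite mulrCA.
rewrite -{1}(mulmxK Mu tau) mxE.
under [LHS]eq_bigr do rewrite tM mulr_suml; under [RHS]eq_bigr do rewrite mulr_suml.
rewrite exchange_big /=; apply: eq_bigr => fg _; apply: eq_bigr => e _.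
by rewrite mulrAC.
Qed.

Section PlanePolynomial.
Variables (J : {ffun 'I_5 -> 'I_5 * 'I_5}) (C : minor_index -> 'I_ncubics -> rat).

Definition plucker_var (j : {ffun 'I_5 -> 'I_5 * 'I_5}) : plane_poly :=
  mpolyX rat (mnm1 (enum_rank j)).

Definition replace_column (k : 'I_5) (ij : 'I_5 * 'I_5) : {ffun 'I_5 -> 'I_5 * 'I_5} :=
  [ffun s => if s == k then ij else J s].

Definition plane_polar (k : 'I_5) : 'M[plane_poly]_5 :=
  \matrix_(i, j) (plucker_var (replace_column k (i, j)) *+ (1 + (i == j))).

(* By Cramer's rule the basis of the plane that is adjugate to the columns in
   [J] has Pluecker coordinates as coefficients. *)
Definition generic_poly : plane_poly :=
  plucker_var J * \det (minor_matrix (@mpolyC _ rat) C plane_polar).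

Lemma generic_poly_homogeneous : homogeneous (1 + ncubics * 3)%N generic_poly.
Proof.
have wD := @mdegD #|{ffun 'I_5 -> 'I_5 * 'I_5}|.
have var1 j : weight_homogeneous mdeg 1 (plucker_var j).
  by apply: weight_homogeneousX; rewrite mdeg1.
apply: (weight_homogeneousM wD) => //; apply: (weight_homogeneous_det wD) => a e.
rewrite mxE; apply: weight_homogeneous_sum => fg _; rewrite mul_mpolyC.
apply: weight_homogeneousZ; apply: weight_homogeneous_sum => h _.
apply: (@weight_homogeneous_det _ _ mdeg wD 3 1) => c c'; rewrite !mxE.
rewrite -scaler_nat; exact: weight_homogeneousZ.
Qed.

Section Evaluation.
Variables (K : numFieldType) (q : 'I_5 -> form5 K).

Definition column_minor : 'M[K]_5 := \matrix_(r, s) quad_coef (q r) (J s).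

Definition adjugate_basis (k : 'I_5) : form5 K := \sum_r \adj column_minor k r *: q r.

Let v := plucker (fun i => quad_coef (q i)).
Let ev : {rmorphism plane_poly -> K} := meval v \o map_mpoly (ratr : rat -> K).

Let ev_var j : ev (plucker_var j) = \det (\matrix_(r, s) quad_coef (q r) (j s)).
Proof.
rewrite /ev /= map_mpolyX mevalXU; congr (\det _).
by apply/matrixP=> r s; rewrite !mxE enum_rankK.
Qed.

Let cramer k ij : \det (\matrix_(r, s) quad_coef (q r) (replace_column k ij s)) =
  quad_coef (adjugate_basis k) ij.
Proof.
set A := \matrix_(r, s) _.
have AE r : A r k = quad_coef (q r) ij by rewrite mxE ffunE eqxx.
have cofE r : cofactor A r k = \adj column_minor k r.
  rewrite [RHS]mxE; congr (_ * \det _).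
  by apply/matrixP=> i j; rewrite !mxE ffunE eq_sym (negPf (neq_lift _ _)).
rewrite (expand_det_col A k) quad_coef_sum; apply: eq_bigr => r _.
by rewrite AE cofE mulrC.
Qed.

Lemma meval_generic_poly :
  meval v (map_mpoly (ratr : rat -> K) generic_poly) =
  \det column_minor * \det (minor_matrix (ratr : rat -> K) C (fun k => polar (adjugate_basis k))).
Proof.
rewrite -[LHS]/(ev _) /generic_poly rmorphM ev_var; congr (_ * _).
rewrite det_minor_matrix_map; congr (\det _); apply/matrixP => a e; rewrite !mxE.
apply: eq_bigr => fg _; congr (_ * _); first by rewrite /= map_mpolyC mevalC.
rewrite /minor_coef; apply: eq_bigr => h _; congr (\det _).
apply/matrixP => c c'; rewrite [LHS]mxE [RHS]mxE [LHS]mxE [RHS]mxE [X in ev X]mxE.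
rewrite rmorphMn; congr (_ *+ _).
exact: etrans (ev_var _) (cramer _ _).
Qed.
End Evaluation.
End PlanePolynomial.

Lemma common_denominator (I : finType) (F : I -> rat) :
  exists2 N : int, N != 0 & exists z : I -> int, forall i, N%:~R * F i = (z i)%:~R.
Proof.
pose N := \prod_i denq (F i).
exists N; first by apply/prodf_neq0 => i _; rewrite denq_neq0.
exists (fun i => numq (F i) * \prod_(j | j != i) denq (F j)) => i.
rewrite /N (bigD1 i) //= !intrM mulrAC -[X in _ * X * _]divq_num_den mulrA.
by rewrite [_ * (numq _)%:~R]mulrC mulfK ?intr_eq0 ?denq_neq0.
Qed.

(** [S] collects the denominators of the pencil and of the formulas for the cubes. At an odd prime
    outside [S], a primitive point has a coordinate prime to [p], so not all its 3x3 minors are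
    divisible by [p]. *)
Lemma minors_nonCS (H : 'I_5 -> 'M[rat]_5) (D : 'I_5 -> minor_index -> rat) :
    (forall k, (H k)^T = H k) ->
    (forall t i, t i ^+ 3 = \sum_fg D i fg * \det (mxsub fg.1 fg.2 (\sum_k t k *: H k))) ->
  exists2 S, (0 < S)%N & forall p (p_prime : prime p), odd p -> ~~ (p %| S)%N ->
  forall t : 'rV[rat]_5, t != 0 -> nonCS (Padic p_prime) (bilin (\sum_i t 0 i *: H i)).
Proof.
move=> symH DH.
have [N N0 [G GE]] := common_denominator (fun x : 'I_5 * ('I_5 * 'I_5) => H x.1 x.2.1 x.2.2).
have [N' N'0 [E EE]] := common_denominator (fun x : 'I_5 * minor_index => D x.1 x.2).
exists (absz (N * N')); first by rewrite absz_gt0 mulf_neq0.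
move=> p p_prime p_odd pS t t0.
have [c [z [c0 tE pz]]] := primitive_multiple t0; have [i pzi] := pz _ p_prime.
pose B : 'M[int]_5 := \matrix_(a, b) \sum_k z 0 k * G (k, (a, b)).
have BE : map_mx intr B = N%:~R *: \sum_k (z 0 k)%:~R *: H k :> 'M[rat]_5.
  apply/matrixP => a b; rewrite !mxE summxE mulr_sumr rmorph_sum; apply: eq_bigr => k _.
  by rewrite [RHS]/= mxE mulrCA (GE (k, (a, b))) /= intrM.
have NQ : N%:~R != 0 :> rat by rewrite intr_eq0.
have symB : B^T = B.
  apply/matrixP => a b; rewrite !mxE; apply: eq_bigr => k _; congr (_ * _).
  apply: (@intr_inj rat); rewrite -!GE /=; congr (_ * _).
  by rewrite -{1}symH mxE.
have detB (f g : 'I_3 -> 'I_5) : \det (mxsub f g (\sum_k (z 0 k)%:~R *: H k)) * N%:~R ^+ 3 =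
    (\det (mxsub f g B))%:~R :> rat.
  have -> : (\det (mxsub f g B))%:~R = \det (map_mx intr (mxsub f g B)) :> rat.
    by rewrite det_map_mx.
  rewrite map_mxsub BE; set T := \sum_k _.
  have -> : mxsub f g (N%:~R *: T) = N%:~R *: mxsub f g T by apply/matrixP => a b; rewrite !mxE.
  by rewrite detZ mulrC.
have key : N' * (N ^+ 3 * z 0 i ^+ 3) = \sum_fg E (i, fg) * \det (mxsub fg.1 fg.2 B).
  apply: (@intr_inj rat); rewrite intrM intrM !rmorphXn /= (DH (fun k => (z 0 k)%:~R)) rmorph_sum.
  rewrite !mulr_sumr; apply: eq_bigr => fg _; rewrite rmorphM /= -(EE (i, fg)) -detB /=.
  by move: (\det _) => d; ring.
have [fg pfg] : exists fg : minor_index, ~~ (p %| \det (mxsub fg.1 fg.2 B))%Z.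
  apply/existsP; apply: contraT; rewrite negb_exists => /forallP H0.
  have : (p %| N' * (N ^+ 3 * z 0%R i ^+ 3))%Z.
    rewrite key; apply: (big_ind (fun x => (p %| x)%Z)) => [|x y|fg _]; first exact: dvdz0.
      exact: rpredD.
    by apply: dvdz_mull; apply/negPn/H0.
  rewrite dvdzE abszM abszM !abszX Euclid_dvdM // Euclid_dvdM // !Euclid_dvdX //= !andbT.
  move: pS pzi; rewrite dvdzE abszM Euclid_dvdM // negb_or => /andP[/negPf-> /negPf->].
  by move=> /negPf ->.
apply: (@nonCS_similar _ _ _ (bilin (map_mx intr B)) _ id (N%:~R / c)).
- by rewrite mulf_neq0 ?invr_eq0.
- move=> x y; rewrite -!bilinZ; congr (bilin _ _ _).
  rewrite BE !scaler_sumr; apply: eq_bigr => k _.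
  by rewrite !scalerA tE !mxE mulrA divfK.
exact: nonCS_padic_minor pfg.
Qed.

Lemma generic_plane_nonCS J C (q : 'I_5 -> form5 rat) :
    in_zariski_open [:: generic_poly J C] q ->
  exists2 S, (0 < S)%N & forall p (p_prime : prime p), odd p -> ~~ (p %| S)%N ->
  forall t : 'rV[rat]_5, t != 0 -> nonCS (Padic p_prime) (bilin (\sum_i t 0 i *: polar (q i))).
Proof.
move=> [F]; rewrite inE => /eqP ->.
rewrite meval_generic_poly mulf_eq0 negb_or => /andP[Q0 M0].
have [|D DE] := @cubics_from_minors _ (ratr : rat -> rat) C
  (fun k => polar (adjugate_basis J q k)); first by rewrite unitmxE unitfE.
have [S S0 HS] := minors_nonCS (fun k => polar_sym _) DE.
exists S; first exact: S0.
move=> p p_prime p_odd pS t t0.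
set Q := column_minor J q in Q0.
have Qu : \adj Q \in unitmx.
  rewrite unitmxE unitfE; apply: contraNneq (expf_neq0 5 Q0) => adj0.
  by rewrite -det_scalar -mul_mx_adj det_mulmx adj0 mulr0.
(* The same quadric, written in the basis [adjugate_basis]. *)
have := HS _ p_prime p_odd pS (t *m invmx (\adj Q)).
have -> : \sum_i (t *m invmx (\adj Q)) 0 i *: polar (adjugate_basis J q i) =
    \sum_i t 0 i *: polar (q i).
  under eq_bigr do rewrite polar_sum scaler_sumr.
  rewrite exchange_big /=; apply: eq_bigr => r _.
  under eq_bigr do rewrite scalerA.
  rewrite -scaler_suml; congr (_ *: _).
  by rewrite -[in RHS](mulmxKV Qu t) mxE.
by apply; apply: contraNneq t0 => tQ; rewrite -(mulmxKV Qu t) tQ mul0mx.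
Qed.

(** * An explicit plane whose 3x3 minors span the cubics *)

Lemma inord_eq (i : 'I_5) k : (k < 5)%N -> (i == inord k) = (i == k :> nat).
Proof. by move=> k5; rewrite -val_eqE /= inordK. Qed.

(* The polar matrix of the quadric
   - t0 Q0 + t1 Q1 + t2 (x0 x2 - x3 x4) + t3 (x0^2 + x2 x4) + t4 (x1 x2 + x0 x4). *)
Definition example_entry (R : nzRingType) (t : seq R) (i j : nat) : R :=
  nth 0 (nth [::] [:: [:: 2 * t`_3 - 12 * t`_0; t`_1; t`_2; 0; t`_4];
                      [:: t`_1; 6 * t`_0; t`_4; 0; 0];
                      [:: t`_2; t`_4; - (4 * t`_0); t`_1; t`_3];
                      [:: 0; 0; t`_1; 2 * t`_0; - t`_2];
                      [:: t`_4; 0; t`_3; - t`_2; 0]] i) j.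

Definition det3 (R : nzRingType) (e : nat -> nat -> R) (a b c d f g : nat) : R :=
  e a d * (e b f * e c g - e b g * e c f) - e a f * (e b d * e c g - e b g * e c d)
  + e a g * (e b d * e c f - e b f * e c d).

Section CubicsFromExample.
Variables (R : comNzRingType) (t : seq R) (P : R -> Prop).
Hypothesis PB : forall p q, P p -> P q -> P (p - q).
Hypothesis P_div : forall n p, (n != 0)%N -> P (n%:R * p) -> P p.

Let d := det3 (example_entry t).
Let m i j k : R := t`_i * t`_j * t`_k.

Hypothesis Pd : forall a b c x y z, all (ltn^~ 5)%N [:: a; b; c; x; y; z] -> P (d a b c x y z).

Let P0 : P 0. Proof. by rewrite -(subrr (d 0 0 0 0 0 0)); apply: PB; exact: Pd. Qed.
Let PN p : P p -> P (- p). Proof. by rewrite -sub0r; exact: PB. Qed.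
Let PD p q : P p -> P q -> P (p + q). Proof. by move=> Pp /PN /(PB Pp); rewrite opprK. Qed.
Let PM n p : P p -> P (n%:R * p).
Proof. by move=> Pp; rewrite mulr_natl; elim: n => // n; rewrite mulrS; exact: PD. Qed.

Local Ltac close := first [assumption | exact: Pd | apply: PM; close | apply: PN; close |
  apply: PB; close | apply: PD; close].
Local Ltac cubic c e := apply: (@P_div c) => //;
  match goal with |- P ?x => have -> : x = e by (rewrite /d /m /det3 /example_entry /=; ring) end; close.

(** [P] will be membership in the rational span of the minors; as a predicate it reduces the proof
    to ring identities in the entries of [t]. *)
Lemma cubics_in_span i j k : (i < 5)%N -> (j < 5)%N -> (k < 5)%N -> P (t`_i * t`_j * t`_k).
Proof.
(* Each step writes a multiple of a new monomial as a combination of minors and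
   earlier monomials, found by a computer search. *)
have P114 : P (m 1 1 4) by cubic 1%N (d 0 1 2 0 3 4).
have P012 : P (m 0 1 2) by cubic 6%N (- d 0 1 2 1 2 3 + m 1 1 4).
have P014 : P (m 0 1 4) by cubic 6%N (d 0 1 2 1 3 4).
have P144 : P (m 1 4 4) by cubic 1%N (d 0 1 2 2 3 4).
have P002 : P (m 0 0 2) by cubic 12%N (- d 0 1 3 1 2 3 + 2 * m 0 1 4).
have P004 : P (m 0 0 4) by cubic 12%N (d 0 1 3 1 3 4).
have P044 : P (m 0 4 4) by cubic 2%N (d 0 1 3 2 3 4).
have P124 : P (m 1 2 4) by cubic 1%N (- d 0 1 4 0 3 4).
have P022 : P (m 0 2 2) by cubic 6%N (d 0 1 4 1 2 3 + m 1 2 4).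
have P034 : P (m 0 3 4) by cubic 6%N (d 0 1 4 1 2 4).
have P024 : P (m 0 2 4) by cubic 6%N (- d 0 1 4 1 3 4).
have P244 : P (m 2 4 4) by cubic 1%N (- d 0 1 4 2 3 4).
have P123 : P (m 1 2 3) by cubic 1%N (d 0 2 4 1 3 4 + m 2 4 4).
have P223 : P (m 2 2 3) by cubic 2%N (- d 0 3 4 0 3 4 + 12 * m 0 2 2 - 2 * m 0 4 4).
have P122 : P (m 1 2 2) by cubic 1%N (- d 0 3 4 1 3 4).
have P222 : P (m 2 2 2) by cubic 1%N (- d 0 3 4 2 3 4 - m 1 2 4 - 2 * m 0 3 4).
have P013 : P (m 0 1 3) by cubic 6%N (- d 1 2 3 1 2 4 + 24 * m 0 0 2 + m 2 4 4).
have P003 : P (m 0 0 3) by cubic 12%N (- d 1 2 3 1 3 4 - 6 * m 0 1 2).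
have P033 : P (m 0 3 3) by cubic 6%N (- d 1 2 4 1 2 4).
have P023 : P (m 0 2 3) by cubic 6%N (d 1 2 4 1 3 4).
have P234 : P (m 2 3 4) by cubic 1%N (d 1 2 4 2 3 4).
have P224 : P (m 2 2 4) by cubic 1%N (- d 1 3 4 2 3 4).
have P113 : P (m 1 1 3) by cubic 1%N (- d 0 1 2 0 1 4 - 72 * m 0 0 3 + 12 * m 0 3 3
    + m 1 4 4 - 6 * m 0 2 4).
have P334 : P (m 3 3 4) by cubic 2%N (d 0 1 2 0 2 4 + 12 * m 0 3 4 + 4 * m 0 1 4
    + m 1 2 3 + m 2 4 4).
have P112 : P (m 1 1 2) by cubic 1%N (d 0 1 3 0 1 4 - 72 * m 0 0 2 + 12 * m 0 2 3).
have P133 : P (m 1 3 3) by cubic 2%N (- d 0 2 3 0 2 4 - 48 * m 0 0 2 + 8 * m 0 2 3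
    + m 1 2 4 + 12 * m 0 1 3 + m 2 2 2).
have P333 : P (m 3 3 3) by cubic 2%N (- d 0 2 4 0 2 4 + 2 * m 2 3 4 + 12 * m 0 3 3
    + 4 * m 0 4 4).
have P233 : P (m 2 3 3) by cubic 2%N (d 0 2 4 0 3 4 + m 2 2 4 + 12 * m 0 2 3 + m 1 4 4).
have P344 : P (m 3 4 4) by cubic 1%N (d 0 2 4 1 2 4 + m 1 3 3).
have P134 : P (m 1 3 4) by cubic 1%N (- d 0 2 4 2 3 4 + 4 * m 0 2 4 + m 2 2 3).
have P444 : P (m 4 4 4) by cubic 1%N (- d 0 1 2 1 2 4 + m 1 3 4 - 24 * m 0 0 4
    - 6 * m 0 2 3).
have P000 : P (m 0 0 0) by cubic 768%N (3 * d 0 1 2 0 1 2 - d 0 2 3 0 2 3 + 128 * m 0 0 3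
  - 6 * m 1 2 4 - 36 * m 0 4 4 + 6 * m 3 4 4 + 16 * m 0 2 2 - 2 * m 1 1 3).
have P011 : P (m 0 1 1) by cubic 4%N (d 0 1 2 0 1 2 - 288 * m 0 0 0 + 48 * m 0 0 3
    - 2 * m 1 2 4
  - 12 * m 0 4 4 + 2 * m 3 4 4 + 6 * m 0 2 2).
have P001 : P (m 0 0 1) by cubic 64%N (d 0 2 3 1 2 3 - d 0 1 2 0 1 3 + 12 * m 0 1 3
    + 2 * m 0 2 4).
have P111 : P (m 1 1 1) by cubic 1%N (- d 0 2 3 1 2 3 - 8 * m 0 0 1 - 2 * m 0 2 4).
have swap1 a b c : m a b c = m b a c by rewrite /m (mulrC t`_a).
have swap2 a b c : m a b c = m a c b by rewrite /m mulrAC.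
rewrite -[_ * _]/(m i j k).
have sorted a b c : (a <= b)%N -> (b <= c)%N -> (c < 5)%N -> P (m a b c).
  by move: a b c => [|[|[|[|[|a]]]]] [|[|[|[|[|b]]]]] [|[|[|[|[|c]]]]] // _ _ _; assumption.
move=> i5 j5 k5.
have [ij|/ltnW ij] := leqP i j; have [jk|/ltnW jk] := leqP j k; have [ik|/ltnW ik] := leqP i k.
all: first [exact: sorted | rewrite swap1; exact: sorted | rewrite swap2; exact: sorted
  | rewrite swap1 swap2; exact: sorted | rewrite swap2 swap1; exact: sorted
  | rewrite swap1 swap2 swap1; exact: sorted].
Qed.
End CubicsFromExample.

Definition example_plane (K : fieldType) (k : 'I_5) : form5 K :=
  nth 0 [:: - Q0 K; Q1 K; xvar K 0 * xvar K 2 - xvar K 3 * xvar K 4;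
            xvar K 0 ^+ 2 + xvar K 2 * xvar K 4; xvar K 1 * xvar K 2 + xvar K 0 * xvar K 4] k.

Lemma polarN (K : fieldType) (g : form5 K) : polar (- g) = - polar g.
Proof. by rewrite -!scaleN1r polarZ. Qed.

Lemma polar_example (K : fieldType) (k i j : 'I_5) :
  polar (example_plane K k) i j = example_entry [seq (nat_of_ord k == l)%:R | l <- iota 0 5] i j.
Proof.
rewrite /example_plane /example_entry.
case: k => -[|[|[|[|[|//]]]]] hk /=; rewrite /Q0 /Q1 ?expr2 ?(polarD, polarN, polarZ, polar_mulX) !mxE
  !inord_eq //; case: i => -[|[|[|[|[|//]]]]] hi; case: j => -[|[|[|[|[|//]]]]] hj //=; ring.
Qed.

Lemma map_example (K L : fieldType) (u : {rmorphism K -> L}) k :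
  map_mpoly u (example_plane K k) = example_plane L k.
Proof.
rewrite /example_plane; case: k => -[|[|[|[|[|//]]]]] hk /=;
rewrite ?(rmorphN, map_Q0, map_Q1) //= ?map_Q0 //.
all: by rewrite !(rmorphB, rmorphD, rmorphM) /= !map_mpolyX.
Qed.

Lemma det_mx3 (R : comNzRingType) (e : nat -> nat -> R) (A : 'M[R]_3) a b c x y z :
    (forall i j, A i j = e (nth 0 [:: a; b; c] i)%N (nth 0 [:: x; y; z] j)%N) ->
  \det A = det3 e a b c x y z.
Proof.
move=> Ae; rewrite (expand_det_row _ ord0) !big_ord_recl big_ord0 /cofactor.
rewrite !(expand_det_row _ ord0) !big_ord_recl !big_ord0 /cofactor !det_mx11 !mxE !Ae /= /det3.
rewrite /bump /= ?addn0 ?addn1 /=; ring.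
Qed.

(** The coefficients of [x3^2], [x0 x1], [x0 x2], [x2 x4], [x1 x2], on which the five forms give the
    identity matrix; the sign of [- Q0] serves this. *)
Definition example_columns : {ffun 'I_5 -> 'I_5 * 'I_5} :=
  [ffun s : 'I_5 => (inord (nth 0 [:: 3; 0; 0; 2; 1] s), inord (nth 0 [:: 3; 1; 2; 4; 2] s))%N].

Lemma example_column_minor (K : numFieldType) :
  column_minor example_columns (example_plane K) = 1%:M.
Proof.
apply/matrixP => r s; rewrite !mxE ffunE.
have quadE (i j : 'I_5) : quad_coef (example_plane K r) (i, j) =
    polar (example_plane K r) i j / (1 + (i == j))%:R.
  by rewrite mxE -[X in X / _]mulr_natr mulfK // pnatr_eq0.
rewrite quadE polar_example /example_entry -!val_eqE /= {quadE}.
case: s => -[|[|[|[|[|//]]]]] hs /=; rewrite !inordK //=.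
all: by case: r => -[|[|[|[|[|//]]]]] hr //=; field.
Qed.

Lemma example_adjugate (K : numFieldType) k :
  adjugate_basis example_columns (example_plane K) k = example_plane K k.
Proof.
rewrite /adjugate_basis example_column_minor.
have -> : \adj 1%:M = 1%:M :> 'M[K]_5 by rewrite -[LHS]mulmx1 mul_adj_mx det1.
by rewrite (bigD1 k) //= mxE eqxx scale1r big1 ?addr0 // => r /negPf rk; rewrite mxE eq_sym rk scale0r.
Qed.

Lemma example_through (K : numFieldType) : plane_through_Q0_Q1 (example_plane K).
Proof.
split.
- split => [k|c c0 k].
    have wD := @mdegD 5; have wX i j : homogeneous 2 (xvar K i * xvar K j).
      by apply: (weight_homogeneousM (d := 1) (e := 1) wD); apply: weight_homogeneousX; rewrite mdeg1.
    rewrite /example_plane /Q0 /Q1 !expr2; case: k => -[|[|[|[|[|//]]]]] hk /=.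
    all: rewrite -?scaleN1r; repeat first [exact: wX |
      apply: (@weight_homogeneousD _ _ mdeg) | apply: (@weight_homogeneousZ _ _ mdeg)].
  have /matrixP/(_ 0 k) : (\row_k c k) *m column_minor example_columns (example_plane K) = 0.
    apply/rowP => s; have q0 : quad_coef (0 : form5 K) (example_columns s) = 0.
      by rewrite /quad_coef mcoeff0.
    rewrite mxE [RHS]mxE -[RHS]q0 -c0 quad_coef_sum.
    by apply: eq_bigr => i _; rewrite !mxE.
  by rewrite example_column_minor mulmx1 !mxE.
- exists (fun k => - (k == ord0)%:R).
  rewrite (bigD1 ord0) //= scaleN1r opprK big1 ?addr0 // => i /negPf ->.
  by rewrite oppr0 scale0r.
- exists (fun k => (k == inord 1)%:R).
  rewrite (bigD1 (inord 1)) //= eqxx scale1r /example_plane inordK //= big1 ?addr0 // => i /negPf ->.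
  by rewrite scale0r.
Qed.

Section ExampleMinors.
Let H (k : 'I_5) : 'M[rat]_5 := polar (example_plane rat k).
Let X (k : 'I_5) : mpoly 5 rat := mpolyX rat (mnm1 k).
Let pencil : 'M[mpoly 5 rat]_5 := \sum_k X k *: map_mx (@mpolyC 5 rat) (H k).
Let minor_span (F : mpoly 5 rat) := exists c : minor_index -> rat,
  F = \sum_fg c fg *: \det (mxsub fg.1 fg.2 pencil).
Let T := [seq xvar rat k | k <- iota 0 5].

Let pencilE i j : pencil i j = example_entry T i j.
Proof.
have -> : pencil i j = \sum_(k < 5) xvar rat k *
    mpolyC 5 (example_entry [seq (nat_of_ord k == l)%:R | l <- iota 0 5] i j).
  rewrite summxE; apply: eq_bigr => k _.
  by rewrite [LHS]mxE [X in _ * X]mxE polar_example /xvar inord_val.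
rewrite !big_ord_recl big_ord0 /example_entry /T.
case: i => -[|[|[|[|[|//]]]]] hi; case: j => -[|[|[|[|[|//]]]]] hj //=.
all: by rewrite ?(rmorphB, rmorphN, rmorphM, rmorph_nat, rmorph0, rmorph1) /bump /=; ring.
Qed.

Let spanB F G : minor_span F -> minor_span G -> minor_span (F - G).
Proof.
move=> [c ->] [d ->]; exists (fun fg => c fg - d fg).
by rewrite -sumrB; apply: eq_bigr => fg _; rewrite scalerBl.
Qed.

Let span_div n F : n != 0%N -> minor_span (n%:R * F) -> minor_span F.
Proof.
move=> n0 [c cE]; exists (fun fg => n%:R^-1 * c fg).
have nQ : n%:R != 0 :> rat by rewrite pnatr_eq0.
rewrite -[F](scalerK nQ) scaler_nat -[X in _ *: X]mulr_natl cE scaler_sumr.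
by apply: eq_bigr => fg _; rewrite scalerA.
Qed.

Let span_minor a b c x y z : all (ltn^~ 5)%N [:: a; b; c; x; y; z] ->
  minor_span (det3 (example_entry T) a b c x y z).
Proof.
move=> /and5P[a5 b5 c5 x5 /and3P[y5 z5 _]].
pose f : {ffun 'I_3 -> 'I_5} := [ffun i : 'I_3 => inord (nth 0 [:: a; b; c] i)%N].
pose g : {ffun 'I_3 -> 'I_5} := [ffun i : 'I_3 => inord (nth 0 [:: x; y; z] i)%N].
exists (fun fg => (fg == (f, g))%:R).
rewrite (bigD1 (f, g)) //= eqxx scale1r big1 ?addr0; last first.
  by move=> fg /negPf ->; rewrite scale0r.
symmetry; apply: det_mx3 => i j; rewrite mxE pencilE !ffunE !inordK //.
  by case: j => -[|[|[|//]]].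
by case: i => -[|[|[|//]]].
Qed.

(** Comparing coefficients of monomials turns the membership of each cubic in [minor_span] into
    numbers. *)
Lemma example_minors_span (a : 'I_ncubics) : exists c : minor_index -> rat, forall b,
  \sum_fg c fg * minor_coef H fg.1 fg.2 b = (b == a)%:R.
Proof.
pose mon (a : 'I_ncubics) : multinom 5 := Multinom [tuple nat_of_ord (enum_val a k) | k < 5].
have monE b : cubic_monomial X b = mpolyX rat (mon b).
  by rewrite mpolyXE_id; apply: eq_bigr => k _; rewrite mnmE.
have mon_inj : injective mon.
  move=> b b' /mnmP E; apply: enum_val_inj; apply/ffunP => k; apply/val_inj.
  by have := E k; rewrite !mnmE.
have [c cE] : minor_span (cubic_monomial X a).
  have /imsetP[h _ aE] := enum_valP a.
  have -> : a = cubic_index h by apply: enum_val_inj; rewrite cubic_indexK.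
  rewrite cubic_monomialE !big_ord_recl big_ord0 mulr1 mulrA.
  have XE k : X k = T`_k by rewrite /T (nth_map 0%N) ?size_iota // nth_iota // /xvar inord_val.
  by rewrite !XE; apply: (cubics_in_span spanB span_div span_minor).
exists c => b.
transitivity (mcoeff (mon b) (cubic_monomial X a)); last first.
  by rewrite monE mcoeffX (inj_eq mon_inj) eq_sym.
rewrite cE raddf_sum; apply: eq_bigr => fg _ /=; rewrite mcoeffZ; congr (_ * _).
rewrite minor_expand raddf_sum (bigD1 b) //= monE -(minor_coef_map (@mpolyC 5 rat)).
rewrite mulrC mcoeffCM mcoeffX eqxx mulr1 big1 ?addr0 // => b' b'b.
by rewrite monE -(minor_coef_map (@mpolyC 5 rat)) mulrC mcoeffCM mcoeffX (inj_eq mon_inj) (negPf b'b) mulr0.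
Qed.
End ExampleMinors.

Local Open Scope classical_set_scope.
Local Open Scope ring_scope.

(** * Sections on the incidence variety *)

Notation plucker3 := #|{ffun 'I_3 -> 'I_5}|.
Notation Zpoly := (mpoly (5 + plucker3) rat).

Definition tvar (i : 'I_5) : Zpoly := mpolyX rat (mnm1 (lshift plucker3 i)).
Definition pvar (j : 'I_plucker3) : Zpoly := mpolyX rat (mnm1 (rshift 5 j)).

Section Bihomogeneity.
Implicit Types F G : Zpoly.

Let lw (m : multinom (5 + plucker3)) := (\sum_(i < 5) m (lshift plucker3 i))%N.
Let rw (m : multinom (5 + plucker3)) := (\sum_(j < plucker3) m (rshift 5 j))%N.

Let lwD m1 m2 : lw (mnm_add m1 m2) = (lw m1 + lw m2)%N.
Proof. by rewrite /lw -big_split; apply: eq_bigr => i _; rewrite mnmDE. Qed.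

Let rwD m1 m2 : rw (mnm_add m1 m2) = (rw m1 + rw m2)%N.
Proof. by rewrite /rw -big_split; apply: eq_bigr => i _; rewrite mnmDE. Qed.

Let bihomE a b F :
  bihomogeneous a b F = weight_homogeneous lw a F && weight_homogeneous rw b F.
Proof. by rewrite /bihomogeneous /weight_homogeneous -all_predI. Qed.

Lemma bihomogeneousD a b F G :
  bihomogeneous a b F -> bihomogeneous a b G -> bihomogeneous a b (F + G).
Proof.
by rewrite !bihomE => /andP[? ?] /andP[? ?]; rewrite !weight_homogeneousD.
Qed.

Lemma bihomogeneousZ a b (c : rat) F : bihomogeneous a b F -> bihomogeneous a b (c *: F).
Proof. by rewrite !bihomE => /andP[? ?]; rewrite !weight_homogeneousZ. Qed.

Lemma bihomogeneousM a b a' b' F G :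
    bihomogeneous a b F -> bihomogeneous a' b' G ->
  bihomogeneous (a + a')%N (b + b')%N (F * G).
Proof.
by rewrite !bihomE => /andP[? ?] /andP[? ?]; rewrite !weight_homogeneousM.
Qed.

Lemma bihomogeneousC (c : rat) : bihomogeneous 0 0 (mpolyC (5 + plucker3) c).
Proof. by rewrite !bihomE !weight_homogeneousC. Qed.

Lemma bihomogeneous_sum (I : Type) (r : seq I) (P : pred I) a b (F : I -> Zpoly) :
  (forall i, P i -> bihomogeneous a b (F i)) ->
  bihomogeneous a b (\sum_(i <- r | P i) F i).
Proof.
move=> hF; rewrite bihomE !weight_homogeneous_sum // => i /hF; rewrite bihomE.
  by case/andP.
by case/andP.
Qed.

Lemma bihomogeneous_tvar i : bihomogeneous 1 0 (tvar i).
Proof.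
rewrite bihomE !weight_homogeneousX //.
  by rewrite /rw big1 // => j _; rewrite mnm1E eq_lrshift.
rewrite /lw (bigD1 i) //= mnm1E eqxx big1 // => j ji.
by rewrite mnm1E (inj_eq (@lshift_inj _ _)) eq_sym (negPf ji).
Qed.

Lemma bihomogeneous_pvar j : bihomogeneous 0 1 (pvar j).
Proof.
rewrite bihomE !weight_homogeneousX //.
  rewrite /rw (bigD1 j) //= mnm1E eqxx big1 // => i ij.
  by rewrite mnm1E (inj_eq (@rshift_inj _ _)) eq_sym (negPf ij).
by rewrite /lw big1 // => i _; rewrite mnm1E eq_rlshift.
Qed.
End Bihomogeneity.

Section Sections.
Variable q : 'I_5 -> form5 rat.
Implicit Types (z : Z q) (F G : Zpoly).

Lemma Z_evalD F G z : Z_eval (F + G) z = Z_eval F z + Z_eval G z.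
Proof. by rewrite /Z_eval rmorphD mevalD. Qed.

Lemma Z_evalM F G z : Z_eval (F * G) z = Z_eval F z * Z_eval G z.
Proof. by rewrite /Z_eval rmorphM mevalM. Qed.

Lemma Z_evalZ (c : rat) F z : Z_eval (c *: F) z = ratr c * Z_eval F z.
Proof. by rewrite /Z_eval map_mpolyZ mevalZ. Qed.

Lemma Z_evalC (c : rat) z : Z_eval (mpolyC _ c) z = ratr c.
Proof. by rewrite /Z_eval map_mpolyC mevalC. Qed.

Lemma Z_eval_sum (I : Type) (r : seq I) (P : pred I) (F : I -> Zpoly) z :
  Z_eval (\sum_(i <- r | P i) F i) z = \sum_(i <- r | P i) Z_eval (F i) z.
Proof.
apply: (big_morph (fun F => Z_eval F z)) => [F1 F2|]; first exact: Z_evalD.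
by rewrite /Z_eval rmorph0 meval0.
Qed.

Lemma Z_eval_tvar i z : Z_eval (tvar i) z = (val z).1 0 i.
Proof.
rewrite /Z_eval map_mpolyX mevalXU /Z_coords.
by have := unsplitK (inl i : 'I_5 + 'I_plucker3) => /= ->.
Qed.

Lemma Z_eval_pvar j z : Z_eval (pvar j) z = plucker (val z).2 j.
Proof.
rewrite /Z_eval map_mpolyX mevalXU /Z_coords.
by have := unsplitK (inr j : 'I_5 + 'I_plucker3) => /= ->.
Qed.

Lemma sectionsM d e (s1 s2 : Z q -> algC) :
  sections d s1 -> sections e s2 -> sections (d + e) (fun z => s1 z * s2 z).
Proof.
move=> h1 h2 z; have [a1 [b1 [F1 [G1 [F1h G1h G1z E1]]]]] := h1 z.
have [a2 [b2 [F2 [G2 [F2h G2h G2z E2]]]]] := h2 z.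
exists (a1 + a2)%N, (b1 + b2)%N, (F1 * F2), (G1 * G2).
rewrite Z_evalM (mulf_neq0 G1z G2z) addnACA !bihomogeneousM //; split=> // z'.
by rewrite !Z_evalM mulf_eq0 negb_or => /andP[/E1-> /E2->]; rewrite mulf_div.
Qed.

Lemma sectionsD d (s1 s2 : Z q -> algC) :
  sections d s1 -> sections d s2 -> sections d (fun z => s1 z + s2 z).
Proof.
move=> h1 h2 z; have [a1 [b1 [F1 [G1 [F1h G1h G1z E1]]]]] := h1 z.
have [a2 [b2 [F2 [G2 [F2h G2h G2z E2]]]]] := h2 z.
exists (a1 + a2)%N, (b1 + b2)%N, (F1 * G2 + G1 * F2), (G1 * G2).
rewrite Z_evalM (mulf_neq0 G1z G2z) bihomogeneousM //; split=> //.
  rewrite bihomogeneousD //; first by rewrite addnAC bihomogeneousM.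
  by rewrite -addnA bihomogeneousM.
move=> z'; rewrite Z_evalD !Z_evalM mulf_eq0 negb_or => /andP[g1 g2].
by rewrite (E1 _ g1) (E2 _ g2) addf_div // [X in _ + X]mulrC.
Qed.

Lemma sections_const (c : rat) : sections 0 (fun _ : Z q => ratr c : algC).
Proof.
move=> z; exists 0%N, 0%N, (mpolyC _ c), (mpolyC _ 1).
rewrite !bihomogeneousC Z_evalC rmorph1 oner_neq0; split=> // z' _.
by rewrite !Z_evalC rmorph1 divr1.
Qed.

Lemma sections_coord i : sections 1 (fun z : Z q => (val z).1 0 i).
Proof.
move=> z; exists 0%N, 0%N, (tvar i), (mpolyC _ 1).
rewrite bihomogeneousC bihomogeneous_tvar Z_evalC rmorph1 oner_neq0; split=> // z' _.
by rewrite Z_evalC Z_eval_tvar rmorph1 divr1.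
Qed.
End Sections.

Section RulingSection.
Variable q : 'I_5 -> form5 rat.
Hypothesis q_hom : forall i, homogeneous 2 (q i).
Implicit Types z : Z q.

Definition pencil (z : Z q) : 'M[algC]_5 := polar (Qt q (val z).1).

Lemma pencilE z :
  pencil z = \sum_i (val z).1 0 i *: map_mx ratr (polar (q i)).
Proof. by rewrite /pencil /Qt polar_sum; under eq_bigr do rewrite polar_map. Qed.

Lemma homogeneous_Qt (t : 'rV[algC]_5) : homogeneous 2 (Qt q t).
Proof.
apply: (@weight_homogeneous_sum _ _ mdeg) => i _; apply: weight_homogeneousZ.
have /homogeneousP hq := q_hom i; apply/homogeneousP => m.
rewrite mcoeff_msupp mcoeff_map_mpoly fmorph_eq0 -mcoeff_msupp; exact: hq.
Qed.

Lemma Z_rank z : \rank (val z).2 = 3%N.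
Proof. by have := set_valP z; case. Qed.

Lemma Z_isotropic z : (val z).2 *m pencil z *m (val z).2^T = 0.
Proof.
have [_ _ Zq] := set_valP z; set M := (val z).2 in Zq *.
have iso (x : 'rV_5) : (x <= M)%MS -> bilin (pencil z) x x = 0.
  by move=> xM; rewrite -meval_polar ?homogeneous_Qt // Zq // mulr0.
apply/matrixP=> i j; rewrite mxE [RHS]mxE.
have -> : \sum_k (M *m pencil z) i k * M^T k j = bilin (pencil z) (row i M) (row j M).
  rewrite /bilin -row_mul mxE; apply: eq_bigr => k _; congr (_ * _).
    by rewrite [RHS]mxE.
  by rewrite !mxE.
have := iso (row i M + row j M); rewrite addmx_sub ?row_sub // => /(_ isT).
rewrite bilinDl !bilinDr !iso ?row_sub // add0r addr0.
rewrite (bilinC (row j M)) ?polar_sym // -mulr2n -mulr_natl => /eqP.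
by rewrite mulf_eq0 pnatr_eq0 /= => /eqP.
Qed.

Lemma Z_det0 z : \det (pencil z) = 0.
Proof. exact: (isotropic_det0 (Z_isotropic z) (Z_rank z)). Qed.

Let rows (s : 'S_(3 + 2)) : 'M[algC]_(2, 4 + 1) := rowsub (s \o @rshift 3 2) 1%:M.

Let Zs_ex z : exists s : 'S_(3 + 2), ruling_den ((val z).2 : 'M_(3, 4 + 1)) (rows s) != 0.
Proof.
have [s s0] := @row_free_minor _ 3 2 _ (Z_rank z); exists s.
rewrite /ruling_den (det_row_extension ((val z).2)) mulf_neq0 //.
by rewrite expf_neq0 // oppr_eq0 oner_neq0.
Qed.

(** An arbitrary admissible complement at each point; by [ruling_rootE] any other gives the same
    value. *)
Let Zs z := xchoose (Zs_ex z).

(* On the rank 4 quadrics this is the square root of the minor that is singled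
   out by the ruling of Q_t containing the 2-plane. *)
Definition ruling_root (z : Z q) : algC :=
  ruling_num (pencil z : 'M_(4 + 1)) (val z).2 (rows (Zs z)) /
  ruling_den ((val z).2 : 'M_(3, 4 + 1)) (rows (Zs z)).

Let ruling_rootE z s : ruling_den ((val z).2 : 'M_(3, 4 + 1)) (rows s) != 0 ->
  ruling_root z = ruling_num (pencil z : 'M_(4 + 1)) (val z).2 (rows s) /
                  ruling_den ((val z).2 : 'M_(3, 4 + 1)) (rows s).
Proof.
move=> s0; have z0 := xchooseP (Zs_ex z).
apply/eqP; rewrite eqr_div //; apply/eqP; rewrite -/(Zs z).
exact: (@ruling_ratio_indep _ (pencil z) (val z).2 (Z_isotropic z) (rows s) (rows (Zs z)) s0).
Qed.

Lemma ruling_root_sqr z : ruling_root z ^+ 2 = \det (ulsubmx (pencil z : 'M_(4 + 1))).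
Proof.
have z0 := xchooseP (Zs_ex z).
rewrite /ruling_root expr_div_n ruling_num_sqr ?polar_sym ?Z_isotropic //.
by rewrite mulrC mulKf // expf_neq0.
Qed.

Definition tentry (i j : 'I_5) : Zpoly := \sum_k polar (q k) i j *: tvar k.

Lemma Z_eval_tentry i j z : Z_eval (tentry i j) z = pencil z i j.
Proof.
rewrite Z_eval_sum pencilE summxE; apply: eq_bigr => k _.
by rewrite Z_evalZ Z_eval_tvar mulrC !mxE.
Qed.

(** The Cauchy-Binet expansion of [ruling_num], with the sign that also occurs in [ruling_den]. *)
Let root_num (s : 'S_(3 + 2)) : Zpoly :=
  (-1) ^+ s *: \sum_(f : {ffun 'I_3 -> 'I_5})
    (tentry (f 0) (s (rshift 3 (0 : 'I_2))) * tentry (f 1) (s (rshift 3 (1 : 'I_2))) *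
     mpolyC _ (f 2%:R == rshift 4 (0 : 'I_1))%:R) * pvar (enum_rank f).

(** Locally it is a quotient of bidegrees (2, 1) and (0, 1), the denominator being one Pluecker
    coordinate. *)
Lemma sections_ruling_root : sections 2 ruling_root.
Proof.
move=> z; have [s s0] := Zs_ex z.
pose j : 'I_plucker3 := enum_rank [ffun c : 'I_3 => s (lshift 2 c)].
have denE z' : ruling_den ((val z').2 : 'M_(3, 4 + 1)) (rows s) = (-1) ^+ s * Z_eval (pvar j) z'.
  rewrite /ruling_den (det_row_extension ((val z').2)) Z_eval_pvar; congr (_ * \det _).
  by apply/matrixP=> a b; rewrite !mxE enum_rankK ffunE.
exists 0%N, 1%N, (root_num s), (pvar j).
have Gz (z' : Z q) : Z_eval (pvar j) z' != 0 ->
    ruling_den ((val z').2 : 'M_(3, 4 + 1)) (rows s) != 0.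
  by move=> h; rewrite denE mulf_neq0 // expf_neq0 // oppr_eq0 oner_neq0.
split.
- apply/bihomogeneousZ/bihomogeneous_sum => f _.
  have t1 a b : bihomogeneous 1 0 (tentry a b).
    by apply: bihomogeneous_sum => k _; apply/bihomogeneousZ/bihomogeneous_tvar.
  apply: (@bihomogeneousM 2 0 0 1); last exact: bihomogeneous_pvar.
  apply: (@bihomogeneousM 2 0 0 0); last exact: bihomogeneousC.
  exact: (@bihomogeneousM 1 0 1 0).
- exact: bihomogeneous_pvar.
- by apply: contraNneq s0 => E; rewrite denE E mulr0.
- move=> z' /[dup] G0 /Gz /ruling_rootE ->; rewrite denE.
  have -> : ruling_num (pencil z' : 'M_(4 + 1)) (val z').2 (rows s) = (-1) ^+ s * Z_eval (root_num s) z'.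
    rewrite /root_num Z_evalZ rmorph_sign mulrA -signr_addb addbb mul1r.
    set A := pencil z'; set M := (val z').2.
    pose W : 'M[algC]_(5, 2 + 1) := row_mx (A *m (rows s)^T) (last_col algC 4).
    have -> : ruling_num (A : 'M_(4 + 1)) M (rows s) = \det (M *m W : 'M_3).
      by rewrite /ruling_num -mulmxA -mul_mx_row.
    rewrite det_mulmx_expand Z_eval_sum; apply: eq_bigr => f _.
    rewrite !Z_evalM !Z_eval_tentry Z_evalC Z_eval_pvar.
    congr (_ * _); last first.
      by congr (\det _); apply/matrixP=> a b; rewrite !mxE enum_rankK.
    have W0 c k : W c (lshift 1 k) = A c (s (rshift 3 k)).
      rewrite row_mxEl mxE (bigD1 (s (rshift 3 k))) //= big1 => [|l lk].
        by rewrite !mxE eqxx mulr1 addr0.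
      by rewrite !mxE /= ?(eq_sym (s _)) (negPf lk) mulr0.
    have W1 c : W c (rshift 2 0) = ratr (c == rshift 4 (0 : 'I_1))%:R.
      by rewrite row_mxEr (@last_colE algC 4) ratr_nat.
    rewrite !big_ord_recr big_ord0 /= mul1r /= -W1 -/A.
    have e0 : (0 : 'I_3) = lshift 1 (0 : 'I_2) by apply/val_inj.
    have e1 : (1 : 'I_3) = lshift 1 (1 : 'I_2) by apply/val_inj.
    rewrite -!W0; congr (W (f _) _ * W (f _) _ * W (f _) _); exact/val_inj.
  by rewrite -mulf_div divff ?mul1r // expf_neq0 // oppr_eq0 oner_neq0.
Qed.
End RulingSection.

(** * Points of the double cover *)

Section RationalPoints.
Variable q : 'I_5 -> form5 rat.

Definition to_section d (s : Z q -> algC) (h : sections d s) : sections d :=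
  exist _ s (mem_set h).

Definition coord_section (i : 'I_5) : sections 1 := to_section (@sections_coord q i).

Variable phi : Cone q rat.

Let hphi : @cone q rat (val phi) := set_valP phi.

Definition cone_coord : 'rV[rat]_5 := \row_i val phi 1%N (coord_section i).

Lemma cone_coord_neq0 : cone_coord != 0.
Proof.
have [_ _ _ [i [s [hs s0]]]] := hphi.
apply: contraNneq s0 => t0; have -> : s = coord_section i.
  by apply/val_inj/funext => z; rewrite hs.
by have := congr1 (fun t : 'rV_5 => t 0 i) t0; rewrite !mxE => ->.
Qed.

(** A relation between functions and values, which hides the proof that the function is a
    section. *)
Let cone_eval d (s : Z q -> algC) (c : rat) :=
  exists h : sections d s, val phi d (to_section h) = c.

Let cone_evalD d s1 s2 c1 c2 : cone_eval d s1 c1 -> cone_eval d s2 c2 ->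
  cone_eval d (fun z => s1 z + s2 z) (c1 + c2).
Proof.
move=> [h1 <-] [h2 <-]; have [_ hD _ _] := hphi.
by exists (sectionsD h1 h2); apply: hD.
Qed.

Let cone_evalM d e s1 s2 c1 c2 : cone_eval d s1 c1 -> cone_eval e s2 c2 ->
  cone_eval (d + e) (fun z => s1 z * s2 z) (c1 * c2).
Proof.
move=> [h1 <-] [h2 <-]; have [_ _ hM _] := hphi.
by exists (sectionsM h1 h2); apply: hM.
Qed.

Let cone_eval_ext d s1 s2 c : s1 =1 s2 -> cone_eval d s1 c -> cone_eval d s2 c.
Proof. by move=> /funext ->. Qed.

Let cone_eval_inj d s c1 c2 : cone_eval d s c1 -> cone_eval d s c2 -> c1 = c2.
Proof.
move=> [h1 <-] [h2 <-]; congr (val phi d _); exact/val_inj.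
Qed.

(** On rational constants [phi] is a ring endomorphism of the rationals, hence the identity. *)
Let cone_eval_const c : cone_eval 0 (fun=> ratr c) c.
Proof.
have [h1 _ _ _] := hphi.
pose f (c : rat) : rat := val phi 0%N (to_section (@sections_const q c)).
have fE x : cone_eval 0 (fun=> ratr x) (f x) by exists (@sections_const q x).
have fD x y : f (x + y) = f x + f y.
  apply: cone_eval_inj (fE _) _; apply: cone_eval_ext (cone_evalD (fE x) (fE y)) => z.
  by rewrite rmorphD.
have fM x y : f (x * y) = f x * f y.
  apply: cone_eval_inj (fE _) _; apply: cone_eval_ext (cone_evalM (fE x) (fE y)) => z.
  by rewrite rmorphM.
have f1 : f 1 = 1 by apply: h1 => z /=; rewrite rmorph1.
have f0 : f 0 = 0 by apply: (addIr (f 0)); rewrite -fD !add0r.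
have fN x : f (- x) = - f x by apply/eqP; rewrite -addr_eq0 -fD addNr f0.
have fn n : f n%:R = n%:R by elim: n => [//|n IH]; rewrite !mulrS fD IH f1.
have fz n : f n%:~R = n%:~R by case: n => n; rewrite ?NegzE ?mulrNz ?fN -pmulrn fn.
suff fc : f c = c by rewrite -[X in cone_eval _ _ X]fc; exact: fE.
have d0 : (denq c)%:~R != 0 :> rat by rewrite intr_eq0 denq_neq0.
apply: (mulIf d0); rewrite -{1}fz -fM -{1 3}[c]divq_num_den.
by rewrite divfK // fz.
Qed.

Let eval_poly (p : mpoly 5 rat) (z : Z q) : algC :=
  meval ((val z).1 0) (map_mpoly (ratr : rat -> algC) p).

Let cone_eval_monomial m :
  cone_eval (mdeg m) (eval_poly (mpolyX rat m)) (meval (cone_coord 0) (mpolyX rat m)).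
Proof.
have [d dE] := ubnP (mdeg m); elim: d m dE => // d IH m; rewrite ltnS => md.
have [m0|/eqP m0] := eqVneq (mdeg m) 0%N.
  rewrite m0; move/eqP: m0; rewrite mdeg_eq0 => /eqP ->; rewrite mpolyX0 meval1.
  by apply: cone_eval_ext (cone_eval_const 1) => z; rewrite /eval_poly !rmorph1 ?meval1.
have [i mi] : exists i, m i != 0%N.
  apply/existsP; apply: contraT; rewrite negb_exists => /forallP mE.
  by case: m0; rewrite mdegE big1 // => i _; apply/eqP/negPn.
have mE : mnm_add (mnm1 i) (mnm_sub m (mnm1 i)) = m.
  by rewrite addmC; apply: submK; rewrite lep1mP.
have dm : mdeg m = (1 + mdeg (mnm_sub m (mnm1 i)))%N by rewrite -{1}mE mdegD mdeg1.
have XE : mpolyX rat m = mpolyX rat (mnm1 i) * mpolyX rat (mnm_sub m (mnm1 i)).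
  by rewrite -mpolyXD mE.
rewrite XE dm mevalM mevalXU.
have hi : cone_eval 1 (fun z => (val z).1 0 i) (cone_coord 0 i).
  by exists (@sections_coord q i); rewrite /cone_coord mxE.
have hm := IH (mnm_sub m (mnm1 i)) _; apply: cone_eval_ext (cone_evalM hi (hm _)) => [z|].
  by rewrite /eval_poly rmorphM /= !map_mpolyX mevalM mevalXU.
by move: md; rewrite dm add1n.
Qed.

(** Through this, polynomial identities on Z_P pass to the coordinates of a rational point of
    Y_P. *)
Lemma cone_poly d (p : mpoly 5 rat) (s : sections d) : homogeneous d p ->
    (forall z, val s z = meval ((val z).1 0) (map_mpoly (ratr : rat -> algC) p)) ->
  val phi d s = meval (cone_coord 0) p.
Proof.
move=> /homogeneousP hp sE.
suff : cone_eval d (eval_poly p) (meval (cone_coord 0) p).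
  move=> [h <-]; congr (val phi d _); apply/val_inj/funext => z; exact: sE.
have hX m c : mdeg m = d -> cone_eval d (eval_poly (c *: mpolyX rat m))
    (meval (cone_coord 0) (c *: mpolyX rat m)).
  move=> <-; rewrite mevalZ.
  apply: cone_eval_ext (cone_evalM (cone_eval_const c) (cone_eval_monomial m)) => z.
  by rewrite /eval_poly map_mpolyZ mevalZ.
have h0 : cone_eval d (eval_poly 0) (meval (cone_coord 0) 0).
  rewrite meval0.
  have h : sections d (eval_poly 0).
    move=> z; exists 0%N, 0%N, 0, (mpolyC _ 1).
    rewrite bihomogeneousC Z_evalC rmorph1 oner_neq0; split=> //.
      by rewrite /bihomogeneous msupp0.
    by move=> z' _; rewrite /Z_eval /eval_poly !rmorph0 ?meval0 mul0r.
  exists h; have [_ hD _ _] := hphi.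
  apply: (addIr (val phi d (to_section h))); rewrite add0r; symmetry; apply: hD => z /=.
  by rewrite /eval_poly !rmorph0 ?meval0 addr0.
rewrite [p]mpolyE; elim: (msupp p) hp => [|m l IH] hl; first by rewrite big_nil.
rewrite big_cons mevalD.
apply: cone_eval_ext (cone_evalD (hX m _ _) (IH _)) => [z||m' m'l].
- by rewrite /eval_poly rmorphD mevalD.
- by apply: hl; rewrite mem_head.
- by apply: hl; rewrite in_cons m'l orbT.
Qed.

Hypothesis q_hom : forall i, homogeneous 2 (q i).

Definition cone_pencil : 'M[rat]_5 := \sum_i cone_coord 0 i *: polar (q i).

Let Mpoly : 'M[mpoly 5 rat]_5 :=
  \matrix_(i, j) \sum_k polar (q k) i j *: mpolyX rat (mnm1 k).

Let Mpoly_lin i j : weight_homogeneous mdeg 1 (Mpoly i j).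
Proof.
rewrite mxE; apply: weight_homogeneous_sum => k _; apply: weight_homogeneousZ.
by apply: weight_homogeneousX; rewrite mdeg1.
Qed.

Let Mpoly_cone : map_mx (meval (cone_coord 0)) Mpoly = cone_pencil.
Proof.
apply/matrixP=> i j; rewrite !mxE raddf_sum summxE; apply: eq_bigr => k _ /=.
by rewrite mevalZ mevalXU !mxE mulrC.
Qed.

Let Mpoly_Z (z : Z q) :
  map_mx (meval ((val z).1 0) \o map_mpoly (ratr : rat -> algC)) Mpoly = pencil z.
Proof.
rewrite pencilE; apply/matrixP=> i j; rewrite [LHS]mxE /= [Mpoly _ _]mxE [map_mpoly _ _]raddf_sum /= raddf_sum summxE.
by apply: eq_bigr => k _ /=; rewrite map_mpolyZ map_mpolyX mevalZ mevalXU !mxE mulrC.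
Qed.

Let eval_det (k : nat) (M : 'M[mpoly 5 rat]_k) (z : Z q) :
  meval ((val z).1 0) (map_mpoly (ratr : rat -> algC) (\det M)) =
  \det (map_mx (meval ((val z).1 0) \o map_mpoly (ratr : rat -> algC)) M).
Proof. by rewrite map_mx_comp det_map_mx /= det_map_mx. Qed.

Let hom_det k (M : 'M[mpoly 5 rat]_k) :
  (forall i j, weight_homogeneous mdeg 1 (M i j)) -> homogeneous k (\det M).
Proof.
move=> hM; have := weight_homogeneous_det (@mdegD 5) hM; rewrite muln1; exact.
Qed.

(** The determinant of the generic pencil vanishes on Z_P, so it is the zero section, which [phi]
    sends to 0. *)
Lemma cone_det0 : \det cone_pencil = 0.
Proof.
have h := hom_det Mpoly_lin.
have s_in : sections 5 (fun _ : Z q => 0 : algC).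
  move=> z; exists 0%N, 0%N, 0, (mpolyC _ 1).
  rewrite bihomogeneousC Z_evalC rmorph1 oner_neq0; split=> //.
    by rewrite /bihomogeneous msupp0.
  by move=> z' _; rewrite /Z_eval !rmorph0 ?meval0 mul0r.
rewrite -Mpoly_cone det_map_mx /= -(@cone_poly _ _ (to_section s_in)) // => [|z]; last first.
  by rewrite eval_det Mpoly_Z Z_det0.
have [_ hD _ _] := hphi.
apply: (addIr (val phi 5%N (to_section s_in))); rewrite add0r; symmetry; apply: hD => z /=.
by rewrite addr0.
Qed.

(** The root is the value of [phi] at [ruling_root], by multiplicativity. *)
Lemma cone_minor_sqr :
  exists s, \det (ulsubmx (cone_pencil : 'M_(4 + 1))) = s ^+ 2.
Proof.
pose r := to_section (@sections_ruling_root q q_hom).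
exists (val phi 2%N r); have [_ _ hM _] := hphi.
pose N : 'M_4 := ulsubmx (Mpoly : 'M_(4 + 1)).
have NE i j : N i j = Mpoly (lshift 1 i) (lshift 1 j) by rewrite !mxE.
have h : homogeneous 4 (\det N) by apply: hom_det => i j; rewrite NE; exact: Mpoly_lin.
have r2 : sections 4 (fun z : Z q => ruling_root z * ruling_root z).
  exact: (sectionsM (@sections_ruling_root q q_hom) (@sections_ruling_root q q_hom)).
rewrite expr2 -(hM 2 2 r r (to_section r2)) // (cone_poly h) => [|z].
  by rewrite -[RHS]det_map_mx -Mpoly_cone map_ulsubmx.
have NZ : map_mx (meval ((val z).1 0) \o map_mpoly (ratr : rat -> algC)) N =
    ulsubmx (pencil z : 'M_(4 + 1)) by rewrite map_ulsubmx Mpoly_Z.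
by rewrite eval_det NZ; exact: (ruling_root_sqr q_hom z).
Qed.
End RationalPoints.

(** * Values of sections along families of planes *)

Section Evaluation.
Variable q : 'I_5 -> form5 rat.
Implicit Types (z : Z q) (F G : Zpoly).

Lemma Z_evalE F z : Z_eval F z =
  \sum_(m <- msupp F) ratr (mcoeff m F) * \prod_i Z_coords z i ^+ fun_of_multinom m i.
Proof.
rewrite {1}[F]mpolyE Z_eval_sum; apply: eq_bigr => m _.
by rewrite Z_evalZ; congr (_ * _); rewrite /Z_eval map_mpolyX mevalX.
Qed.

Lemma Z_coords_lshift i z : Z_coords z (lshift _ i) = (val z).1 0 i.
Proof. by rewrite /Z_coords (unsplitK (inl i)). Qed.

Lemma Z_coords_rshift j z : Z_coords z (rshift 5 j) = plucker (val z).2 j.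
Proof. by rewrite /Z_coords (unsplitK (inr j)). Qed.

Lemma plucker_mulmx (K : fieldType) (g : 'M[K]_3) (M : 'M[K]_(3, 5)) j :
  plucker (g *m M) j = \det g * plucker M j.
Proof.
rewrite /plucker -det_mulmx; congr (\det _); apply/matrixP=> r s.
by rewrite !mxE; apply: eq_bigr => k _; rewrite mxE.
Qed.

(** Numerator and denominator have the same degree in the Pluecker coordinates, which are all
    multiplied by [\det g]. *)
Lemma section_basis_change d (s : Z q -> algC) z z' (g : 'M[algC]_3) :
    sections d s -> (val z').1 = (val z).1 -> (val z').2 = g *m (val z).2 ->
  s z' = s z.
Proof.
move=> hs zt zM; have [a [b [F [G [Fh Gh Gz E]]]]] := hs z.
have scale a' b' H : bihomogeneous a' b' H -> Z_eval H z' = \det g ^+ b' * Z_eval H z.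
  move=> /allP hH; rewrite !Z_evalE mulr_sumr; apply: eq_big_seq => m mH.
  have /andP[_ /eqP mb] := hH m mH.
  rewrite mulrCA; congr (_ * _); rewrite !big_split_ord /= mulrCA; congr (_ * _).
    by apply: eq_bigr => i _; rewrite !Z_coords_lshift zt.
  rewrite -mb -prodrXr -big_split /=; apply: eq_bigr => j _.
  by rewrite !Z_coords_rshift zM plucker_mulmx exprMn.
have g0 : \det g != 0.
  rewrite -unitfE -unitmxE -row_free_unit /row_free eqn_leq rank_leq_row /=.
  by rewrite -{1}(Z_rank z') zM mxrankM_maxl.
rewrite (E z Gz) E; last by rewrite (scale _ _ _ Gh) mulf_neq0 ?expf_neq0.
by rewrite (scale _ _ _ Fh) (scale _ _ _ Gh) -mulf_div divff ?mul1r // expf_neq0.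
Qed.

(** The local numerators and denominators have rational coefficients. *)
Lemma section_conj d (s : Z q -> algC) z z' :
    sections d s -> (forall i, (val z').1 0 i = ((val z).1 0 i)^*) ->
    (val z').2 = map_mx Num.conj (val z).2 ->
  s z' = (s z)^*.
Proof.
move=> hs zt zM; have [a [b [F [G [Fh Gh Gz E]]]]] := hs z.
have conjE H : Z_eval H z' = (Z_eval H z)^*.
  rewrite !Z_evalE rmorph_sum; apply: eq_bigr => m _ /=.
  rewrite rmorphM /= (CratrE, conj_Crat) ?Crat_rat //; congr (_ * _).
  rewrite rmorph_prod; apply: eq_bigr => i _; rewrite rmorphXn; congr (_ ^+ _).
  case: (split_ordP i) => k ->; first by rewrite !Z_coords_lshift zt.
  rewrite !Z_coords_rshift zM /plucker -det_map_mx; congr (\det _).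
  by apply/matrixP=> r c; rewrite !mxE.
by rewrite (E z Gz) E conjE ?fmorph_eq0 // conjE fmorph_div.
Qed.

(** Pluecker coordinates of a polynomial family of planes are polynomials in the parameter. *)
Lemma section_regular d (s : Z q -> algC) (t : 'rV[algC]_5)
    (M : 'M[{poly algC}]_(3, 5)) (z : algC -> Z q) :
    sections d s -> (forall x, (val (z x)).1 = t) ->
    (forall x, (val (z x)).2 = map_mx (horner_eval x) M) ->
  regular (s \o z).
Proof.
move=> hs zt zM x0; have [a [b [F [G [_ _ Gz E]]]]] := hs (z x0).
pose C (i : 'I_(5 + plucker3)) : {poly algC} := match fintype.split i with
  | inl i => (t 0 i)%:P
  | inr j => \det (\matrix_(r, c) M r (enum_val j c)) end.
have CE i x : (C i).[x] = Z_coords (z x) i.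
  rewrite /Z_coords /C; case: fintype.split => k; first by rewrite hornerC zt.
  rewrite -[LHS]/(horner_eval x _) -det_map_mx zM; congr (\det _).
  by apply/matrixP=> r c; rewrite !mxE.
pose ev H : {poly algC} :=
  \sum_(m <- msupp H) (ratr (mcoeff m H))%:P * \prod_i C i ^+ fun_of_multinom m i.
have evE H x : (ev H).[x] = Z_eval H (z x).
  rewrite Z_evalE horner_sum; apply: eq_bigr => m _.
  rewrite hornerM hornerC; congr (_ * _).
  by rewrite horner_prod; apply: eq_bigr => i _; rewrite horner_exp CE.
exists (ev F), (ev G); rewrite evE; split=> // x; rewrite !evE; exact: E.
Qed.

Lemma cone_point (z : Z q) :
    (forall d (s : Z q -> algC), sections d s -> s z \in Crat) ->
  exists phi : Cone q rat, forall d (s : sections d), ratr (val phi d s) = val s z :> algC.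
Proof.
move=> zQ; pose phi d (s : @sections q d) := getCrat (val s z).
have phiK d (s : @sections q d) : ratr (phi d s) = val s z :> algC.
  by rewrite getCratK // (zQ d) //; exact: set_valP.
have phi_in : phi \in @cone q rat.
  rewrite inE; split.
  - by move=> s hs; apply: (fmorph_inj (ratr : {rmorphism rat -> algC})); rewrite /= phiK hs rmorph1.
  - move=> d s1 s2 s hs; apply: (fmorph_inj (ratr : {rmorphism rat -> algC})).
    by rewrite rmorphD /= !phiK hs.
  - move=> d e s1 s2 s hs; apply: (fmorph_inj (ratr : {rmorphism rat -> algC})).
    by rewrite rmorphM /= !phiK hs.
  have [t0 _ _] := set_valP z; have /existsP[i ti] : [exists i, (val z).1 0 i != 0].
    apply: contraNT t0; rewrite negb_exists => /forallP t0.
    by apply/eqP/rowP => i; rewrite mxE; apply/eqP/negPn.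
  exists i, (coord_section q i); split=> //.
  by rewrite -(fmorph_eq0 (ratr : {rmorphism rat -> algC})) /= phiK.
by exists (exist _ phi phi_in).
Qed.
End Evaluation.

(** * The quadratic field over which the planes in Q0 are defined *)

Definition theta : algC := 'i * sqrtC 3.

Lemma theta_sqr : theta ^+ 2 = -3.
Proof. by rewrite /theta exprMn sqrCi sqrtCK mulN1r. Qed.

Lemma theta_conj : theta^* = - theta.
Proof.
by rewrite /theta rmorphM /= conjCi conj_Creal ?mulNr // ger0_real // sqrtC_ge0 ler0n.
Qed.

Definition in_Qtheta (x : algC) : Prop :=
  exists a b : rat, x = ratr a + ratr b * theta.

Lemma in_Qtheta_rat c : in_Qtheta (ratr c).
Proof. by exists c, 0; rewrite rmorph0 mul0r addr0. Qed.

Lemma in_Qtheta_theta : in_Qtheta theta.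
Proof. by exists 0, 1; rewrite rmorph0 rmorph1 mul1r add0r. Qed.

Lemma in_QthetaD x y : in_Qtheta x -> in_Qtheta y -> in_Qtheta (x + y).
Proof.
by move=> [a [b ->]] [c [d ->]]; exists (a + c), (b + d); rewrite !rmorphD /=; ring.
Qed.

Lemma in_QthetaM x y : in_Qtheta x -> in_Qtheta y -> in_Qtheta (x * y).
Proof.
move=> [a [b ->]] [c [d ->]]; exists (a * c - 3 * (b * d)), (a * d + b * c).
rewrite rmorphB !rmorphD !rmorphM /= ratr_nat.
have -> (u v w t : algC) : (u + v * theta) * (w + t * theta) =
  u * w + (u * t + v * w) * theta + theta ^+ 2 * (v * t) by ring.
by rewrite theta_sqr; ring.
Qed.

Lemma in_QthetaV x : in_Qtheta x -> in_Qtheta x^-1.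
Proof.
move=> [a [b xE]]; have [x0|x0] := eqVneq x 0.
  by rewrite x0 invr0; exact: (in_Qtheta_rat 0) || (have := in_Qtheta_rat 0; rewrite rmorph0).
pose n := a ^+ 2 + 3 * b ^+ 2.
have nE : x * (ratr a - ratr b * theta) = ratr n.
  rewrite xE /n rmorphD rmorphM !rmorphXn /= ratr_nat.
  have -> (u v : algC) : (u + v * theta) * (u - v * theta) = u ^+ 2 - theta ^+ 2 * v ^+ 2 by ring.
  by rewrite theta_sqr; ring.
have n0 : ratr n != 0 :> algC.
  rewrite fmorph_eq0; apply: contraNneq x0 => n0.
  have a2 := sqr_ge0 a; have b2 := sqr_ge0 b.
  have /eqP : a ^+ 2 = 0 by rewrite /n in n0; lra.
  have /eqP : b ^+ 2 = 0 by rewrite /n in n0; lra.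
  by rewrite !sqrf_eq0 xE => /eqP -> /eqP ->; rewrite rmorph0 mul0r addr0.
have -> : x^-1 = ratr (a / n) + ratr (- b / n) * theta.
  apply: (mulfI x0); rewrite divff // !fmorph_div rmorphN /=.
  have -> (u v w : algC) : x * (u / w + - v / w * theta) = x * (u - v * theta) / w by ring.
  by rewrite nE divff.
by exists (a / n), (- b / n).
Qed.

Lemma in_Qtheta_prod (I : Type) (r : seq I) (F : I -> algC) :
  (forall i, in_Qtheta (F i)) -> in_Qtheta (\prod_(i <- r) F i).
Proof.
move=> hF; apply: big_ind => //; last exact: in_QthetaM.
by have := in_Qtheta_rat 1; rewrite rmorph1.
Qed.

Lemma in_Qtheta_sum (I : Type) (r : seq I) (F : I -> algC) :
  (forall i, in_Qtheta (F i)) -> in_Qtheta (\sum_(i <- r) F i).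
Proof.
move=> hF; apply: big_ind => //; last exact: in_QthetaD.
by have := in_Qtheta_rat 0; rewrite rmorph0.
Qed.

Lemma in_QthetaX x n : in_Qtheta x -> in_Qtheta (x ^+ n).
Proof.
move=> hx; elim: n => [|n IH]; last by rewrite exprS; exact: in_QthetaM.
by have := in_Qtheta_rat 1; rewrite rmorph1.
Qed.

Lemma in_Qtheta_det n (M : 'M[algC]_n) :
  (forall i j, in_Qtheta (M i j)) -> in_Qtheta (\det M).
Proof.
move=> hM; apply: in_Qtheta_sum => s; apply: in_QthetaM; last exact: in_Qtheta_prod.
by have := in_Qtheta_rat ((-1) ^+ s); rewrite rmorph_sign.
Qed.

Lemma in_Qtheta_real x : in_Qtheta x -> x^* = x -> x \in Crat.
Proof.
move=> [a [b ->]]; rewrite rmorphD /= [(_ * theta)^*]rmorphM /= theta_conj !conj_Crat ?Crat_rat // => E.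
have E2 : ratr b * - theta = ratr b * theta by apply: addrI E.
have : 2 * (ratr b * theta) = 0.
  by transitivity (ratr b * theta - ratr b * - theta); [ring | rewrite E2 subrr].
move/eqP; rewrite mulf_eq0 pnatr_eq0 => /eqP.
by move=> ->; rewrite addr0 Crat_rat.
Qed.

Section Points.
Variable q : 'I_5 -> form5 rat.
Implicit Types z : Z q.

Lemma section_in_Qtheta d (s : Z q -> algC) z : sections d s ->
    (forall i, in_Qtheta ((val z).1 0 i)) -> (forall i j, in_Qtheta ((val z).2 i j)) ->
  in_Qtheta (s z).
Proof.
move=> hs zt zM; have [a [b [F [G [_ _ Gz E]]]]] := hs z.
have evQ H : in_Qtheta (Z_eval H z).
  rewrite Z_evalE; apply: in_Qtheta_sum => m; apply: in_QthetaM; first exact: in_Qtheta_rat.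
  apply: in_Qtheta_prod => i; apply: in_QthetaX; case: (split_ordP i) => k ->.
    by rewrite Z_coords_lshift.
  by rewrite Z_coords_rshift; apply: in_Qtheta_det => r c; rewrite mxE.
by rewrite (E z Gz); apply: in_QthetaM => //; exact: in_QthetaV.
Qed.

Lemma inord5 k : (k < 5)%N -> nat_of_ord (inord k : 'I_5) = k.
Proof. by move=> k5; rewrite inordK. Qed.

(* The 2-planes of one ruling of Q0: with X = x2 + theta x0, X' = x2 - theta x0,
   W = x3 + theta x1 and W' = x3 - theta x1, the quadric is 2 X X' = W W' and
   the 2-plane is l W = m X, 2 l X' = m W'. *)
Definition ruling_plane (R : comNzRingType) (th l m : R) : 'M[R]_(3, 5) :=
  \matrix_(i, j) nth 0 (nth [::]
    [:: [:: l; m; th * l; th * m; 0];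
        [:: - m; - (2 * l); th * m; 2 * th * l; 0];
        [:: 0; 0; 0; 0; 1]] i) j.

Lemma mul_ruling_plane (R : comNzRingType) (th l m : R) (v : 'rV_3) :
  let w := v *m ruling_plane th l m in
  [/\ w 0 (inord 0) = v 0 0 * l - v 0 1 * m,
      w 0 (inord 1) = v 0 0 * m - 2 * v 0 1 * l,
      w 0 (inord 2) = th * (v 0 0 * l + v 0 1 * m),
      w 0 (inord 3) = th * (v 0 0 * m + 2 * v 0 1 * l) &
      w 0 (inord 4) = v 0 2%:R].
Proof.
have e0 : ord0 = 0 :> 'I_3 by [].
have e1 : lift ord0 ord0 = 1 :> 'I_3 by apply/val_inj.
have e2 : lift ord0 (lift ord0 ord0) = 2%:R :> 'I_3 by apply/val_inj.
by split; rewrite !mxE !big_ord_recl big_ord0 !mxE /= !inord5 //= e0 e1 e2; ring.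
Qed.

Lemma ruling_plane_rank (th l m : algC) : th != 0 -> (l, m) != (0, 0) ->
  \rank (ruling_plane th l m) = 3%N.
Proof.
move=> th0 lm; apply/eqP; rewrite -/(row_free _); apply: inj_row_free => v vM.
have [] := mul_ruling_plane th l m v; rewrite vM !mxE => E0 E1 E2 E3 E4.
have {}E2 : v 0 0 * l + v 0 1 * m = 0.
  by apply/eqP; move/esym/eqP: E2; rewrite mulf_eq0 (negPf th0).
have {}E3 : v 0 0 * m + 2 * v 0 1 * l = 0.
  by apply/eqP; move/esym/eqP: E3; rewrite mulf_eq0 (negPf th0).
have two0 : 2 != 0 :> algC by rewrite pnatr_eq0.
have al : v 0 0 * l = 0.
  apply: (mulfI two0); rewrite mulr0.
  transitivity ((v 0 0 * l - v 0 1 * m) + (v 0 0 * l + v 0 1 * m)); first by ring.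
  by rewrite -E0 E2 addr0.
have bm : v 0 1 * m = 0 by move: E2; rewrite al add0r.
have am : v 0 0 * m = 0.
  apply: (mulfI two0); rewrite mulr0.
  transitivity ((v 0 0 * m - 2 * v 0 1 * l) + (v 0 0 * m + 2 * v 0 1 * l)); first by ring.
  by rewrite -E1 E3 addr0.
have bl : v 0 1 * l = 0.
  by apply: (mulfI two0); rewrite mulr0; move: E3; rewrite am add0r mulrA.
have cancel (u : algC) : u * l = 0 -> u * m = 0 -> u = 0.
  move=> /eqP ul /eqP um; apply/eqP; move: lm; apply: contraNT => u0.
  by move: ul um; rewrite !mulf_eq0 (negPf u0) /= => /eqP -> /eqP ->.
apply/rowP => i; rewrite mxE; case: i => -[|[|[|//]]] lt.
- by rewrite -[RHS](cancel _ al am); congr (v _ _); apply/val_inj.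
- by rewrite -[RHS](cancel _ bl bm); congr (v _ _); apply/val_inj.
- by rewrite [RHS]E4; congr (v _ _); apply/val_inj.
Qed.

Hypothesis q_hom : forall i, homogeneous 2 (q i).

Lemma meval_Q0 (K : fieldType) (x : 'I_5 -> K) : meval x (Q0 K) =
  6 * x (inord 0) ^+ 2 - 3 * x (inord 1) ^+ 2 + 2 * x (inord 2) ^+ 2 - x (inord 3) ^+ 2.
Proof. by rewrite /Q0 mevalB mevalD mevalB !mevalZ !rmorphXn /= !mevalXU. Qed.

Lemma meval_Q1 (K : fieldType) (x : 'I_5 -> K) : meval x (Q1 K) =
  x (inord 0) * x (inord 1) + x (inord 2) * x (inord 3).
Proof. by rewrite /Q1 mevalD !mevalM !mevalXU. Qed.

Section QuadricPoint.
Variables (c : 'I_5 -> rat) (g : form5 rat).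
Hypotheses (gE : g = \sum_i c i *: q i) (g0 : g != 0).

Let t : 'rV[algC]_5 := \row_i ratr (c i).

Let t0 : t != 0.
Proof.
apply: contraNneq g0 => t0; rewrite gE big1 // => i _.
have := congr1 (fun w : 'rV_5 => w 0 i) t0; rewrite !mxE => /eqP.
by rewrite fmorph_eq0 => /eqP ->; rewrite scale0r.
Qed.

Let QtE : Qt q t = map_mpoly (ratr : rat -> algC) g.
Proof.
rewrite /Qt gE raddf_sum; apply: eq_bigr => i _ /=.
by rewrite mxE map_mpolyZ.
Qed.

Lemma plane_in_Z (M : 'M[algC]_(3, 5)) : \rank M = 3%N ->
    (forall v : 'rV_3, meval ((v *m M) 0) (map_mpoly (ratr : rat -> algC) g) = 0) ->
  Z q (t, M).
Proof.
move=> rM gM; split=> // x /= /submxP[v ->].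
by rewrite QtE; exact: gM.
Qed.

Lemma cone_coord_point (phi : Cone q rat) (z : Z q) : (val z).1 = t ->
    (forall d (s : sections d), ratr (val phi d s) = val s z :> algC) ->
  forall i, cone_coord phi 0 i = c i.
Proof.
move=> zt phiE i; rewrite mxE; apply: (fmorph_inj (ratr : {rmorphism rat -> algC})).
by rewrite /= phiE /= zt mxE.
Qed.
End QuadricPoint.

Lemma map_ruling_plane (R S : comNzRingType) (f : {rmorphism R -> S}) (th l m : R) :
  map_mx f (ruling_plane th l m) = ruling_plane (f th) (f l) (f m).
Proof.
apply/matrixP => i j; rewrite !mxE.
case: i => -[|[|[|//]]] hi; case: j => -[|[|[|[|[|//]]]]] hj /=;
  by rewrite ?(rmorphM, rmorphN, rmorph0, rmorph1, rmorph_nat).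
Qed.

Let Zpt tM (h : Z q tM) : Z q := exist (fun x => x \in Z q) tM (mem_set h).

(** Evaluate sections at one plane over the field of [theta]. Its complex conjugate lies in the same
    ruling, so the values are real, and elements of that field fixed by conjugation are rational. *)
Lemma point_over_Q0 (c : 'I_5 -> rat) : Q0 rat = \sum_i c i *: q i ->
  exists phi : Cone q rat, forall i, cone_coord phi 0 i = c i.
Proof.
move=> gE; have g0 : Q0 rat != 0.
  apply/eqP => Q00; have := meval_Q0 (fun i : 'I_5 => (i < 1)%:R : rat).
  by rewrite Q00 meval0 !inord5.
pose t : 'rV[algC]_5 := \row_i ratr (c i).
have inZ (th l m : algC) : th ^+ 2 = -3 -> (l, m) != (0, 0) -> Z q (t, ruling_plane th l m).
  move=> th2 lm; apply: (plane_in_Z gE g0).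
    by apply: ruling_plane_rank => //; rewrite -sqrf_eq0 th2 oppr_eq0 pnatr_eq0.
  move=> v; rewrite map_Q0 meval_Q0.
  have [-> -> -> ->  _] := mul_ruling_plane th l m v.
  rewrite !exprMn th2; ring.
have n1 (x : algC) : ((1 : algC), x) != (0, 0) by rewrite xpair_eqE oner_eq0.
have n2 (x : algC) : (x, (1 : algC)) != (0, 0) by rewrite xpair_eqE oner_eq0 andbF.
pose z1 x : Z q := Zpt (inZ theta 1 x theta_sqr (n1 x)).
pose z2 x : Z q := Zpt (inZ theta x 1 theta_sqr (n2 x)).
have th2 : (- theta) ^+ 2 = -3 by rewrite sqrrN theta_sqr.
pose z1c : Z q := Zpt (inZ (- theta) 1 0 th2 (n1 0)).
have real_s d (s : Z q -> algC) : sections d s -> (s (z1 0))^* = s (z1 0).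
  move=> hs.
  (* The planes [(1 : x)] and [(x : 1)] are the two charts of the ruling, so [s] is constant on
     it. *)
  have s12 : s (z1 0) = s (z2 0).
    apply: (@regular_inverse_constant _ (s \o z1) (s \o z2)).
    - apply: (section_regular (t := t) (M := ruling_plane theta%:P 1 'X) hs) => // x.
      by rewrite map_ruling_plane rmorph1 /= !horner_evalE hornerC hornerX.
    - apply: (section_regular (t := t) (M := ruling_plane theta%:P 'X 1) hs) => // x.
      by rewrite map_ruling_plane rmorph1 /= !horner_evalE hornerC hornerX.
    move=> x x0 /=; apply: (section_basis_change (g := diag_mx (\row_i nth 0 [:: x; x; 1] i)) hs) => //=.
    rewrite mul_diag_mx; apply/matrixP => i j; rewrite !mxE.
    case: i => -[|[|[|//]]] hi; case: j => -[|[|[|[|[|//]]]]] hj /=; by field.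
  have s1c : s z1c = (s (z1 0))^*.
    apply: (section_conj hs) => [i|] /=; first by rewrite !mxE conj_Crat ?Crat_rat.
    by rewrite map_ruling_plane rmorph1 rmorph0 /= theta_conj.
  (* The conjugate of the plane [(1 : 0)] is the plane [(0 : 1)] in another basis; [g] is the change
     of basis. *)
  have sc2 : s z1c = s (z2 0).
    pose g : 'M[algC]_3 := \matrix_(i, j) nth 0 (nth [::] [:: [:: 0; -1; 0]; [:: -2; 0; 0]; [:: 0; 0; 1]] i) j.
    apply: (section_basis_change (g := g) hs) => //=.
    apply/matrixP => i j; rewrite !mxE !big_ord_recl big_ord0 !mxE.
    case: i => -[|[|[|//]]] hi; case: j => -[|[|[|[|[|//]]]]] hj /=; by ring.
  by rewrite -s1c sc2 s12.
have [|phi phiE] := @cone_point q (z1 0).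
  move=> d s hs; apply: in_Qtheta_real; last exact: real_s hs.
  apply: section_in_Qtheta hs _ _ => /= [i|i j]; first by rewrite mxE; exact: in_Qtheta_rat.
  have q0 : in_Qtheta 0 by have := in_Qtheta_rat 0; rewrite rmorph0.
  have q1 : in_Qtheta 1 by have := in_Qtheta_rat 1; rewrite rmorph1.
  have qm : in_Qtheta (-2) by have := in_Qtheta_rat (-2); rewrite rmorphN /= ratr_nat.
  have q2 : in_Qtheta 2 by have := in_Qtheta_rat 2; rewrite ratr_nat.
  have qt := in_Qtheta_theta.
  rewrite mxE; case: i => -[|[|[|//]]] hi; case: j => -[|[|[|[|[|//]]]]] hj /=;
    rewrite ?(mulr0, mulr1, oppr0) //; exact: in_QthetaM.
by exists phi; apply: cone_coord_point phiE.
Qed.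

Lemma point_over_Q1 (c : 'I_5 -> rat) : Q1 rat = \sum_i c i *: q i ->
  exists phi : Cone q rat, forall i, cone_coord phi 0 i = c i.
Proof.
move=> gE; have g0 : Q1 rat != 0.
  apply/eqP => Q10; have := meval_Q1 (fun i : 'I_5 => (i < 2)%:R : rat).
  by rewrite Q10 meval0 !inord5 //= mulr1 mulr0 addr0 => /eqP; rewrite eq_sym oner_eq0.
pose t : 'rV[algC]_5 := \row_i ratr (c i).
(* The rational plane [x0 = x2 = 0] lies on Q1. *)
pose M : 'M[algC]_(3, 5) := \matrix_(i, j) nth 0 (nth [::]
  [:: [:: 0; 1; 0; 0; 0]; [:: 0; 0; 0; 1; 0]; [:: 0; 0; 0; 0; 1]] i) j.
have ME (v : 'rV_3) : let w := v *m M in [/\ w 0 (inord 0) = 0, w 0 (inord 1) = v 0 0,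
    w 0 (inord 2) = 0, w 0 (inord 3) = v 0 1 & w 0 (inord 4) = v 0 2%:R].
  have e1 : lift ord0 ord0 = 1 :> 'I_3 by apply/val_inj.
  have e2 : lift ord0 (lift ord0 ord0) = 2%:R :> 'I_3 by apply/val_inj.
  by split; rewrite !mxE !big_ord_recl big_ord0 !mxE /= !inord5 //= e1 e2; ring.
have inZ : Z q (t, M).
  apply: (plane_in_Z gE g0) => [|v]; last first.
    by rewrite map_Q1 meval_Q1; have [-> _ -> _ _] := ME v; rewrite !mul0r addr0.
  apply/eqP; rewrite -/(row_free _); apply: inj_row_free => v vM.
  have [_ v0 _ v1 v2] := ME v; rewrite vM !mxE in v0 v1 v2.
  apply/rowP => i; rewrite mxE; case: i => -[|[|[|//]]] lt.
  - by rewrite [RHS]v0; congr (v _ _); apply/val_inj.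
  - by rewrite [RHS]v1; congr (v _ _); apply/val_inj.
  - by rewrite [RHS]v2; congr (v _ _); apply/val_inj.
pose z : Z q := Zpt inZ.
have [|phi phiE] := @cone_point q z.
  move=> d s hs; apply: in_Qtheta_real.
    apply: section_in_Qtheta hs _ _ => /= [i|i j]; first by rewrite mxE; exact: in_Qtheta_rat.
    have q0 : in_Qtheta 0 by have := in_Qtheta_rat 0; rewrite rmorph0.
    have q1 : in_Qtheta 1 by have := in_Qtheta_rat 1; rewrite rmorph1.
    by rewrite mxE; case: i => -[|[|[|//]]] hi; case: j => -[|[|[|[|[|//]]]]] hj.
  apply/esym/(section_conj hs) => [i|] /=; first by rewrite !mxE conj_Crat ?Crat_rat.
  apply/matrixP => i j; rewrite !mxE.
  by case: i => -[|[|[|//]]] hi; case: j => -[|[|[|[|[|//]]]]] hj; rewrite /= ?rmorph0 ?rmorph1.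
by exists phi; apply: cone_coord_point phiE.
Qed.
End Points.

(** * Failure of weak approximation *)

Lemma nbhs_proj (I : Type) (T : I -> topologicalType) (f : prod_topology T) i
    (A : set (T i)) : nbhs (f i) A -> nbhs f [set g | A (g i)].
Proof.
move=> fA; have /cvg_sup/(_ i) h : f --> f by exact: cvg_id.
by apply: h; exact: (@initial_continuous _ _ (fun g : forall i, T i => g i)).
Qed.

(** * Open conditions on local points *)

Section CompletionNorm.
Variables (R : realType) (v : place) (C : completion R v).
Local Notation norm := (@compl_norm R v C).

Lemma compl_norm0 : norm 0 = 0.
Proof.
rewrite -(rmorph0 (compl_embed C)) compl_norm_embed.
have -> : place_norm v 0 = 0.
  by case: v => [|p _] /=; rewrite ?normr0 // /padic_norm eqxx.
exact: rmorph0.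
Qed.

Lemma compl_normN x : norm (- x) = norm x.
Proof.
rewrite -mulN1r compl_normM -(rmorphN1 (compl_embed C)) compl_norm_embed.
have -> : place_norm v (-1) = 1; last by rewrite rmorph1 mul1r.
case: v => [|p p_prime] /=; first by rewrite normrN1.
by rewrite padic_normN padic_norm1.
Qed.

Lemma compl_norm_ge0 x : 0 <= norm x.
Proof.
have := compl_normD x (- x); rewrite subrr compl_norm0 compl_normN.
by rewrite -mulr2n pmulrn_lge0.
Qed.

Lemma compl_norm_gt0 x : x != 0 -> 0 < norm x.
Proof.
move=> x0; rewrite lt_def compl_norm_ge0 andbT; apply: contraNneq x0.
by move/compl_norm_eq0 => ->.
Qed.

Lemma nbhs_norm_lt (x : Qcompl C) (e : R) : 0 < e ->
  nbhs x [set y : Qcompl C | norm (y - x) < e].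
Proof. by move=> e0; exists e. Qed.
End CompletionNorm.

Section LocalPoints.
Variable q : 'I_5 -> form5 rat.
Variables (R : realType) (v : place) (C : completion R v).
Local Notation norm := (@compl_norm R v C).
Variables (s1 s2 : @sections q 1).

Let lt_cone (phi : Cone q (Qcompl C)) : Prop := norm (val phi 1%N s1) < norm (val phi 1%N s2).

Let cone_near (phi : Cone q (Qcompl C)) (s : @sections q 1) (e : R) : 0 < e ->
  \forall psi \near phi, norm (val psi 1%N s - val phi 1%N s) < e.
Proof.
move=> e0.
have h1 := nbhs_norm_lt (val phi 1%N s) e0.
have h2 := @nbhs_proj _ (fun _ : @sections q 1 => Qcompl C) (val phi 1%N) s _ h1.
have h3 := @nbhs_proj _ (fun d => prod_topology (fun _ : @sections q d => Qcompl C)) (val phi) 1%N _ h2.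
exact: (@initial_continuous _ (prod_topology (fun d => prod_topology (fun _ : @sections q d => Qcompl C))) set_val phi _ h3).
Qed.

Let open_lt_cone : open (lt_cone : set (Cone q (Qcompl C))).
Proof.
rewrite openE => phi lt_phi.
pose e := (norm (val phi 1%N s2) - norm (val phi 1%N s1)) / 2.
have e0 : 0 < e by rewrite divr_gt0 // subr_gt0.
apply: filterS2 (cone_near phi s1 e0) (cone_near phi s2 e0) => psi h1 h2.
rewrite /lt_cone.
have t1 := compl_normD (val psi 1%N s1 - val phi 1%N s1) (val phi 1%N s1).
have t2 := compl_normD (val phi 1%N s2 - val psi 1%N s2) (val psi 1%N s2).
rewrite !subrK in t1 t2; rewrite -compl_normN opprB in h2.
move: t1 t2 h1 h2; rewrite /e.
move: (norm (val psi 1%N s1)) (norm (val psi 1%N s2)) (norm (val phi 1%N s1)) (norm (val phi 1%N s2)).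
move: (norm (_ - _)) (norm (_ - _)) => a b c d f g ? ? ? ?; lra.
Qed.

(** Both sections have degree 1, so that rescaling the representative multiplies the two norms by
    the same factor. *)
Definition section_lt (y : Y_local q C) : Prop := lt_cone (repr (y : Y q (Qcompl C))).

Lemma section_lt_pi (phi : Cone q (Qcompl C)) :
  section_lt (\pi_(Y q (Qcompl C)) phi)%qT <->
  norm (val phi 1%N s1) < norm (val phi 1%N s2).
Proof.
rewrite /section_lt /lt_cone; case: piP => psi /eqmodP /= /asboolP[c c0 h].
by rewrite !h !expr1 !compl_normM ltr_pM2l // compl_norm_gt0.
Qed.

Lemma open_section_lt : open (section_lt : set (Y_local q C)).
Proof.
rewrite /open /= /quotient_open.
rewrite (_ : _ @^-1` _ = lt_cone); first exact: open_lt_cone.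
by apply/seteqP; split => phi /section_lt_pi.
Qed.

Lemma section_lt_rat (phi : Cone q rat) :
  section_lt (Y_map (compl_embed C : {rmorphism rat -> Qcompl C}) (\pi_(Y q rat) phi)%qT) <->
  place_norm v (val phi 1%N s1) < place_norm v (val phi 1%N s2).
Proof.
by rewrite Y_mapE section_lt_pi /= !compl_norm_embed ltr_rat.
Qed.
End LocalPoints.

Section LinearSections.
Variable q : 'I_5 -> form5 rat.

Definition linear_form (w : 'I_5 -> rat) : mpoly 5 rat :=
  \sum_i w i *: mpolyX rat (mnm1 i).

Lemma sections_linear (w : 'I_5 -> rat) : @sections q 1 (fun z : Z q =>
  meval ((val z).1 0) (map_mpoly (ratr : rat -> algC) (linear_form w))).
Proof.
move=> z; exists 0%N, 0%N, (\sum_i w i *: tvar i), (mpolyC _ 1).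
rewrite bihomogeneousC Z_evalC rmorph1 oner_neq0; split=> //.
  by apply: bihomogeneous_sum => i _; apply/bihomogeneousZ/bihomogeneous_tvar.
move=> z' _; rewrite Z_evalC rmorph1 divr1 Z_eval_sum /linear_form.
rewrite [map_mpoly _ _]raddf_sum /= raddf_sum; apply: eq_bigr => i _ /=.
by rewrite map_mpolyZ map_mpolyX mevalZ mevalXU Z_evalZ Z_eval_tvar.
Qed.

Definition linear_section w : @sections q 1 := to_section (sections_linear w).

Lemma cone_linear (phi : Cone q rat) w :
  val phi 1%N (linear_section w) = \sum_i w i * cone_coord phi 0 i.
Proof.
rewrite (@cone_poly _ phi _ (linear_form w)) //; last first.
  apply: (@weight_homogeneous_sum _ _ mdeg) => i _; apply: weight_homogeneousZ.
  by apply: weight_homogeneousX; rewrite mdeg1.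
rewrite /linear_form raddf_sum; apply: eq_bigr => i _ /=.
by rewrite mevalZ mevalXU.
Qed.

Definition entry_coef (i j : 'I_5) (k : 'I_5) : rat := polar (q k) i j.

Lemma cone_entry (phi : Cone q rat) i j :
  \sum_k entry_coef i j k * cone_coord phi 0 k = cone_pencil phi i j.
Proof.
by rewrite /cone_pencil summxE; apply: eq_bigr => k _; rewrite [RHS]mxE mulrC.
Qed.
End LinearSections.

Lemma place_norm_ge0 v (x : rat) : 0 <= place_norm v x.
Proof. by case: v => [|p p_prime] /=; rewrite ?padic_norm_ge0. Qed.

Lemma place_norm0_lt v (x : rat) : x != 0 -> place_norm v 0 < place_norm v x.
Proof.
rewrite -(place_norm_gt0 v) => x0; apply: le_lt_trans x0.
by case: v => [|p p_prime] /=; rewrite ?normr0 ?padic_norm0.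
Qed.

Lemma polar_Q1 (i j : 'I_5) : polar (Q1 rat) i j =
  ((nat_of_ord i, nat_of_ord j) \in [:: (0, 1); (1, 0); (2, 3); (3, 2)]%N)%:R.
Proof.
rewrite /Q1 polarD !polar_mulX !mxE !inord_eq //.
by case: i => -[|[|[|[|[|//]]]]] hi; case: j => -[|[|[|[|[|//]]]]] hj.
Qed.

Lemma polar_Q0 (i j : 'I_5) : polar (Q0 rat) i j =
  (nth 0 [:: 12; -6; 4; -2; 0] i : rat) *+ (i == j).
Proof.
rewrite /Q0 -!scaleNr -(scaleN1r (xvar _ 3 ^+ 2)) !polarD !polarZ !expr2 !polar_mulX !mxE !inord_eq //.
by case: i => -[|[|[|[|[|//]]]]] hi; case: j => -[|[|[|[|[|//]]]]] hj //=; rewrite -val_eqE /=; ring.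
Qed.

Section WeakApproximation.
Variables (q : 'I_5 -> form5 rat) (S : nat).
Hypothesis q_plane : plane_through_Q0_Q1 q.
Hypothesis S_gt0 : (0 < S)%N.
Hypothesis q_generic : forall p (p_prime : prime p), odd p -> ~~ (p %| S)%N ->
  forall t : 'rV[rat]_5, t != 0 ->
  nonCS (Padic p_prime) (bilin (\sum_i t 0 i *: polar (q i))).
Variables (R : realType) (Qv : forall v : place, completion R v).

(** Two inequalities between linear sections by which the first two unit vectors violate
    Cauchy-Schwarz. At Q1 the three entries are 0, 0 and 1. *)
Let split_near (v : place) (y : Y_local q (Qv v)) : Prop :=
  section_lt (linear_section q (entry_coef q (inord 0) (inord 0)))
             (linear_section q (entry_coef q (inord 0) (inord 1))) y /\
  section_lt (linear_section q (entry_coef q (inord 1) (inord 1)))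
             (linear_section q (entry_coef q (inord 0) (inord 1))) y.

Let e33 := entry_coef q (inord 3) (inord 3).

(** The hypothesis of [near_Q0_anisotropic] for one entry; [e33], which is -2 at Q0, fixes the
    scale. *)
Let nonsplit_entry (v : place) (i j : 'I_4) : set (Y_local q (Qv v)) :=
  section_lt (linear_section q (fun k => 2 * entry_coef q (lshift 1 i) (lshift 1 j) k +
                                 (Q0_diag 0 i *+ (i == j))%:~R * e33 k))
             (linear_section q (fun k => 16 * e33 k)).

Let nonsplit_near (v : place) (y : Y_local q (Qv v)) : Prop :=
  forall i j : 'I_4, nonsplit_entry i j y.

Let open_split v : open (@split_near v : set (Y_local q (Qv v))).
Proof. by apply: openI; exact: open_section_lt. Qed.

Let nbhs_nonsplit v y : @nonsplit_near v y -> nbhs y (@nonsplit_near v).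
Proof.
move=> ny; rewrite /nonsplit_near.
apply: (@filter_forall _ _ (fun i x => forall j, @nonsplit_entry v i j x) (nbhs y) (nbhs_filter y)) => i.
apply: (@filter_forall _ _ (fun j => @nonsplit_entry v i j) (nbhs y) (nbhs_filter y)) => j.
by apply: open_nbhs_nbhs; split; [exact: open_section_lt | exact: ny].
Qed.

Let split_nonCS (v : place) (phi : Cone q rat) :
    @split_near v (Y_map (compl_embed (Qv v) : {rmorphism rat -> Qcompl (Qv v)})
                     (\pi_(Y q rat) phi)%qT) ->
  nonCS v (bilin (cone_pencil phi)).
Proof.
move=> [/section_lt_rat h0 /section_lt_rat h1].
rewrite !cone_linear !cone_entry in h0 h1.
exists (delta_mx 0 (inord 0)), (delta_mx 0 (inord 1)); rewrite !bilin_delta place_normM.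
by rewrite expr2 ltr_pM // place_norm_ge0.
Qed.

Let nonsplit_entry_rat (v : place) (phi : Cone q rat) i j :
    let e := cone_pencil phi (inord 3) (inord 3) in
  @nonsplit_entry v i j (Y_map (compl_embed (Qv v) : {rmorphism rat -> Qcompl (Qv v)})
                           (\pi_(Y q rat) phi)%qT) <->
  place_norm v (2 * cone_pencil phi (lshift 1 i) (lshift 1 j) +
                e * (Q0_diag 0 i *+ (i == j))%:~R) < place_norm v (16 * e).
Proof.
move=> e; rewrite /nonsplit_entry section_lt_rat !cone_linear.
rewrite (_ : \sum_k _ = 2 * cone_pencil phi (lshift 1 i) (lshift 1 j) +
                       e * (Q0_diag 0 i *+ (i == j))%:~R); last first.
  rewrite /e -!cone_entry mulr_sumr mulr_suml -big_split /=; apply: eq_bigr => k _.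
  by rewrite /e33; ring.
rewrite (_ : \sum_k _ = 16 * e) // /e -cone_entry mulr_sumr.
by apply: eq_bigr => k _; rewrite mulrA.
Qed.

Let nonsplit_anisotropic (p2 : prime 2) (phi : Cone q rat) :
    @nonsplit_near (Padic p2) (Y_map (compl_embed (Qv (Padic p2)) : {rmorphism rat -> Qcompl (Qv (Padic p2))})
                     (\pi_(Y q rat) phi)%qT) ->
  ~ isotropic (bilin (ulsubmx (cone_pencil phi : 'M_(4 + 1)))).
Proof.
move=> near; apply: (near_Q0_anisotropic (e := cone_pencil phi (inord 3) (inord 3))) => i j.
have -> : ulsubmx (cone_pencil phi : 'M_(4 + 1)) i j = cone_pencil phi (lshift 1 i) (lshift 1 j).
  by rewrite !mxE.
by move: (near i j) => /nonsplit_entry_rat.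
Qed.

Let no_rational (phi : Cone q rat) (p2 : prime 2) :
    let y := (\pi_(Y q rat) phi)%qT in
    @split_near Archimedean (Y_diagonal Qv y Archimedean) ->
    (forall p (p_prime : prime p), odd p -> (p %| S)%N ->
       @split_near (Padic p_prime) (Y_diagonal Qv y (Padic p_prime))) ->
    @nonsplit_near (Padic p2) (Y_diagonal Qv y (Padic p2)) ->
  False.
Proof.
move=> y /split_nonCS at_inf at_odd /nonsplit_anisotropic aniso.
have [[q_hom _] _ _] := q_plane.
pose A := cone_pencil phi; have symA : A^T = A.
  by rewrite /A /cone_pencil raddf_sum; apply: eq_bigr => k _; rewrite /= linearZ /= polar_sym.
have [s sE] := cone_minor_sqr phi q_hom.
(* A singular corner would have a kernel vector, which is isotropic. *)
have s0 : s != 0.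
  apply/eqP => s0; apply: aniso.
  have /eqP/det0P[x x0 xB] : \det (ulsubmx (A : 'M_(4 + 1))) = 0 by rewrite sE s0 expr0n.
  by exists x => //; rewrite /bilin xB mul0mx mxE.
have := @quinary_local_global (A : 'M_(4 + 1)) s symA (cone_det0 phi q_hom) sE s0.
move=> glob; apply/aniso/glob; split; first exact: at_inf.
move=> p p_prime p_odd; have [pS|pS] := boolP (p %| S)%N.
  by apply: split_nonCS; exact: at_odd.
exact: q_generic (cone_coord_neq0 phi).
Qed.

Theorem weak_approximation_fails :
  Y_rational_closure q Qv !=set0 /\ ~ Y_weak_approximation q Qv.
Proof.
have [q4 [c0 E0] [c1 E1]] := q_plane.
have [phi0 phi0E] := point_over_Q0 E0; have [phi1 phi1E] := point_over_Q1 E1.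
have pencil0 : cone_pencil phi0 = polar (Q0 rat).
  by rewrite E0 polar_sum; apply: eq_bigr => i _; rewrite phi0E.
have pencil1 : cone_pencil phi1 = polar (Q1 rat).
  by rewrite E1 polar_sum; apply: eq_bigr => i _; rewrite phi1E.
pose y0 := (\pi_(Y q rat) phi0)%qT; pose y1 := (\pi_(Y q rat) phi1)%qT.
split; first by exists (Y_diagonal Qv y1); apply: subset_closure; exists y1.
have p2 : prime 2 by [].
have y1_split v : @split_near v (Y_diagonal Qv y1 v).
  split; apply/section_lt_rat; rewrite !cone_linear !cone_entry pencil1 !polar_Q1 !inordK //;
    exact: place_norm0_lt.
have y0_nonsplit : @nonsplit_near (Padic p2) (Y_diagonal Qv y0 (Padic p2)).
  move=> i j; apply/nonsplit_entry_rat; rewrite pencil0 !polar_Q0.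
  have e3 : nat_of_ord (inord 3 : 'I_5) = 3%N by rewrite inordK.
  (* At Q0 itself the left side is exactly 0. *)
  rewrite e3 eqxx mulr1n (_ : 2 * _ + _ = 0); first exact: place_norm0_lt.
  rewrite (inj_eq (@lshift_inj 4 1)) mxE; case: eqP => _; last by rewrite !mulr0n !mulr0 addr0.
  by case: i => -[|[|[|[|//]]]] hi; rewrite /= !mulr1n; ring.
(* The place 2 is recognized by its number, since [Padic] also carries a proof of primality. *)
pose at2 v := if v is Padic p _ then p == 2%N else false.
pose x : Y_adelic q Qv := fun v => if at2 v then Y_diagonal Qv y0 v else Y_diagonal Qv y1 v.
move=> wa; have xcl : Y_rational_closure q Qv x by rewrite wa.
have near_split v : ~~ at2 v -> \forall y \near x, @split_near v (y v).
  move=> v2; apply: nbhs_proj; rewrite /x (negPf v2).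
  by apply: open_nbhs_nbhs; split; [exact: open_split | exact: y1_split].
have near_nonsplit : \forall y \near x, @nonsplit_near (Padic p2) (y (Padic p2)).
  by apply: nbhs_proj; exact: nbhs_nonsplit.
pose odd_split (l : seq nat) : set (Y_adelic q Qv) := [set y | forall p (p_prime : prime p),
  odd p -> p \in l -> @split_near (Padic p_prime) (y (Padic p_prime))].
have FF := nbhs_filter x.
(* A neighbourhood in the product restricts finitely many places only; the list will be
   [primes S]. *)
have near_odd l : nbhs x (odd_split l).
  elim: l => [|r l IH].
    by apply: (@filterS _ _ FF setT); [move=> y _ p p_prime _; rewrite in_nil | exact: filterT].
  have [/andP[r_prime r_odd]|r_np] := boolP (prime r && odd r); last first.
    apply: (@filterS _ _ FF (odd_split l)) IH => y h p p_prime p_odd.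
    rewrite in_cons => /orP[/eqP pr|]; last exact: h.
    by move: r_np; rewrite -pr p_prime p_odd.
  have r2 : ~~ at2 (Padic r_prime) by rewrite /at2; apply: contraL r_odd => /eqP ->.
  apply: (@filterS2 _ _ FF) IH (near_split _ r2) => y h hr p p_prime p_odd.
  rewrite in_cons => /orP[/eqP pr|]; last exact: h.
  (* Any two proofs that [r] is prime give the same place. *)
  by move: p_prime {p_odd}; rewrite pr => p_prime; rewrite (bool_irrelevance p_prime r_prime).
have near_inf := near_split Archimedean isT.
have [z [[y _ <-] [[inf_y odd_y] non_y]]] :=
  xcl _ (filterI (filterI near_inf (near_odd (primes S))) near_nonsplit).
apply: (@no_rational (repr y) p2); rewrite reprK //.
by move=> p p_prime p_odd pS; apply: odd_y => //; rewrite mem_primes p_prime S_gt0 pS.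
Qed.
End WeakApproximation.

(** [C] consists of the combinations that produce the cubic monomials on the example plane, where
    [minor_matrix] is therefore the identity. *)
Lemma generic_poly_nonempty :
  exists C, nonempty_zariski_open [:: generic_poly example_columns C].
Proof.
have [c cE] := fin_all_exists example_minors_span.
pose C (fg : minor_index) (a : 'I_ncubics) := c a fg.
have M1 : minor_matrix idfun C (fun k => polar (example_plane rat k)) = 1%:M.
  by apply/matrixP => a e; rewrite [LHS]mxE [RHS]mxE cE.
exists C; split.
  by move=> F; rewrite inE => /eqP ->; exists (1 + ncubics * 3)%N; exact: generic_poly_homogeneous.
exists (example_plane algC); first exact: example_through.
exists (generic_poly example_columns C); first exact: mem_head.
rewrite meval_generic_poly example_column_minor det1 mul1r.
have -> : (fun k => polar (adjugate_basis example_columns (example_plane algC) k)) =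
    (fun k => map_mx ratr (polar (example_plane rat k))).
  by apply/funext => k; rewrite example_adjugate -polar_map map_example.
have := det_minor_matrix_map (ratr : rat -> algC) idfun C (fun k => polar (example_plane rat k)).
by rewrite M1 det1 rmorph1 => <-; exact: oner_neq0.
Qed.

Theorem proposition3p10 :
  exists U : seq plane_poly, nonempty_zariski_open U /\
  forall q : 'I_5 -> form5 rat, plane_through_Q0_Q1 q -> in_zariski_open U q ->
  forall (R : realType) (Qv : forall v : place, completion R v),
    [/\ Y_rational_closure q Qv !=set0,
        Y_rational_closure q Qv `<` setT &
        ~ Y_weak_approximation q Qv].
Proof.
have [C nonempty] := generic_poly_nonempty; exists [:: generic_poly example_columns C].
split=> // q q_plane /generic_plane_nonCS[S S_gt0 q_generic] R Qv.
have [ne nWA] := weak_approximation_fails q_plane S_gt0 q_generic Qv.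
split=> //; split=> [//|sub]; apply: nWA; apply/seteqP; split=> [//|]; exact: sub.
Qed.
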